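(* Let $\mathcal{F}$ be one of the hypothesis classes $\mathcal{F}_{\mathrm{RatNN}}$, $\mathcal{F}^T_{\mathrm{RatNN}}$, $\mathcal{F}_{\mathrm{RatCNN}}$, $\mathcal{F}^T_{\mathrm{RatCNN}}$ of depth-$L$ rational networks with activations in $R^s_s$ defined in the context. Suppose the loss function $\ell$ is Lipschitz with constant $\|\ell\|_{\mathrm{Lip}}$ in its first argument (for each value of the second) and has range in $[0,H]$, and $\operatorname{im}(\rho_L)\subseteq[-t,t]$. Denote by $N$ the number of parameters and $\alpha=\min\{H,\,t\|\ell\|_{\mathrm{Lip}}\sqrt{d_L}\}$. Then, with an absolute constant $c$, $$\sup_{X\in\mathbb{R}^{d_0\times n}}\mathfrak{R}_S(\mathcal{F};\ell)\;\leq\; c\,\alpha\sqrt{\frac{N}{n}}\left(\sqrt{\pi}+\sqrt{\log\frac{tW\|\ell\|_{\mathrm{Lip}}}{\alpha\sqrt n}}\right),$$ where, for an absolute constant $c'$, $W=c'N(nd_L)^{5/2}s^L\prod_{j=1}^{L-1}d_j$ for $\mathcal{F}_{\mathrm{RatNN}},\mathcal{F}^T_{\mathrm{RatNN}}$ and $W=c'N(nd_L)^{5/2}s^Lk^{2(L-1)}\prod_{j=1}^{L-1}c_j$ for $\mathcal{F}_{\mathrm{RatCNN}},\mathcal{F}^T_{\mathrm{RatCNN}}$. In particular, write $D=\max_{i\leq L-1}d_i$ for $\mathcal{F}_{\mathrm{RatNN}}$ and its trainable variant, and $D=k^2\max_{i\leq L-1}c_i$ for $\mathcal{F}_{\mathrm{RatCNN}}$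 and its trainable variant. Suppose ($\ast$): $t$, $H$ and $\|\ell\|_{\mathrm{Lip}}$ are $\mathcal{O}(1)$, and $\log d_L$, $\log n$ are $\mathcal{O}(L\log(sD))$. Then $$\sup_{X\in\mathbb{R}^{d_0\times n}}\mathfrak{R}_S(\mathcal{F};\ell)=\mathcal{O}\left(n^{-1/2}\cdot\sqrt{NL\log(sD)}\right).$$ If in fact the classification loss is $\mathrm{CrossEntropy}(\mathrm{softmax}(f(x)),y)$, where $y_i=1$ for data in class $i$ and $y_i=0$ otherwise, then under ($\ast$): $$\sup_{X\in\mathbb{R}^{d_0\times n}}\mathfrak{R}_S(\mathcal{F};\ell)=\mathcal{O}\left(n^{-1/2}\cdot(t+\log d_L)\sqrt{NL\log(sD)}\right).$$ In all of these cases, the generalization error is then bounded via the standard Rademacher complexity inequality recalled in the context.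
   Context: Rational functions: $R^a_b$ is the set of functions $\rho=p/q$ with $p,q$ real polynomials, $\deg p\le a$, $\deg q\le b$, defined on an open dense subset. Univariate activations are applied entrywise. Rational fully connected networks: $f(x)=\rho_L\big[A_L(\cdots\rho_1(A_1x+b_1)\cdots)+b_L\big]$ from $\mathbb{R}^{d_0}$ to $\mathbb{R}^{d_L}$, with $\rho_i\in R^s_s$, weight matrices $A_i\in\mathbb{R}^{d_i\times d_{i-1}}$, biases $b_i\in\mathbb{R}^{d_i}$, $i=1,\dots,L$. Rational convolutional networks: the same with $A_i x$ replaced by $\mathcal{K}_i x$, where $\mathcal{K}_i\in\mathbb{R}^{c_i\times c_{i-1}\times k\times k}$ is a convolution kernel mapping $\mathbb{R}^{d_{i-1}}$ to $\mathbb{R}^{d_i}$ ($d_i$ is the total size of the ''image'' with $c_i$ channels; strides and zero or constant padding allowed). Classes: in $\mathcal{F}_{\mathrm{RatNN}}$, $\mathcal{F}_{\mathrm{RatCNN}}$ the activations $\rho_i\in R^s_s$ are fixed and the parameters are the entries of $A_i$ (resp. $\mathcal{K}_i$) and $b_i$; in $\mathcal{F}^T_{\mathrm{RatNN}}$, $\mathcal{F}^T_{\mathrm{RatCNN}}$ the coefficients of the $\rho_i\in R^s_s$ are parameters as well (only parameters for which $\operatorname{im}(\rho_L)\subseteq[-t,t]$ are considered). Rademacher complexity: for a sample $S=\{(x_i,y_i)\}_{i=1}^n$ with $X=(x_1|\cdots|x_n)\in\mathbb{R}^{d_0\times n}$, $\mathfrak{R}_S(\mathcal{F};\ell)=\mathbb{E}_\sigma\sup_{f\in\mathcal{F}}\frac1n\sum_{i=1}^n\sigma_i\,\ell(f(x_i),y_i)$,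 with $\sigma_i$ independent Rademacher variables ($\pm1$ with equal probability). Generalization error: for i.i.d. data $(x_i,y_i)\sim\mathcal{D}$, $\mathrm{GE}_S(\mathcal{F};\ell)=\sup_{f\in\mathcal{F}}\big(\mathbb{E}_{(x,y)\sim\mathcal{D}}\ell(f(x),y)-\frac1n\sum_{i=1}^n\ell(f(x_i),y_i)\big)$. Standard inequality: if $\ell$ has range in $[0,1]$, then with probability at least $1-\delta$ over $S$, $\mathrm{GE}_S(\mathcal{F};\ell)\le 2\mathfrak{R}_S(\mathcal{F};\ell)+3\sqrt{\log(2/\delta)/(2n)}$. Softmax is $\mathrm{softmax}(z)_i=e^{z_i}/\sum_j e^{z_j}$ and $\mathrm{CrossEntropy}(q,y)=-\sum_i y_i\log q_i$. $\log$ is the natural logarithm. *)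

(* Defs.v *)
From HB Require Import structures.
From mathcomp Require Import all_boot all_order all_algebra.
From mathcomp Require Import all_classical all_reals all_analysis.

Set Implicit Arguments.
Unset Strict Implicit.
Unset Printing Implicit Defensive.

Import Order.TTheory GRing.Theory Num.Theory.

Local Open Scope classical_set_scope.
Local Open Scope ring_scope.

(** * Rational activations *)

(* An element of R^a_b is kept as a formal quotient; it is the function
   num / den on the open dense set where den does not vanish. *)
Record ratfun (R : realType) (a b : nat) := RatFun {
  num : {poly R};
  den : {poly R};
  num_deg : (size num <= a.+1)%N;
  den_deg : (size den <= b.+1)%N;
  den_neq0 : den != 0
}.

Definition rateval (R : realType) (a b : nat) (rho : ratfun R a b) (x : R) : R :=
  (num rho).[x] / (den rho).[x].

Definition im_within (R : realType) (a b : nat) (rho : ratfun R a b) (t : R) :=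
  forall x : R, (den rho).[x] != 0 -> - t <= rateval rho x <= t.

(* A partial function, with None off the domain of definition. *)
Definition pfun (R : realType) (d m : nat) := 'cV[R]_d -> option 'cV[R]_m.

(* Entrywise application, undefined as soon as one entry is at a pole. *)
Definition activate (R : realType) (a b m : nat) (rho : ratfun R a b) :
    pfun R m m :=
  fun u => if [forall j, (den rho).[u j 0] != 0]
           then Some (map_mx (rateval rho) u) else None.

(** * Convolutions *)

Record conv_geom (R : realType) := ConvGeom {
  stride_v : nat; stride_h : nat;
  pad_top : nat; pad_bottom : nat; pad_left : nat; pad_right : nat;
  pad_value : R
}.

(* Entry (r, q) of the padded image, whose top-left corner is (0, 0). *)
Definition padded (R : realType) (h w : nat) (g : conv_geom R) (im : 'M[R]_(h, w))
    (r q : nat) : R :=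
  if (pad_top g <= r)%N && (pad_left g <= q)%N then
    match insub (r - pad_top g)%N, insub (q - pad_left g)%N with
    | Some i, Some j => im i j
    | _, _ => pad_value g
    end
  else pad_value g.

Definition conv_kernel (R : realType) (k c c' : nat) :=
  'I_c' -> 'I_c -> 'M[R]_(k, k).

(* Images with c channels of size h x w are flattened, channel by channel,
   to vectors of dimension c * (h * w). *)
Definition channel (R : realType) (c h w : nat) (u : 'cV[R]_(c * (h * w)))
    (i : 'I_c) : 'M[R]_(h, w) :=
  vec_mx (row i (vec_mx u^T)).

Definition convolution (R : realType) (k c h w c' h' w' : nat) (g : conv_geom R)
    (K : conv_kernel R k c c') (u : 'cV[R]_(c * (h * w))) :
    'cV[R]_(c' * (h' * w')) :=
  (mxvec (\matrix_(o < c') mxvec (\matrix_(a < h', b < w')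
     \sum_(i < c) \sum_(p < k) \sum_(q < k)
       K o i p q * padded g (channel u i) (a * stride_v g + p)%N
                                          (b * stride_h g + q)%N)))^T.

Definition conv_fits (R : realType) (k h w h' w' : nat) (g : conv_geom R) :=
  [/\ (0 < stride_v g)%N, (0 < stride_h g)%N,
      (k <= pad_top g + h + pad_bottom g)%N
        /\ (k <= pad_left g + w + pad_right g)%N,
      h' = ((pad_top g + h + pad_bottom g - k) %/ stride_v g).+1%N
    & w' = ((pad_left g + w + pad_right g - k) %/ stride_h g).+1%N].

(** * Network architectures *)

(* Families are indexed by nat; a network of depth L only uses the dimensions
   of index 0, ..., L and the layers of index 0, ..., L - 1, where layer i maps
   dimension i to dimension i + 1. *)
Inductive arch (R : realType) :=
| FullyConnected (d : nat -> nat)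
| Convolutional (k : nat) (c h w : nat -> nat) (g : nat -> conv_geom R).

Definition layer_dim (R : realType) (a : arch R) (i : nat) : nat :=
  match a with
  | FullyConnected d => d i
  | Convolutional _ c h w _ => c i * (h i * w i)
  end%N.

Definition arch_wf (R : realType) (a : arch R) (L : nat) : Prop :=
  match a with
  | FullyConnected d => forall i, (i <= L)%N -> (0 < d i)%N
  | Convolutional k c h w g =>
      [/\ (0 < k)%N,
          forall i, (i <= L)%N -> [/\ (0 < c i)%N, (0 < h i)%N & (0 < w i)%N]
        & forall i, (i < L)%N -> conv_fits k (h i) (w i) (h i.+1) (w i.+1) (g i)]
  end.

Definition weights (R : realType) (a : arch R) (i : nat) : Type :=
  match a with
  | FullyConnected d => 'M[R]_(d i.+1, d i)
  | Convolutional k c _ _ _ => conv_kernel R k (c i) (c i.+1)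
  end.

Definition linear_part (R : realType) (a : arch R) (i : nat) :
    weights a i -> 'cV[R]_(layer_dim a i) -> 'cV[R]_(layer_dim a i.+1) :=
  match a return weights a i -> 'cV[R]_(layer_dim a i) ->
                 'cV[R]_(layer_dim a i.+1) with
  | FullyConnected d => fun A x => A *m x
  | Convolutional k c h w g => fun K x => convolution (h i.+1) (w i.+1) (g i) K x
  end.

Definition num_weights (R : realType) (a : arch R) (i : nat) : nat :=
  match a with
  | FullyConnected d => d i.+1 * d i
  | Convolutional k c _ _ _ => c i.+1 * c i * k * k
  end%N.

Fixpoint network (R : realType) (s : nat) (a : arch R)
    (rho : nat -> ratfun R s s) (A : forall i, weights a i)
    (b : forall i, 'cV[R]_(layer_dim a i.+1)) (L : nat) :
    pfun R (layer_dim a 0) (layer_dim a L) :=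
  match L with
  | 0%N => fun x => Some x
  | l.+1 => fun x =>
      obind (fun u => activate (rho l) (linear_part (A l) u + b l))
            (network rho A b l x)
  end.

(** * Hypothesis classes *)

Inductive activations (R : realType) (s : nat) :=
| Fixed (rho : nat -> ratfun R s s)
| Trainable.
Arguments Trainable {R s}.

Definition F_fixed (R : realType) (s : nat) (a : arch R) (L : nat)
    (rho : nat -> ratfun R s s) :
    set (pfun R (layer_dim a 0) (layer_dim a L)) :=
  [set f | exists A b, f = network rho A b L].
Arguments F_fixed {R s} a L rho _.

Definition F_trainable (R : realType) (s : nat) (a : arch R) (L : nat) (t : R) :
    set (pfun R (layer_dim a 0) (layer_dim a L)) :=
  [set f | exists (rho : nat -> ratfun R s s) A b,
     im_within (rho L.-1) t /\ f = network rho A b L].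
Arguments F_trainable {R} s a L t _.

(* F_RatNN, F_RatNN^T, F_RatCNN and F_RatCNN^T, according to the two cases of
   the architecture and of the activations. *)
Definition hyp_class (R : realType) (s : nat) (a : arch R)
    (act : activations R s) (L : nat) (t : R) :
    set (pfun R (layer_dim a 0) (layer_dim a L)) :=
  match act with
  | Fixed rho => F_fixed a L rho
  | Trainable => F_trainable s a L t
  end.
Arguments hyp_class {R s} a act L t _.

Definition last_within (R : realType) (s : nat) (act : activations R s)
    (L : nat) (t : R) : Prop :=
  match act with
  | Fixed rho => im_within (rho L.-1) t
  | Trainable => True
  end.

(* Each trainable activation contributes the s + 1 coefficients of its
   numerator and the s + 1 coefficients of its denominator. *)
Definition num_params (R : realType) (s : nat) (a : arch R)
    (act : activations R s) (L : nat) : nat :=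
  (\sum_(i < L) (num_weights a i + layer_dim a i.+1) +
   match act with Fixed _ => 0 | Trainable => L * (s.+1 + s.+1) end)%N.

(* The widths are positive, so the unit 1 only matters for L = 1, when there
   is no hidden layer. *)
Definition width (R : realType) (a : arch R) (L : nat) : nat :=
  match a with
  | FullyConnected d => \big[maxn/1]_(1 <= j < L) d j
  | Convolutional k c _ _ _ => k ^ 2 * \big[maxn/1]_(1 <= j < L) c j
  end%N.

Definition width_prod (R : realType) (a : arch R) (L : nat) : nat :=
  match a with
  | FullyConnected d => \prod_(1 <= j < L) d j
  | Convolutional k c _ _ _ =>
      k ^ (2 * (L - 1)) * \prod_(1 <= j < L) c j
  end%N.

(** * Losses *)

Definition l2norm (R : realType) (m : nat) (u : 'cV[R]_m) : R :=
  Num.sqrt (\sum_j u j 0 ^+ 2).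

Definition loss_lipschitz (R : realType) (m : nat) (Y : Type)
    (l : 'cV[R]_m -> Y -> R) (K : R) :=
  forall y u v, `|l u y - l v y| <= K * l2norm (u - v).

Definition loss_range (R : realType) (m : nat) (Y : Type)
    (l : 'cV[R]_m -> Y -> R) (H : R) :=
  forall u y, 0 <= l u y <= H.

Definition softmax (R : realType) (m : nat) (z : 'cV[R]_m) : 'cV[R]_m :=
  \col_i (expR (z i 0) / \sum_j expR (z j 0)).

Definition cross_entropy (R : realType) (m : nat) (q y : 'cV[R]_m) : R :=
  - \sum_i y i 0 * ln (q i 0).

Definition one_hot (R : realType) (m : nat) (i : 'I_m) : 'cV[R]_m :=
  delta_mx i 0.

Definition ce_loss (R : realType) (m : nat) (Y : Type) (cls : Y -> 'I_m)
    (z : 'cV[R]_m) (y : Y) : R :=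
  cross_entropy (softmax z) (one_hot R (cls y)).

(** * Rademacher complexity and generalization error *)

(* The value 0 off the domain is never used below: suprema only range over
   functions defined at all sample points, and, in an expectation, defined
   almost everywhere. *)
Definition loss_at (R : realType) (d m : nat) (Y : Type)
    (l : 'cV[R]_m -> Y -> R) (f : pfun R d m) (x : 'cV[R]_d) (y : Y) : R :=
  if f x is Some u then l u y else 0.

Definition defined_on (R : realType) (d m n : nat) (X : 'M[R]_(d, n))
    (f : pfun R d m) : Prop :=
  forall i, f (col i X) <> None.

(* The expectation over independent Rademacher signs is the average over the
   2 ^ n sign patterns. *)
Definition rademacher (R : realType) (d m n : nat) (Y : Type)
    (F : set (pfun R d m)) (l : 'cV[R]_m -> Y -> R)
    (X : 'M[R]_(d, n)) (y : 'I_n -> Y) : \bar R :=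
  (((2 ^+ n)^-1)%:E * \sum_(sg : {ffun 'I_n -> bool})
    ereal_sup [set (n%:R^-1 *
                     \sum_i (-1) ^+ sg i * loss_at l f (col i X) (y i))%:E
              | f in F `&` defined_on X])%E.

Definition sup_rademacher (R : realType) (d m n : nat) (Y : Type)
    (F : set (pfun R d m)) (l : 'cV[R]_m -> Y -> R) (y : 'I_n -> Y) : \bar R :=
  ereal_sup [set rademacher F l X y | X in [set: 'M[R]_(d, n)]].

Definition cvec (R : realType) (d : nat) (x : d.-tuple R) : 'cV[R]_d :=
  \col_j tnth x j.

Definition gen_error (R : realType) (d m n : nat) (dY : measure_display)
    (Y : measurableType dY) (F : set (pfun R d m)) (l : 'cV[R]_m -> Y -> R)
    (D : probability (d.-tuple R * Y)%type R)
    (X : 'M[R]_(d, n)) (y : 'I_n -> Y) : \bar R :=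
  ereal_sup [set (\int[D]_z (loss_at l f (cvec z.1) z.2)%:E
                  - (n%:R^-1 * \sum_i loss_at l f (col i X) (y i))%:E)%E
            | f in [set f | [/\ F f, defined_on X f
                              & {ae D, forall z, f (cvec z.1) <> None}]]].

Definition iid (R : realType) (dO dZ : measure_display)
    (Omega : measurableType dO) (Z : measurableType dZ)
    (P : probability Omega R) (D : probability Z R) (n : nat)
    (S : 'I_n -> {RV P >-> Z}) : Prop :=
  (forall i (A : set Z), measurable A -> P (S i @^-1` A) = D A) /\
  (forall A : 'I_n -> set Z, (forall i, measurable (A i)) ->
     P (\bigcap_i (S i @^-1` A i)) = \prod_(i < n) P (S i @^-1` A i))%E.

(* With probability at least 1 - delta over an i.i.d. sample of size n,
   GE_S <= 2 B + 3 H sqrt (log (2 / delta) / (2 n)): the standard inequality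
   for l / H, whose range is in [0, 1], with B in place of the Rademacher
   complexity. *)
Definition generalizes (R : realType) (d m n : nat) (dY : measure_display)
    (Y : measurableType dY) (F : set (pfun R d m)) (l : 'cV[R]_m -> Y -> R)
    (H B : R) : Prop :=
  (forall u, measurable_fun setT (l u)) ->
  forall (dO : measure_display) (Omega : measurableType dO)
         (P : probability Omega R) (D : probability (d.-tuple R * Y)%type R)
         (S : 'I_n -> {RV P >-> (d.-tuple R * Y)%type}),
  iid D S ->
  forall delta : R, 0 < delta < 1 ->
  exists2 E : set Omega, measurable E /\ ((1 - delta)%:E <= P E)%E &
    forall omega, E omega ->
      (gen_error F l D (\matrix_(j < d, i < n) tnth (S i omega).1 j)
                       (fun i => (S i omega).2)
       <= (2 * B + 3 * H * Num.sqrt (ln (2 / delta) / (2 * n%:R)))%:E)%E.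

(* Main.v *)
Require Import Defs.
From HB Require Import structures.
From mathcomp Require Import all_boot all_order all_algebra.
From mathcomp Require Import all_classical all_reals all_analysis.
From mathcomp Require Import measurable_realfun.
From mathcomp Require Import ring lra zify.

(** The networks of the class, evaluated on a fixed sample of size n, realise
    few outputs up to a given precision; everything else is the classical
    passage from a cover to a Rademacher or generalization bound.

    Each output coordinate is a quotient P / Q of polynomials in the N
    parameters (network_exprs). An activation in R^s_s multiplies the degree
    by s, and putting an affine combination over a common denominator
    multiplies it by the number of summands, which is a width, or k^2 times a
    number of channels; so the degree is of the order of L s^L times the
    product of the widths (layer_degree_le). The output exceeds a threshold
    theta when P Q - theta Q^2 > 0. Two parameters with the same signs for all
    thresholds of a grid of step eps in [-t, t] have outputs within eps of
    each other (network_cover), so the size of a cover is a number of sign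
    patterns.

    The number of sign patterns of m polynomials of degree at most E in N
    variables is at most (N (2 m E + 2 N) + 1)^N (card_sign_patterns). Let G
    be the product of the squares of the polynomials and of factors vanishing
    on the faces of a large cube. A small linear perturbation of G has a
    maximum inside each cell (region_critical), which is a point where the
    gradient of G takes a given value. These points are counted without
    intersection theory: the N partial derivatives of G and a linear form that
    separates the points are algebraically dependent (algebraic_dependency),
    with an explicit bound for the degree of the relation. For a generic value
    of the gradient the relation becomes a nonzero polynomial in the linear
    form alone, and its degree bounds the number of points (gradient_values).

    With losses covered at precision alpha / sqrt n, the bound for finite
    classes gives the Rademacher complexity (rademacher_le). A single scale is
    enough: at this precision the logarithm of the size of the cover is at
    most 2 N times the logarithm in the claimed bound. The generalization
    error is bounded from the same cover, on a double sample, by a Chernoff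
    bound after symmetrization (uniform_deviation); the class is first reduced
    to a countable dense subfamily (network_generalizes), which makes the
    supremum measurable. The two together give the explicit bound
    (explicit_bounds) with c = 4 and c' = 8.

    For the asymptotic bounds (asymptotic_bounds), the case N >= n is trivial,
    and otherwise ln W = O(L log (s D)) up to a term absorbed by the factor
    alpha. Cross-entropy is 2-Lipschitz, and has range in [0, 2 t + ln d_L] on
    the outputs, which lie in a box; composing it with the projection onto the
    box (clip) makes the asymptotic bound applicable. *)

Set Implicit Arguments.
Unset Strict Implicit.
Unset Printing Implicit Defensive.

Import Order.TTheory GRing.Theory Num.Theory.
Import numFieldNormedType.Exports.

Local Open Scope classical_set_scope.
Local Open Scope ring_scope.

(** * Polynomial expressions and algebraic dependency *)

(** Syntax trees instead of an algebra of polynomials: values, partial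
    derivatives and degree bounds are all obtained by recursion on the tree,
    and so is the substitution of the sample points for the inputs. *)
Inductive pexp (R V : Type) :=
| PCst of R
| PVar of V
| PAdd of pexp R V & pexp R V
| PMul of pexp R V & pexp R V.

Arguments PCst {R V}.
Arguments PVar {R V}.

Fixpoint ev (R : realType) (V : Type) (e : pexp R V) (x : V -> R) : R :=
  match e with
  | PCst c => c
  | PVar v => x v
  | PAdd e1 e2 => ev e1 x + ev e2 x
  | PMul e1 e2 => ev e1 x * ev e2 x
  end.

(** A bound for the degree, with weight w v on the variable v, that ignores
    cancellations. Weight 0 on the inputs of a network gives the degree in its
    parameters. *)
Fixpoint pdeg (R V : Type) (w : V -> nat) (e : pexp R V) : nat :=
  match e with
  | PCst _ => 0
  | PVar v => w v
  | PAdd e1 e2 => maxn (pdeg w e1) (pdeg w e2)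
  | PMul e1 e2 => pdeg w e1 + pdeg w e2
  end.

Fixpoint pbind (R V V' : Type) (f : V -> pexp R V') (e : pexp R V) : pexp R V' :=
  match e with
  | PCst c => PCst c
  | PVar v => f v
  | PAdd e1 e2 => PAdd (pbind f e1) (pbind f e2)
  | PMul e1 e2 => PMul (pbind f e1) (pbind f e2)
  end.

Fixpoint pderiv (R : realType) (V : eqType) (v : V) (e : pexp R V) : pexp R V :=
  match e with
  | PCst _ => PCst 0
  | PVar u => PCst (u == v)%:R
  | PAdd e1 e2 => PAdd (pderiv v e1) (pderiv v e2)
  | PMul e1 e2 => PAdd (PMul (pderiv v e1) e2) (PMul e1 (pderiv v e2))
  end.

Notation tdeg := (pdeg (fun=> 1%N)).

Definition psum (R : realType) (V : Type) (I : finType) (f : I -> pexp R V) :=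
  \big[@PAdd R V/PCst 0]_i f i.

Definition pprod (R : realType) (V : Type) (I : finType) (f : I -> pexp R V) :=
  \big[@PMul R V/PCst 1]_i f i.

Definition ppow (R : realType) (V : Type) (e : pexp R V) (n : nat) :=
  iter n (PMul e) (PCst 1).

Lemma ev_sum (R : realType) (V : Type) (I : finType) (f : I -> pexp R V) x :
  ev (psum f) x = \sum_i ev (f i) x.
Proof. exact: (big_morph (fun e => ev e x)). Qed.

Lemma ev_prod (R : realType) (V : Type) (I : finType) (f : I -> pexp R V) x :
  ev (pprod f) x = \prod_i ev (f i) x.
Proof. exact: (big_morph (fun e => ev e x)). Qed.

Lemma ev_pow (R : realType) (V : Type) (e : pexp R V) n x :
  ev (ppow e n) x = ev e x ^+ n.
Proof. by elim: n => [|n IH] /=; rewrite ?expr0 // exprS -IH. Qed.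

Lemma pdeg_sum (R : realType) (V : Type) (w : V -> nat) (I : finType)
    (f : I -> pexp R V) E :
  (forall i, (pdeg w (f i) <= E)%N) -> (pdeg w (psum f) <= E)%N.
Proof.
move=> fE; rewrite /psum (big_morph (pdeg w) (op1 := maxn) (id1 := 0%N)) //.
by apply/bigmax_leqP => i _.
Qed.

Lemma pdeg_prod (R : realType) (V : Type) (w : V -> nat) (I : finType)
    (f : I -> pexp R V) :
  pdeg w (pprod f) = (\sum_i pdeg w (f i))%N.
Proof. exact: (big_morph (pdeg w)). Qed.

Lemma pdeg_pow (R : realType) (V : Type) (w : V -> nat) (e : pexp R V) n :
  pdeg w (ppow e n) = (n * pdeg w e)%N.
Proof. by elim: n => //= n ->; rewrite mulSn. Qed.

Lemma ev_bind (R : realType) (V V' : Type) (f : V -> pexp R V') e x :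
  ev (pbind f e) x = ev e (fun v => ev (f v) x).
Proof. by elim: e => //= e1 -> e2 ->. Qed.

Lemma pdeg_bind (R : realType) (V V' : Type) (w : V -> nat) (w' : V' -> nat)
    (f : V -> pexp R V') e :
  (forall v, (pdeg w' (f v) <= w v)%N) -> (pdeg w' (pbind f e) <= pdeg w e)%N.
Proof.
move=> fw; elim: e => //= e1 IH1 e2 IH2; last exact: leq_add.
by rewrite geq_max !leq_max IH1 IH2 orbT.
Qed.

Lemma pdeg_deriv (R : realType) (V : eqType) (w : V -> nat) (v : V)
    (e : pexp R V) : (pdeg w (pderiv v e) <= pdeg w e)%N.
Proof.
elim: e => //= e1 IH1 e2 IH2; first by rewrite geq_max !leq_max IH1 IH2 orbT.
by rewrite geq_max !leq_add.
Qed.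

(** Monomials are taken from a box rather than a simplex of exponents, so that
    the dimension of their span is visibly (E + 1)^N. *)
Lemma ev_span (R : realType) N E (e : pexp R 'I_N) : (tdeg e <= E)%N ->
  exists c : {ffun 'I_N -> 'I_E.+1} -> R,
    forall x, ev e x = \sum_a c a * \prod_i x i ^+ a i.
Proof.
elim: e E => [r|v|e1 IH1 e2 IH2|e1 IH1 e2 IH2] E /= degE.
- exists (fun a => r * (a == [ffun=> ord0])%:R) => x.
  rewrite (bigD1 [ffun=> ord0]) //= eqxx mulr1 big1 ?mulr1 => [|i _].
    by rewrite big1 ?addr0 // => a /negbTE ->; rewrite mulr0 mul0r.
  by rewrite ffunE.
- exists (fun a => (a == [ffun i => inord (i == v)])%:R) => x.
  rewrite (bigD1 [ffun i => inord (i == v)]) //= eqxx mul1r.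
  rewrite (bigD1 v) //= ffunE eqxx inordK // expr1 [X in _ * X]big1 => [|i ni].
    rewrite mulr1 big1 ?addr0 // => a /negbTE ->; by rewrite mul0r.
  by rewrite ffunE (negbTE ni) inordK.
- move: degE; rewrite geq_max => /andP[/IH1[c1 c1E] /IH2[c2 c2E]].
  exists (fun a => c1 a + c2 a) => x; rewrite c1E c2E -big_split /=.
  by apply: eq_bigr => a _; rewrite mulrDl.
- have [c1 c1E] := IH1 _ (leqnn _); have [c2 c2E] := IH2 _ (leqnn _).
  pose s (p : {ffun 'I_N -> 'I_(tdeg e1).+1} * {ffun 'I_N -> 'I_(tdeg e2).+1})
    : {ffun 'I_N -> 'I_E.+1} := [ffun i => inord (p.1 i + p.2 i)].
  exists (fun a => \sum_(p | s p == a) c1 p.1 * c2 p.2) => x.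
  rewrite c1E c2E big_distrlr /= pair_big /= (partition_big s xpredT) //=.
  apply: eq_bigr => a _; rewrite mulr_suml; apply: eq_bigr => p /eqP <-.
  rewrite -!mulrA; congr (_ * _); rewrite mulrCA; congr (_ * _).
  rewrite -big_split; apply: eq_bigr => i _ /=; rewrite ffunE inordK ?exprD //.
  rewrite ltnS (leq_trans _ degE) // leq_add //; by rewrite -ltnS.
Qed.

Lemma linear_dependency (R : fieldType) (J K : finType) (C : J -> K -> R) :
  (#|K| < #|J|)%N ->
  exists v : J -> R, (exists j, v j != 0) /\ forall k, \sum_j v j * C j k = 0.
Proof.
move=> ltKJ.
pose A := \matrix_(j < #|J|, k < #|K|) C (enum_val j) (enum_val k).
have : kermx A != 0.
  rewrite -mxrank_eq0 mxrank_ker subn_eq0 -ltnNge.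
  exact: leq_ltn_trans (rank_leq_col A) ltKJ.
move=> /rowV0Pn[u /sub_kermxP uA /rV0Pn[j uj]].
exists (fun j => u 0 (enum_rank j)); split.
  by exists (enum_val j); rewrite enum_valK.
move=> k; move/rowP: uA => /(_ (enum_rank k)); rewrite !mxE; apply: etrans.
rewrite [LHS](reindex (@enum_val J predT)) /=; last exact: onW_bij (enum_val_bij J).
by apply: eq_bigr => i _; rewrite !mxE enum_valK enum_rankK.
Qed.

Lemma leq_wexp2r (m n e : nat) : (m <= n)%N -> (m ^ e <= n ^ e)%N.
Proof. by case: e => // e; rewrite leq_exp2r. Qed.

(** A dimension count. The (B + 1)^(N + 1) products F^a l^b with exponents at
    most B have degree at most B (N E + 1), so they lie in the span of (B (N E
    + 1) + 1)^N monomials, which are fewer as soon as B is at least (N E +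
    1)^N. *)
Lemma algebraic_dependency (R : realType) N E B (F : 'I_N -> pexp R 'I_N)
    (l : pexp R 'I_N) :
  (forall i, (tdeg (F i) <= E)%N) -> (tdeg l <= 1)%N ->
  ((N * E + 1) ^ N <= B)%N ->
  exists c : {ffun 'I_N -> 'I_B.+1} * 'I_B.+1 -> R,
    (exists ab, c ab != 0) /\
    forall x, \sum_ab c ab * (\prod_i ev (F i) x ^+ ab.1 i * ev l x ^+ ab.2) = 0.
Proof.
move=> FE lE leB; set J := (_ * _)%type; set T := (B * (N * E + 1))%N.
pose g (ab : J) := PMul (pprod (fun i => ppow (F i) (ab.1 i))) (ppow l ab.2).
have gT ab : (tdeg (g ab) <= T)%N.
  rewrite /g /= pdeg_prod pdeg_pow /T mulnDr leq_add //; last first.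
    by rewrite leq_mul // -ltnS.
  rewrite (@leq_trans (\sum_(i < N) B * E)%N) //.
    by apply: leq_sum => i _; rewrite pdeg_pow leq_mul // -ltnS.
  by rewrite sum_nat_const card_ord mulnCA.
have /choice[C CE] : forall ab, exists c : {ffun 'I_N -> 'I_T.+1} -> R,
    forall x, ev (g ab) x = \sum_a c a * \prod_i x i ^+ a i.
  by move=> ab; apply: ev_span; exact: gT.
have [|c [c0 cC]] := @linear_dependency R J _ C.
  rewrite /J card_prod !card_ffun !card_ord mulnC.
  have T1 : (T.+1 <= B.+1 * (N * E + 1))%N by rewrite /T; nia.
  apply: (@leq_ltn_trans ((B.+1 * (N * E + 1)) ^ N)); first exact: leq_wexp2r.
  by rewrite expnMn mulnC ltn_mul2r ltnS leB expn_gt0.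
exists c; split=> // x.
have gE (ab : J) : \prod_i ev (F i) x ^+ ab.1 i * ev l x ^+ ab.2 = ev (g ab) x.
  by rewrite /g /= ev_prod ev_pow; congr (_ * _); apply: eq_bigr => i _; rewrite ev_pow.
under eq_bigr => ab _ do rewrite gE CE mulr_sumr.
rewrite exchange_big big1 //= => a _.
rewrite -[RHS](mul0r (\prod_i x i ^+ a i)) -[in RHS](cC a) mulr_suml.
by apply: eq_bigr => ab _; rewrite mulrA.
Qed.

(** * Critical points in the cells of an arrangement *)

Definition line (R : realType) (V : eqType) (x : V -> R) (i : V) (t : R) : V -> R :=
  fun j => x j + t *+ (j == i).

Lemma eq_ev (R : realType) (V : Type) (e : pexp R V) x y :
  x =1 y -> ev e x = ev e y.
Proof. by move=> xy; elim: e => //= e1 -> e2 ->. Qed.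

Lemma line0 (R : realType) (V : eqType) (x : V -> R) i : line x i 0 =1 x.
Proof. by move=> j; rewrite /line mul0rn addr0. Qed.

Lemma is_derive_line (R : realType) (V : eqType) (e : pexp R V) x i (t : R) :
  is_derive t 1 (fun u => ev e (line x i u)) (ev (pderiv i e) (line x i t)).
Proof.
elim: e => [c|v|e1 IH1 e2 IH2|e1 IH1 e2 IH2] /=.
- exact: is_derive_cst.
- rewrite /line; case: eqP => _ /=.
    under eq_fun do rewrite mulr1n.
    rewrite -[1%:R]add0r; apply: is_deriveD.
  under eq_fun do rewrite mulr0n addr0.
  exact: is_derive_cst.
- exact: (is_deriveD IH1 IH2).
- rewrite addrC [X in _ + X]mulrC; exact: (is_deriveM IH1 IH2).
Qed.

Lemma critical_point (R : realType) (V : eqType) (e : pexp R V) x i :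
  (\forall t \near (0 : R), ev e (line x i t) <= ev e x) ->
  ev (pderiv i e) x = 0.
Proof.
move=> /nbhs_ballP[r /= r0 max].
have inI : (0 : R) \in `]- r, r[%R by rewrite in_itv /= oppr_lt0 r0.
have d0 : is_derive (0 : R) 1 (fun u => ev e (line x i u)) 0.
  apply: (derive1_at_max (a := - r) (b := r)) => //.
  - by rewrite ge0_cp // ltW.
  - by move=> t _; apply: ex_derive; exact: is_derive_line.
  - move=> t; rewrite in_itv /= => tr; rewrite [leRHS](eq_ev _ (line0 x i)).
    by apply: max; rewrite /ball /= sub0r normrN ltr_norml.
rewrite -(eq_ev _ (line0 x i)).
by rewrite -(@derive_val _ _ _ _ _ _ _ (is_derive_line e x i 0)) derive_val.
Qed.

Lemma continuous_ev (R : realType) N (e : pexp R 'I_N) :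
  continuous (fun x : 'rV[R]_N => ev e (x 0)).
Proof.
elim: e => [c|v|e1 IH1 e2 IH2|e1 IH1 e2 IH2] x /=.
- exact: cst_continuous.
- exact: coord_continuous.
- exact: (cvgD (IH1 x) (IH2 x)).
- exact: (cvgM (IH1 x) (IH2 x)).
Qed.

Lemma continuous_line (R : realType) (V : eqType) (e : pexp R V) x i (t : R) :
  {for t, continuous (fun u => ev e (line x i u))}.
Proof.
apply/differentiable_continuous/derivable1_diffP.
by apply: ex_derive; exact: is_derive_line.
Qed.

(** This product is positive inside the cells that the f j cut in the cube of
    half-side rad, and vanishes on their walls. *)
Definition walled (R : realType) N m (f : 'I_m -> pexp R 'I_N) (rad : R) :=
  PMul (pprod (fun j => ppow (f j) 2))
       (pprod (fun i : 'I_N =>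
          PAdd (PCst (rad ^+ 2)) (PMul (PCst (-1)) (ppow (PVar i) 2)))).

Lemma walledE (R : realType) N m (f : 'I_m -> pexp R 'I_N) rad x :
  ev (walled f rad) x =
  \prod_j ev (f j) x ^+ 2 * \prod_i (rad ^+ 2 - x i ^+ 2).
Proof.
rewrite /walled /= !ev_prod; congr (_ * _); apply: eq_bigr => i _.
  by rewrite /= mulr1 expr2.
by rewrite /= mulr1 mulN1r expr2.
Qed.

Lemma tdeg_walled (R : realType) N m E (f : 'I_m -> pexp R 'I_N) rad :
  (forall j, (tdeg (f j) <= E)%N) -> (tdeg (walled f rad) <= 2 * m * E + 2 * N)%N.
Proof.
move=> fE; rewrite /walled /= !pdeg_prod leq_add //.
  rewrite (@leq_trans (\sum_(j < m) 2 * E)%N) //; last first.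
    by rewrite sum_nat_const card_ord; lia.
  by apply: leq_sum => j _; have := fE j; rewrite /=; lia.
by rewrite /= sum_nat_const card_ord; lia.
Qed.

(** The sum of the walled product and of the linear form w has a maximum on
    the closed cell of v. It is not on a wall, where the product is 0 and the
    linear form too small to reach the value at v; at an interior maximum the
    gradient of the product is - w. *)
Lemma region_critical (R : realType) N m (f : 'I_m -> pexp R 'I_N) (rad : R)
    (v w : 'I_N -> R) :
  (forall j, ev (f j) v != 0) -> (forall i, `|v i| < rad) ->
  2 * (\sum_i `|w i| * rad) < ev (walled f rad) v ->
  exists p : 'I_N -> R,
    (forall j, (0 < ev (f j) p) = (0 < ev (f j) v)) /\
    (forall i, ev (pderiv i (walled f rad)) p = - w i).
Proof.
move=> fv vrad small.
pose s j := Num.sg (ev (f j) v).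
pose box : set 'rV[R]_N := [set x | forall i, `[- rad, rad]%classic (x ord0 i)].
pose reg : set 'rV[R]_N := \bigcap_j [set x : 'rV[R]_N | 0 <= s j * ev (f j) (x 0)].
pose H := PAdd (walled f rad) (psum (fun i => PMul (PCst (w i)) (PVar i))).
have HE x : ev H x = ev (walled f rad) x + \sum_i w i * x i.
  by rewrite /H /= ev_sum.
have cK : compact (box `&` reg).
  apply: compact_closedI.
    by apply: (@rV_compact _ _ (fun=> `[- rad, rad]%classic)) => i; exact: segment_compact.
  apply: closed_bigI => j _.
  apply: (@closed_comp _ _ (fun x : 'rV[R]_N => s j * ev (f j) (x 0)) [set y | 0 <= y]).
    move=> x _.
    exact: (cvgM (cvg_cst (s j)) (@continuous_ev _ _ (f j) x)).
  exact: closed_ge.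
have vK : (box `&` reg) (\row_i v i).
  split=> [i|j _] /=.
    by rewrite in_itv /= mxE -ler_norml ltW.
  rewrite (@eq_ev _ _ _ _ v) => [|i]; last by rewrite mxE.
  by rewrite /s -normrEsg.
have [p /set_mem[pbox preg] pmax] :
    exists2 p : 'rV[R]_N, p \in box `&` reg &
      forall x : 'rV[R]_N, x \in box `&` reg -> ev H (x 0) <= ev H (p 0).
  apply: compact_EVT_max => //; first by exists (\row_i v i).
  by apply: continuous_subspaceT; exact: continuous_ev.
have prad i : `|p 0 i| <= rad by have := pbox i; rewrite /= in_itv /= -ler_norml.
have lin x : (forall i, `|x i| <= rad) -> `|\sum_i w i * x i| <= \sum_i `|w i| * rad.
  move=> xr; apply: le_trans (ler_norm_sum _ _ _) _; apply: ler_sum => i _.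
  by rewrite normrM ler_wpM2l.
have Gp : ev (walled f rad) (p 0) != 0.
  apply/eqP => Gp0; have := pmax _ (mem_set vK).
  rewrite !HE Gp0 add0r !(@eq_ev _ _ _ _ v) => [|i]; last by rewrite mxE.
  under eq_bigr do rewrite mxE.
  have := lin v (fun i => ltW (vrad i)); have := lin (p 0) prad.
  rewrite !ler_norml; lra.
move: Gp; rewrite walledE mulf_eq0 negb_or => /andP[/prodf_neq0 Gf /prodf_neq0 Gb].
have {}Gf j : 0 < s j * ev (f j) (p 0).
  rewrite lt_neqAle (preg j Logic.I) andbT eq_sym mulf_neq0 //.
    by rewrite /s sgr_eq0.
  by have := Gf j isT; rewrite expf_eq0.
have {}Gb i : `|p 0 i| < rad.
  rewrite lt_neqAle prad andbT; apply/eqP => e; have := Gb i isT.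
  by rewrite -e real_normK ?num_real // subrr eqxx.
exists (p 0); split=> [j|i].
  have := Gf j; rewrite /s; case: sgrP (fv j) => // fj _; rewrite ?mul1r //.
  by rewrite mulN1r oppr_gt0 => /ltW; rewrite ltNge => ->.
have : ev (pderiv i H) (p 0) = 0.
  apply: critical_point.
  have Hb (k : 'I_N) : \forall t \near (0 : R), `|line (p 0) i t k| < rad.
    have := @continuous_line _ _ (PVar k : pexp R 'I_N) (p 0) i 0.
    by move=> /cvg_norm /cvgr_lt; apply; rewrite /= line0.
  have Hf (j : 'I_m) : \forall t \near (0 : R), 0 < s j * ev (f j) (line (p 0) i t).
    have : {for 0, continuous (fun t => s j * ev (f j) (line (p 0) i t))}.
      by apply: cvgM; [exact: cvg_cst | exact: continuous_line].
    by move=> /cvgr_gt; apply; rewrite (eq_ev _ (line0 _ _)).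
  have {}Hb := @filter_forall R 'I_N _ _ _ Hb.
  have {}Hf := @filter_forall R 'I_m _ _ _ Hf.
  near=> t.
  have tb : forall k, `|line (p 0) i t k| < rad by near: t; exact: Hb.
  have tf : forall j, 0 < s j * ev (f j) (line (p 0) i t) by near: t; exact: Hf.
  have := pmax (\row_k line (p 0) i t k).
  rewrite (@eq_ev _ _ H _ (line (p 0) i t)) => [|k]; last by rewrite mxE.
  apply; apply: mem_set; split=> [k|j _] /=.
    by rewrite in_itv /= mxE -ler_norml ltW.
  by rewrite (@eq_ev _ _ _ _ (line (p 0) i t)) => [|k]; rewrite ?mxE // ltW.
have -> : ev (pderiv i H) (p 0) = ev (pderiv i (walled f rad)) (p 0) + w i.
  rewrite {1}/H /=; congr (_ + _).
  have -> : pderiv i (psum (fun i0 => PMul (PCst (w i0)) (PVar i0))) =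
      psum (fun i0 => PAdd (PMul (PCst 0) (PVar i0)) (PMul (PCst (w i0)) (PCst (i0 == i)%:R))).
    exact: (big_morph (pderiv i)).
  rewrite ev_sum (bigD1 i) //= eqxx mul0r add0r mulr1 big1 ?addr0 // => k /negbTE -> /=.
  by rewrite mul0r mulr0 addr0.
by move/eqP; rewrite addr_eq0 => /eqP.
Unshelve. all: by end_near.
Qed.

(** * Generic values *)

(** The exponents a i are the digits in base B + 1. Substituting tau^((B +
    1)^i) for the i-th variable therefore sends distinct monomials to distinct
    powers of tau: this is Kronecker's substitution. *)
Lemma Kronecker_inj N B : injective
  (fun a : {ffun 'I_N -> 'I_B.+1} => \sum_i a i * B.+1 ^ i)%N.
Proof.
elim: N => [|N IH] a b; first by move=> _; apply/ffunP => -[].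
rewrite !big_ord_recl !expn0 !muln1.
have sh (c : {ffun 'I_N.+1 -> 'I_B.+1}) :
  (\sum_(i < N) c (lift ord0 i) * B.+1 ^ lift ord0 i =
   (\sum_(i < N) [ffun i : 'I_N => c (lift ord0 i)] i * B.+1 ^ i) * B.+1)%N.
  rewrite big_distrl; apply: eq_bigr => i _ /=.
  by rewrite ffunE /bump /= add1n expnSr mulnA.
rewrite !sh => ab.
have ab0 : a ord0 = b ord0.
  apply: val_inj; have := congr1 (modn^~ B.+1) ab.
  by rewrite ![(_ + _ * B.+1)%N]addnC !modnMDl !modn_small.
move: ab; rewrite ab0 => /addnI /eqP; rewrite eqn_pmul2r // => /eqP /IH ab.
apply/ffunP => i; case: (unliftP ord0 i) => [j ->|-> //].
by move/ffunP: ab => /(_ j); rewrite !ffunE.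
Qed.

Lemma lower_bound_gt0 (R : realFieldType) (T : finType) (f : T -> R) :
  (forall i, 0 < f i) -> exists2 eta, 0 < eta & forall i, eta < f i.
Proof.
move=> f0; have s0 : 0 <= \sum_i (f i)^-1.
  by apply: sumr_ge0 => i _; rewrite invr_ge0 ltW.
exists (1 + \sum_i (f i)^-1)^-1; first by rewrite invr_gt0 ltr_pwDl.
move=> i; rewrite -[ltRHS]invrK ltf_pV2 ?posrE ?invr_gt0 ?ltr_pwDl //.
rewrite (bigD1 i) //= lerDl; apply: sumr_ge0 => j _.
by rewrite invr_ge0 ltW.
Qed.

Lemma nonroot_small (R : realFieldType) (p : {poly R}) r :
  p != 0 -> 0 < r -> exists2 t, 0 < t < r & ~~ root p t.
Proof.
move=> p0 r0; pose s := [seq r / i.+2%:R | i <- iota 0 (size p)].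
have us : uniq s.
  rewrite map_inj_uniq ?iota_uniq // => i j /(mulfI (lt0r_neq0 r0)) /invr_inj /eqP.
  by rewrite eqr_nat => /eqP [].
have : ~~ all (root p) s.
  apply/negP => ps; have := max_poly_roots p0 ps us.
  by rewrite size_map size_iota ltnn.
move=> /allPn[_ /mapP[i _ ->] ni]; exists (r / i.+2%:R) => //.
by rewrite divr_gt0 // ltr_pdivrMr // ltr_pMr // ltr1n.
Qed.

Lemma nonroot_nat (R : numDomainType) (p : {poly R}) K :
  p != 0 -> (size p <= K)%N -> exists k : 'I_K, p.[k%:R] != 0.
Proof.
move=> p0 pK; pose s := [seq (k%:R : R) | k : 'I_K].
have us : uniq s.
  rewrite map_inj_uniq ?enum_uniq // => i j /eqP.
  by rewrite eqr_nat => /eqP /val_inj.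
have : ~~ all (root p) s.
  apply/negP => ps; have := max_poly_roots p0 ps us.
  by rewrite size_map size_enum_ord ltnNge pK.
by move=> /allPn[_ /mapP[i _ ->] ni]; exists i.
Qed.

(** The form with coefficients k^i identifies a and b only if k is a root of
    the nonzero polynomial with coefficients p a i - p b i. The product over
    all pairs has too few roots for every k in the range to fail. *)
Lemma separating_form (R : numDomainType) (T : finType) N (p : T -> 'I_N -> R) :
  (forall a b, p a =1 p b -> a = b) ->
  exists k : 'I_(#|{: T * T}| * N).+1,
    injective (fun a => \sum_i p a i * (k%:R : R) ^+ i).
Proof.
move=> pinj; set K := (_ * N).+1.
pose d (ab : T * T) : {poly R} :=
  if ab.1 == ab.2 then 1 else \sum_(i < N) (p ab.1 i - p ab.2 i) *: 'X^i.
have dE a b : d (a, b) = if a == b then 1 else \poly_(i < N)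
    oapp (fun i => p a i - p b i) 0 (insub i).
  rewrite /d /=; case: eqP => // _; rewrite poly_def; apply: eq_bigr => i _.
  by rewrite valK.
have d0 ab : d ab != 0.
  case: ab => a b; rewrite dE; case: (eqVneq a b) => [_|ab]; first by rewrite oner_eq0.
  apply: contra ab => /eqP/polyP q0; apply/eqP; apply: pinj => i.
  have := q0 i; rewrite coef_poly ltn_ord valK coef0 /= => /eqP.
  by rewrite subr_eq0 => /eqP.
have [||k] := @nonroot_nat R (\prod_ab d ab) K; first by apply/prodf_neq0.
  rewrite (leq_trans (size_prod_leq _ _)) // leq_subLR.
  rewrite (@leq_trans (\sum_(ab : T * T) N.+1).+1) //; last first.
    by rewrite sum_nat_const /K mulnS addnS.
  rewrite ltnS; apply: leq_sum => -[a b] _; rewrite dE.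
  by case: ifP => _; rewrite ?size_poly1 // (leq_trans (size_poly _ _)).
rewrite horner_prod => /prodf_neq0 kd; exists k => a b ab.
apply/eqP; apply/negPn/negP => nab; have := kd (a, b) isT.
rewrite /d /= (negbTE nab) horner_sum.
under eq_bigr do rewrite hornerZ hornerXn mulrBl.
by rewrite sumrB ab subrr eqxx.
Qed.

(** * Counting sign patterns *)

Definition sign_pattern (R : realType) (V : Type) m (f : 'I_m -> pexp R V)
    (x : V -> R) : {ffun 'I_m -> bool} := [ffun j => 0 < ev (f j) x].

(** For each k, algebraic_dependency relates the partial derivatives of G to
    the form with coefficients k^i. Where the i-th derivative is tau^((B +
    1)^i), the relation becomes a polynomial Z in the value of the form, of
    degree at most B. By Kronecker_inj its coefficients do not all vanish
    identically in tau, so Z is nonzero unless tau is a root of some q fixed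
    in advance. The values of the form at the points p a are then distinct
    roots of Z. *)
Lemma gradient_values (R : realType) N E B (G : pexp R 'I_N) K :
  (tdeg G <= E)%N -> ((N * E + 1) ^ N <= B)%N ->
  exists2 q : {poly R}, q != 0 &
    forall tau, ~~ root q tau -> forall (k : 'I_K) (T : finType) (p : T -> 'I_N -> R),
      (forall a i, ev (pderiv i G) (p a) = tau ^+ (B.+1 ^ i)) ->
      injective (fun a => \sum_i p a i * k%:R ^+ i) -> (#|T| <= B)%N.
Proof.
move=> GE NB.
pose l (k : 'I_K) := psum (fun i : 'I_N => PMul (PVar i) (PCst (k%:R ^+ i : R))).
have lE k x : ev (l k) x = \sum_i x i * k%:R ^+ i by rewrite ev_sum.
have /choice[c cP] : forall k : 'I_K, exists c : {ffun 'I_N -> 'I_B.+1} * 'I_B.+1 -> R,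
    (exists ab, c ab != 0) /\
    forall x, \sum_ab c ab *
      (\prod_i ev (pderiv i G) x ^+ ab.1 i * ev (l k) x ^+ ab.2) = 0.
  move=> k; apply: algebraic_dependency (NB) => [i|].
    exact: leq_trans (pdeg_deriv _ _ _) GE.
  by apply: pdeg_sum.
have /choice[ab ab0] : forall k, exists ab, c k ab != 0 by move=> k; have [] := cP k.
pose e (a : {ffun 'I_N -> 'I_B.+1}) := (\sum_i a i * B.+1 ^ i)%N.
pose q k b := \sum_a c k (a, b) *: 'X^(e a).
exists (\prod_k q k (ab k).2).
  apply/prodf_neq0 => k _; apply/eqP => /polyP /(_ (e (ab k).1)) /eqP.
  rewrite coef0 coef_sum (bigD1 (ab k).1) //= coefZ coefXn eqxx mulr1.
  rewrite big1 => [|a na]; last first.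
    rewrite coefZ coefXn; case: eqP => [/Kronecker_inj/esym/eqP|_]; last by rewrite mulr0.
    by rewrite (negbTE na).
  by rewrite addr0 -surjective_pairing (negbTE (ab0 k)).
move=> tau; rewrite /root horner_prod => /prodf_neq0 qtau k T p crit pinj.
pose Z := \poly_(b < B.+1) (q k (inord b)).[tau].
have Z0 : Z != 0.
  apply/eqP => /polyP /(_ (ab k).2) /eqP; rewrite coef0 coef_poly ltn_ord inord_val.
  by rewrite (negbTE (qtau k isT)).
rewrite -ltnS (leq_trans _ (size_poly B.+1 (fun b => (q k (inord b)).[tau]))) //.
rewrite cardT -(size_map (fun a => \sum_i p a i * k%:R ^+ i)).
apply: max_poly_roots => //; last by rewrite map_inj_uniq ?enum_uniq.
apply/allP => _ /mapP[a0 _ ->].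
rewrite /root horner_poly; apply/eqP; have [_ /(_ (p a0))] := cP k; apply: etrans.
under eq_bigr => b _ do rewrite inord_val /q horner_sum mulr_suml.
rewrite exchange_big pair_big /=; apply: eq_bigr => -[a b] _ /=.
rewrite hornerZ hornerXn lE -mulrA; congr (_ * (_ * _)).
rewrite /e expr_sum; apply: eq_bigr => i _.
by rewrite crit -exprM mulnC.
Qed.

(** One point is chosen in each pattern. Subtracting a small eta from every f
    j keeps these patterns and makes all f j nonzero at the chosen points. For
    a small generic tau each of the cells contains a point where the gradient
    of the walled product is tau^((B + 1)^i), by region_critical, and there
    are at most B such points, by gradient_values. *)
Theorem card_sign_patterns (R : realType) N m E (f : 'I_m -> pexp R 'I_N)
    (A : {set {ffun 'I_m -> bool}}) :
  (forall j, (tdeg (f j) <= E)%N) ->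
  (forall pi, pi \in A -> exists x, sign_pattern f x = pi) ->
  (#|A| <= (N * (2 * m * E + 2 * N) + 1) ^ N)%N.
Proof.
move=> fE fA; set E' := (2 * m * E + 2 * N)%N; set B := ((N * E' + 1) ^ N)%N.
have /choice[v vP] : forall pi : {sg | sg \in A}, exists x, sign_pattern f x = val pi.
  by move=> [pi pA] /=; exact: fA.
pose T : finType := {sg | sg \in A}.
have [eta eta0 etaP] : exists2 eta : R, 0 < eta & forall pi : T, forall j,
    0 < ev (f j) (v pi) -> eta < ev (f j) (v pi).
  pose h (pj : T * 'I_m) := if 0 < ev (f pj.2) (v pj.1) then ev (f pj.2) (v pj.1) else 1.
  have [|eta eta0 etaP] := @lower_bound_gt0 R _ h.
    by move=> pj; rewrite /h; case: ifP.
  by exists eta => // pi j fj; have := etaP (pi, j); rewrite /h /= fj.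
pose f' j := PAdd (f j) (PCst (- eta)).
have f'v pi j : ev (f' j) (v pi) != 0 /\ (0 < ev (f' j) (v pi)) = val pi j.
  rewrite -(vP pi) ffunE /=; case: (ltP 0 (ev (f j) (v pi))) => [/etaP fj|fj].
    by rewrite subr_gt0 fj; split=> //; rewrite subr_eq0 gt_eqF.
  have lt0 : ev (f j) (v pi) + - eta < 0 by lra.
  by split; [rewrite lt_eqF | apply/negbTE; rewrite -leNgt ltW].
have [rad radP] : exists rad : R, forall pi i, `|v pi i| < rad.
  exists (\sum_(p : T * 'I_N) `|v p.1 p.2| + 1) => pi i.
  by rewrite (bigD1 (pi, i)) //= -addrA ltrDl ltr_wpDl // sumr_ge0.
pose G := walled f' rad.
have GE : (tdeg G <= E')%N.
  by apply: tdeg_walled => j; rewrite /= maxn0.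
have [gam gam0 gamP] : exists2 gam : R, 0 < gam & forall pi, gam < ev G (v pi).
  apply: lower_bound_gt0 => pi; rewrite walledE mulr_gt0 // prodr_gt0 // => i _.
    by rewrite exprn_even_gt0 //=; have [] := f'v pi i.
  rewrite subr_gt0 -(real_normK (num_real (v pi i))) ltr_pXn2r ?nnegrE //.
  exact: le_trans (normr_ge0 _) (ltW (radP pi i)).
have [q q0 qP] := @gradient_values R N E' B G (#|{: T * T}| * N).+1 GE (leqnn _).
(* Below r, the coefficients tau^((B + 1)^i) <= tau make the linear form smaller
   on the cube than half of gam, a lower bound for G at the chosen points. *)
pose r := Num.min 1 (gam / (2 * N%:R * `|rad| + 1)).
have d0 : 0 < 2 * N%:R * `|rad| + 1 by rewrite ltr_wpDl // mulr_ge0 // mulr_ge0.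
have r0 : 0 < r by rewrite lt_min ltr01 divr_gt0.
have [tau /andP[tau0]] := nonroot_small q0 r0.
rewrite lt_min ltr_pdivlMr // => /andP[tau1 tauG] /qP{}qP.
have /choice[p pP] : forall pi : T, exists p : 'I_N -> R,
    (forall j, (0 < ev (f' j) p) = val pi j) /\
    (forall i, ev (pderiv i G) p = tau ^+ (B.+1 ^ i)).
  move=> pi.
  have [j|//||p [p1 p2]] := @region_critical R N m f' rad (v pi)
      (fun i => - tau ^+ (B.+1 ^ i)); first by have [] := f'v pi j.
    apply: le_lt_trans (gamP pi).
    apply: (@le_trans _ _ (2 * (\sum_(i < N) tau * `|rad|))).
      rewrite ler_wpM2l //; apply: ler_sum => i _.
      have le_tau : tau ^+ (B.+1 ^ i) <= tau.
        by rewrite -[leRHS]expr1 ler_wiXn2l ?expn_gt0 ?ltW.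
      rewrite normrN ger0_norm; last by rewrite exprn_ge0 // ltW.
      rewrite (@le_trans _ _ (tau ^+ (B.+1 ^ i) * `|rad|)) //.
        by rewrite ler_wpM2l ?exprn_ge0 ?ler_norm // ltW.
      by rewrite ler_wpM2r.
    rewrite sumr_const card_ord -mulr_natr; apply: ltW; apply: le_lt_trans tauG.
    nra.
  by exists p; split=> [j|i]; [rewrite p1; have [] := f'v pi j|rewrite p2 opprK].
have pinj (a b : T) : p a =1 p b -> a = b.
  move=> pab; apply: val_inj; apply/ffunP => j.
  by have [<- _] := pP a; have [<- _] := pP b; rewrite (eq_ev _ pab).
have [k kinj] := separating_form pinj.
by rewrite -[leqLHS]card_sig; apply: (qP k T p) => // a i; have [] := pP a.
Qed.

(** * Layers and parameters *)

Definition weight_index (R : realType) (a : arch R) (i : nat) : finType :=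
  match a with
  | FullyConnected d => ('I_(d i.+1) * 'I_(d i))%type
  | Convolutional k c _ _ _ => ('I_(c i.+1) * 'I_(c i) * ('I_k * 'I_k))%type
  end.

Definition weight_entry (R : realType) (a : arch R) (i : nat) :
    weights a i -> weight_index a i -> R :=
  match a return weights a i -> weight_index a i -> R with
  | FullyConnected d => fun A q => A q.1 q.2
  | Convolutional k c _ _ _ => fun K q => K q.1.1 q.1.2 q.2.1 q.2.2
  end.

(** Index set of the products that are summed in one coordinate of the linear
    part of layer i. *)
Definition fan_in (R : realType) (a : arch R) (i : nat) : finType :=
  match a with
  | FullyConnected d => 'I_(d i)
  | Convolutional k c _ _ _ => ('I_(c i) * ('I_k * 'I_k))%type
  end.

(** An operand of a convolution is either an entry of the image or the
    constant of the padding. *)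
Definition source (R : realType) m (u : 'cV[R]_m) (o : 'I_m + R) : R :=
  match o with inl k => u k 0 | inr r => r end.

Lemma card_weight_index (R : realType) (a : arch R) i :
  #|weight_index a i| = num_weights a i.
Proof. by case: a => [d|k c h w g] /=; rewrite !card_prod !card_ord ?mulnA. Qed.

Lemma padded_source (R : realType) c h w (g : conv_geom R) (i : 'I_c) r q :
  exists o : 'I_(c * (h * w)) + R, forall u, padded g (channel u i) r q = source u o.
Proof.
rewrite /padded; case: ((_ <= r)%N && _); last by exists (inr (pad_value g)).
case: (insub (r - _)%N) => [i'|]; last by exists (inr (pad_value g)).
case: (insub (q - _)%N) => [j'|]; last by exists (inr (pad_value g)).
exists (inl (mxvec_index i (mxvec_index i' j'))) => u.
by rewrite /channel !mxE.
Qed.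

(** The common form of the two kinds of layers. It makes the degree depend on
    the fan-in, not on the size of the images. *)
Lemma linear_part_sparse (R : realType) (a : arch R) i (j : 'I_(layer_dim a i.+1)) :
  exists (ws : fan_in a i -> weight_index a i)
         (us : fan_in a i -> 'I_(layer_dim a i) + R),
  forall (A : weights a i) u,
    linear_part A u j 0 = \sum_q weight_entry A (ws q) * source u (us q).
Proof.
case: a j => [d|k c h w g] /= j.
  by exists (fun q => (j, q)), inl => A u; rewrite mxE.
case/mxvec_indexP: j => o ab; case/mxvec_indexP: ab => a b.
have /choice[us usE] : forall q : 'I_(c i) * ('I_k * 'I_k),
    exists s : 'I_(c i * (h i * w i)) + R, forall u : 'cV[R]_(c i * (h i * w i)),
    padded (g i) (channel u q.1) (a * stride_v (g i) + q.2.1)%N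
           (b * stride_h (g i) + q.2.2)%N = source u s.
  by move=> q; exact: padded_source.
exists (fun q => (o, q.1, q.2)), us => K u.
rewrite /convolution mxE mxvecE mxE mxvecE mxE.
transitivity (\sum_i0 \sum_(p : 'I_k * 'I_k)
    K o i0 p.1 p.2 * source u (us (i0, p))); last first.
  by rewrite pair_bigA; apply: eq_bigr => -[].
apply: eq_bigr => i0 _; rewrite pair_bigA /=.
by apply: eq_bigr => -[p q] _; rewrite -usE.
Qed.

Record parameters (R : realType) (a : arch R) (s : nat) := MakeParameters {
  p_act : nat -> ratfun R s s;
  p_weight : forall i, weights a i;
  p_bias : forall i, 'cV[R]_(layer_dim a i.+1)
}.

Definition net (R : realType) (a : arch R) s L (th : parameters a s) :=
  network (p_act th) (p_weight th) (p_bias th) L.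
Arguments net {R a s} L th _.

Definition coef_index (R : realType) s (act : activations R s) (L : nat) : finType :=
  match act with
  | Fixed _ => void
  | Trainable => ('I_L * ('I_s.+1 + 'I_s.+1))%type
  end.

Definition coef_entry (R : realType) s (act : activations R s) (L : nat)
    (rho : nat -> ratfun R s s) : coef_index act L -> R :=
  match act return coef_index act L -> R with
  | Fixed _ => fun v => match v with end
  | Trainable => fun q => match q.2 with
                          | inl k => (Defs.num (rho q.1))`_k
                          | inr k => (Defs.den (rho q.1))`_k
                          end
  end.

Definition param_index (R : realType) (a : arch R) s (act : activations R s)
    (L : nat) : finType :=
  ({i : 'I_L & (weight_index a i + 'I_(layer_dim a i.+1))%type} +
   coef_index act L)%type.

Definition param_entry (R : realType) (a : arch R) s (act : activations R s)
    (L : nat) (th : parameters a s) (q : param_index a act L) : R :=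
  match q with
  | inl (existT i (inl k)) => weight_entry (p_weight th i) k
  | inl (existT i (inr j)) => p_bias th i j 0
  | inr k => coef_entry (p_act th) k
  end.

Lemma card_param_index (R : realType) (a : arch R) s (act : activations R s) L :
  #|param_index a act L| = num_params a act L.
Proof.
rewrite card_sum card_tagged /num_params; congr (_ + _)%N.
  rewrite sumnE big_map enumT -[index_enum _]/(index_enum _).
  by apply: eq_bigr => i _; rewrite card_sum card_weight_index card_ord.
by case: act => [rho|] /=; rewrite ?card_void // card_prod card_sum !card_ord.
Qed.

(** * Networks as quotients of polynomials *)

Definition joint_var (R : realType) (a : arch R) s (act : activations R s) L :=
  (param_index a act L + 'I_(layer_dim a 0))%type.

Definition joint_entry (R : realType) (a : arch R) s (act : activations R s) L
    (th : parameters a s) (x : 'cV[R]_(layer_dim a 0)) (v : joint_var a act L) : R :=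
  match v with inl q => param_entry th q | inr j => x j 0 end.

(** The degree in the parameters alone: the sample is constant while patterns
    are counted. *)
Definition param_weight (A B : Type) (v : A + B) : nat :=
  match v with inl _ => 1 | inr _ => 0 end.

Notation wdeg := (pdeg (@param_weight _ _)).

Definition fixes (R : realType) s (act : activations R s)
    (rho : nat -> ratfun R s s) : Prop :=
  match act with Fixed rho0 => rho = rho0 | Trainable => True end.

Lemma coefficient_exprs (R : realType) (a : arch R) s (act : activations R s) L
    l (k : 'I_s.+1) : (l < L)%N ->
  exists nc dc : pexp R (joint_var a act L),
    [/\ (wdeg nc <= 1)%N, (wdeg dc <= 1)%N &
     forall th x, fixes act (p_act th) ->
       ev nc (joint_entry th x) = (Defs.num (p_act th l))`_k /\
       ev dc (joint_entry th x) = (Defs.den (p_act th l))`_k].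
Proof.
case: act => [rho|] lL.
  exists (PCst (Defs.num (rho l))`_k), (PCst (Defs.den (rho l))`_k).
  by split=> // th x /= ->.
exists (PVar (inl (inr (Ordinal lL, inl k)))), (PVar (inl (inr (Ordinal lL, inr k)))).
by split.
Qed.

(** The quotients P k / Q k are put over the common denominator T, the product
    of the denominators over the fan-in; a weight or a bias adds 1 to the
    degree. *)
Lemma linear_exprs (R : realType) (a : arch R) s (act : activations R s) L l D
    (P Q : 'I_(layer_dim a l) -> pexp R (joint_var a act L))
    (j : 'I_(layer_dim a l.+1)) :
  (l < L)%N -> (forall k, (wdeg (P k) <= D)%N /\ (wdeg (Q k) <= D)%N) ->
  exists U T : pexp R (joint_var a act L),
    [/\ (wdeg U <= #|fan_in a l| * D + 1)%N, (wdeg T <= #|fan_in a l| * D + 1)%N &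
     forall th x, let e := joint_entry th x in (forall k, ev (Q k) e != 0) ->
       ev T e != 0 /\
       ev U e / ev T e =
       (linear_part (p_weight th l) (\col_k (ev (P k) e / ev (Q k) e))
        + p_bias th l) j 0].
Proof.
move=> lL degD; have [ws [us E]] := linear_part_sparse j.
pose Ps q : pexp R (joint_var a act L) := match us q with inl k => P k | inr r => PCst r end.
pose Qs q : pexp R (joint_var a act L) := match us q with inl k => Q k | inr r => PCst 1 end.
have PsD q : (wdeg (Ps q) <= D)%N.
  by rewrite /Ps; case: (us q) => [k|//]; have [] := degD k.
have QsD q : (wdeg (Qs q) <= D)%N.
  by rewrite /Qs; case: (us q) => [k|//]; have [] := degD k.
pose T := pprod Qs.
pose wv q : joint_var a act L := inl (inl (existT _ (Ordinal lL) (inl (ws q)))).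
pose bv : joint_var a act L := inl (inl (existT _ (Ordinal lL) (inr j))).
pose oth q q' := if q' == q then PCst 1 else Qs q'.
pose U := PAdd (psum (fun q => PMul (PVar (wv q)) (PMul (Ps q) (pprod (oth q)))))
               (PMul (PVar bv) T).
have TD : (wdeg T <= #|fan_in a l| * D)%N.
  by rewrite pdeg_prod -sum_nat_const; apply: leq_sum.
exists U, T; split.
- rewrite /U /= geq_max [(1 + wdeg T)%N]addnC leq_add2r TD andbT.
  apply: pdeg_sum => q /=; rewrite addnC leq_add2r.
  rewrite pdeg_prod (bigD1 q) //= /oth eqxx /= add0n.
  have -> : (#|fan_in a l| * D = D + \sum_(q' | q' != q) D)%N.
    by rewrite -sum_nat_const (bigD1 q).
  rewrite leq_add //.
  by apply: leq_sum => q' /negbTE ->.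
- by rewrite (leq_trans TD) // leq_addr.
move=> th x e Q0.
have Qs0 q : ev (Qs q) e != 0.
  by rewrite /Qs; case: (us q) => [k|_] //=; exact: oner_neq0.
have T0 : ev T e != 0 by rewrite ev_prod; apply/prodf_neq0 => q _.
split=> //; rewrite mxE E /U /= ev_sum mulrDl mulfK //; congr (_ + _).
rewrite mulr_suml; apply: eq_bigr => q _ /=.
rewrite -mulrA; congr (_ * _).
have -> : source (\col_k (ev (P k) e / ev (Q k) e)) (us q) = ev (Ps q) e / ev (Qs q) e.
  by rewrite /Ps /Qs; case: (us q) => [k|r] /=; rewrite ?mxE ?divr1.
rewrite -mulrA; congr (_ * _); rewrite /T !ev_prod [X in _ / X](bigD1 q) //=.
rewrite (bigD1 q) //= {1}/oth eqxx /= mul1r.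
rewrite (eq_bigr (fun q' => ev (Qs q') e)) => [|q' /negbTE nq]; last by rewrite /oth nq.
rewrite invfM mulrCA divff ?mulr1 //.
by apply/prodf_neq0 => q' _.
Qed.

Lemma homogenized_horner (R : fieldType) s (p : {poly R}) (u v : R) :
  (size p <= s.+1)%N -> v != 0 ->
  \sum_(k < s.+1) p`_k * (u ^+ k * v ^+ (s - k)) = p.[u / v] * v ^+ s.
Proof.
move=> ps v0; rewrite (horner_coef_wide _ ps) mulr_suml; apply: eq_bigr => k _.
rewrite -!mulrA; congr (_ * _); rewrite expr_div_n -mulrA; congr (_ * _).
have ks : (k <= s)%N by rewrite -ltnS.
have -> : v ^+ s = v ^+ k * v ^+ (s - k) by rewrite -exprD subnKC.
by rewrite mulKf // expf_neq0.
Qed.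

(** The activation multiplies the degree of its argument by s, and a trainable
    coefficient adds 1. *)
Fixpoint layer_degree (R : realType) (a : arch R) (s l : nat) : nat :=
  match l with
  | 0 => 0
  | l.+1 => s * (#|fan_in a l| * layer_degree a s l + 1) + 1
  end%N.

(** Delta accumulates the denominators of all layers, because a pole of an
    early layer need not be visible in the final quotients P j / Q j. *)
Lemma network_exprs (R : realType) (a : arch R) s (act : activations R s) L l :
  (l <= L)%N ->
  exists (P Q : 'I_(layer_dim a l) -> pexp R (joint_var a act L))
         (Delta : pexp R (joint_var a act L)),
    (forall j, (wdeg (P j) <= layer_degree a s l)%N /\
               (wdeg (Q j) <= layer_degree a s l)%N) /\
    forall th x, fixes act (p_act th) -> let e := joint_entry th x in
      (ev Delta e != 0 -> forall j, ev (Q j) e != 0) /\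
      net l th x = if ev Delta e != 0 then Some (\col_j (ev (P j) e / ev (Q j) e))
                   else None.
Proof.
elim: l => [|l IH] lL.
  exists (fun j => PVar (inr j)), (fun j => PCst 1), (PCst 1).
  split=> // th x _; split=> [_ j|] /=; first exact: oner_neq0.
  rewrite oner_neq0; congr Some; apply/colP => j; by rewrite mxE divr1.
have [P [Q [Delta [degPQ netE]]]] := IH (ltnW lL).
have /choice[U /choice[T UT]] := fun j => linear_exprs j lL degPQ.
have /choice[nc /choice[dc ncdc]] := fun k : 'I_s.+1 => coefficient_exprs a act k lL.
pose hom (cs : 'I_s.+1 -> pexp R (joint_var a act L)) j :=
  psum (fun k : 'I_s.+1 => PMul (cs k) (PMul (ppow (U j) k) (ppow (T j) (s - k)))).
exists (hom nc), (hom dc), (PMul Delta (pprod (hom dc))).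
set D := (#|fan_in a l| * layer_degree a s l + 1)%N.
have homD cs j : (forall k, (wdeg (cs k) <= 1)%N) -> (wdeg (hom cs j) <= layer_degree a s l.+1)%N.
  move=> cs1; apply: pdeg_sum => k /=; rewrite addnC leq_add // !pdeg_pow -/D.
  have [UD TD _] := UT j.
  rewrite (@leq_trans (k * D + (s - k) * D)) ?leq_add ?leq_mul //.
  by rewrite -mulnDl subnKC // -ltnS.
split=> [j|th x fx e].
  by split; apply: homD => k; have [] := ncdc k.
have [Q0 netl] := netE th x fx.
have homE j : (forall k, ev (Q k) e != 0) ->
   [/\ ev (T j) e != 0,
    ev (hom nc j) e = (Defs.num (p_act th l)).[ev (U j) e / ev (T j) e] * ev (T j) e ^+ s &
    ev (hom dc j) e = (Defs.den (p_act th l)).[ev (U j) e / ev (T j) e] * ev (T j) e ^+ s].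
  move=> Qe; have [_ _ /(_ th x Qe) [T0 _]] := UT j.
  split=> //; rewrite -homogenized_horner ?num_deg ?den_deg // ev_sum;
    apply: eq_bigr => k _ /=; rewrite !ev_pow; congr (_ * _).
    by have [_ _ /(_ th x fx) []] := ncdc k.
  by have [_ _ /(_ th x fx) []] := ncdc k.
split=> [|].
  by rewrite /= mulf_eq0 negb_or ev_prod => /andP[_ /prodf_neq0 d0] j; exact: d0.
rewrite /net /= -/(net l th x) netl /= mulf_eq0 negb_or.
case: ifPn => //= De; rewrite ev_prod /activate.
have Qe := Q0 De.
have uE j : (linear_part (p_weight th l) (\col_k (ev (P k) e / ev (Q k) e))
        + p_bias th l) j 0 = ev (U j) e / ev (T j) e.
  by have [_ _ /(_ th x Qe) [_ ->]] := UT j.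
have -> : [forall j, (Defs.den (p_act th l)).[(linear_part (p_weight th l)
    (\col_k (ev (P k) e / ev (Q k) e)) + p_bias th l) j 0] != 0] =
    (\prod_j ev (hom dc j) e != 0).
  apply/forallP/prodf_neq0 => [d0 j _|d0 j].
    have [T0 _ ->] := homE j Qe.
    by rewrite mulf_neq0 ?expf_neq0 // -uE.
  have [T0 _ dE] := homE j Qe.
  by have := d0 j isT; rewrite dE mulf_eq0 negb_or -uE => /andP[].
case: ifPn => // _; congr Some; apply/colP => j; rewrite [LHS]mxE [RHS]mxE.
have [T0 -> ->] := homE j Qe.
by rewrite /rateval uE invfM mulrACA divff ?mulr1 // expf_neq0.
Qed.

(** * Covering the outputs on a sample *)

Lemma layer_degree_le (R : realType) (a : arch R) s l :
  (0 < s)%N -> (forall j, (j <= l)%N -> (0 < #|fan_in a j|)%N) ->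
  (layer_degree a s l.+1 <=
   2 * l.+1 * (s ^ l.+1 * \prod_(1 <= j < l.+1) #|fan_in a j|))%N.
Proof.
move=> s0; elim: l => [|l IH] f0; first by rewrite /= big_nil; lia.
rewrite big_nat_recr //.
have {}IH := IH (fun j jl => f0 j (leqW jl)).
have -> : layer_degree a s l.+2 =
  (s * (#|fan_in a l.+1| * layer_degree a s l.+1 + 1) + 1)%N by [].
set D := layer_degree a s l.+1 in IH *; set Pi := (\prod_(1 <= i < l.+1) _)%N in IH *.
have fl := f0 l.+1 (leqnn _); set F := #|fan_in a l.+1| in fl *.
have Pi0 : (0 < Pi)%N.
  rewrite /Pi big_nat; apply: prodn_cond_gt0 => j /andP[_ jl]; apply: f0.
  exact: leqW.
have S0 : (0 < s ^ l.+1)%N by rewrite expn_gt0 s0.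
rewrite [(s ^ l.+2)%N]expnS; set S := (s ^ l.+1)%N in IH S0 *.
have H1 : (F * D <= F * (2 * l.+1 * (S * Pi)))%N by rewrite leq_mul2l IH orbT.
have H2 : (1 <= S * (Pi * F))%N by rewrite !muln_gt0 S0 Pi0.
have H3 : (s * (F * D) <= s * (F * (2 * l.+1 * (S * Pi))))%N by rewrite leq_mul2l H1 orbT.
have H4 : (s * 1 <= s * (S * (Pi * F)))%N by rewrite leq_mul2l H2 orbT.
clear IH H1 H2 f0; clearbody D Pi F S.
rewrite [leqRHS](_ : _ = s * (F * (2 * l.+1 * (S * Pi))) + 2 * (s * (S * (Pi * F))))%N; last first.
  by rewrite !mulnA; ring.
lia.
Qed.

Lemma width_prodE (R : realType) (a : arch R) L : (0 < L)%N ->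
  width_prod a L = (\prod_(1 <= j < L) #|fan_in a j|)%N.
Proof.
move=> L0; case: a => [d|k c h w g] /=; first by apply: eq_bigr => j _; rewrite card_ord.
rewrite [RHS](eq_bigr (fun j => c j * k ^ 2)%N) => [|j _]; last first.
  by rewrite /= !card_prod !card_ord mulnn.
by rewrite big_split /= mulnC prod_nat_const_nat expnM.
Qed.

Lemma net_range (R : realType) (a : arch R) s (th : parameters a s) L t x u :
  (0 < L)%N -> im_within (p_act th L.-1) t -> net L th x = Some u ->
  forall j, - t <= u j 0 <= t.
Proof.
case: L u => // l u _ imt; rewrite /net /=.
case: (network _ _ _ l x) => [u'|//] /=; rewrite /activate.
by case: ifP => // /forallP d0 [<-] j; rewrite mxE; apply: imt.
Qed.

Lemma grid_separation (R : realType) (t eps u u' : R) G :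
  0 < eps -> - t <= u -> u' <= t -> 2 * t <= G%:R * eps -> u + eps < u' ->
  exists g : 'I_G, u <= - t + g%:R * eps < u'.
Proof.
move=> e0 tu u't tG uu'.
have exg : exists g, u <= - t + g%:R * eps.
  by exists G; lra.
case: (ex_minnP exg) => g ug gmin.
have gu' : - t + g%:R * eps < u'.
  case: g ug gmin => [|g] ug gmin; first by lra.
  have : - t + g%:R * eps < u.
    by rewrite ltNge; apply/negP => /gmin; rewrite ltnn.
  by rewrite -natr1; lra.
have gG : (g < G)%N.
  by rewrite -(ltr_nat R) -(ltr_pM2r e0); lra.
by exists (Ordinal gG); rewrite /= ug.
Qed.

(** The range condition is a hypothesis when the activations are fixed, and
    part of the class when they are trainable; the condition below serves both
    cases. *)
Definition class_parameters (R : realType) (a : arch R) s (act : activations R s)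
    (L : nat) (t : R) :=
  {th : parameters a s | fixes act (p_act th) /\ im_within (p_act th L.-1) t}.

Definition realised (Th : Type) (T : finType) (pat : Th -> T) : {set T} :=
  [set p | `[< exists th, pat th = p >]].

(** The pattern of a parameter records, for each sample point, output
    coordinate and threshold theta of a grid of step eps, whether P Q - theta
    Q^2 is positive, that is, whether the output exceeds theta. Outputs more
    than eps apart are separated by a threshold. *)
Theorem network_cover (R : realType) (a : arch R) s (act : activations R s) L (t : R)
    n (X : 'M[R]_(layer_dim a 0, n)) G (eps : R) :
  (0 < L)%N -> 0 < eps -> 2 * t <= G%:R * eps ->
  let N := num_params a act L in
  let m := (n * layer_dim a L * G)%N in
  exists (T : finType) (pat : class_parameters a act L t -> T),
    (#|realised pat| <= (N * (4 * m * layer_degree a s L + 2 * N) + 1) ^ N)%N /\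
    forall th th', pat th = pat th' -> forall i u u',
      net L (sval th) (col i X) = Some u -> net L (sval th') (col i X) = Some u' ->
      forall j, `|u j 0 - u' j 0| <= eps.
Proof.
move=> L0 eps0 tG N m.
have [P [Q [Delta [degPQ netE]]]] := network_exprs a act (leqnn L).
pose I := param_index a act L; pose J := ('I_n * 'I_(layer_dim a L) * 'I_G)%type.
pose sub i (v : joint_var a act L) : pexp R 'I_#|I| :=
  match v with inl q => PVar (enum_rank q) | inr j => PCst (X j i) end.
pose thr g : R := - t + g%:R * eps.
pose f0 (q : J) := PAdd (PMul (P q.1.2) (Q q.1.2))
                        (PMul (PCst (- thr q.2)) (PMul (Q q.1.2) (Q q.1.2))).
pose f (q : 'I_#|{: J}|) := let q := enum_val q in pbind (sub q.1.1) (f0 q).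
pose env (th : parameters a s) (k : 'I_#|I|) := param_entry th (enum_val k : I).
exists {ffun 'I_#|{: J}| -> bool}, (fun th => sign_pattern f (env (sval th))).
have fE th q : ev (f (enum_rank q)) (env th) = ev (f0 q) (joint_entry th (col q.1.1 X)).
  rewrite /f enum_rankK ev_bind; apply: eq_ev => -[k|j] /=; last by rewrite mxE.
  by rewrite /env enum_rankK.
split.
  have -> : N = #|I| by rewrite card_param_index.
  have -> : m = #|{: J}| by rewrite !card_prod !card_ord.
  have -> : (4 * #|{: J}| * layer_degree a s L =
             2 * #|{: J}| * (2 * layer_degree a s L))%N by lia.
  apply: (@card_sign_patterns R #|I| #|{: J}| (2 * layer_degree a s L) f).
    move=> q; have [dP dQ] := degPQ (enum_val q).1.2.
    apply: leq_trans (pdeg_bind (w := @param_weight _ _) _ _) _; first by case.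
    by rewrite /f0 /= add0n geq_max mul2n -addnn !leq_add.
  by move=> p; rewrite inE => /asboolP[th <-]; exists (env (sval th)).
move=> [th [fx imt]] [th' [fx' imt']] /= /ffunP pp i u u' nu nu' j.
have [Q0 ] := netE th (col i X) fx; rewrite nu; case: ifP => // De [uE].
have [Q0'] := netE th' (col i X) fx'; rewrite nu'; case: ifP => // De' [uE'].
have cmp (g : 'I_G) : (thr g < u j 0) = (thr g < u' j 0).
  have := pp (enum_rank (i, j, g)); rewrite !ffunE !fE /= uE uE' !mxE.
  have pos (x y z : R) : y != 0 -> (0 < x * y + - z * (y * y)) = (z < x / y).
    move=> y0; have -> : x * y + - z * (y * y) = (x / y - z) * y ^+ 2 by field.
    by rewrite pmulr_lgt0 ?subr_gt0 // exprn_even_gt0.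
  by rewrite !pos //; [exact: (Q0' De')|exact: (Q0 De)].
have /andP[ur1 ur2] := net_range L0 imt nu j.
have /andP[ur1' ur2'] := net_range L0 imt' nu' j.
rewrite leNgt; apply/negP; rewrite ltr_normr => /orP[] big.
  have [||||g /andP[g1 g2]] := @grid_separation R t eps (u' j 0) (u j 0) G eps0; try lra.
  by move: g1; rewrite leNgt -/(thr g) -cmp g2.
have [||||g /andP[g1 g2]] := @grid_separation R t eps (u j 0) (u' j 0) G eps0; try lra.
by move: g1; rewrite leNgt -/(thr g) cmp g2.
Qed.

(** * Exponential moments of Rademacher sums *)

Lemma fact_double (j : nat) : (2 ^ j * j`! <= (2 * j)`!)%N.
Proof.
elim: j => // j IH; rewrite mulnS !factS expnS.
have : (0 < (2 * j)`!)%N by exact: fact_gt0.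
move: IH; move: ((2 * j)`!) (2 ^ j)%N (j`!) => f p q IH f0.
have -> : (2 * p * (j.+1 * q) = 2 * j.+1 * (p * q))%N by ring.
apply: (@leq_trans (2 * j.+1 * ((2 * j).+1 * f))); last by lia.
by rewrite leq_mul // (leq_trans IH) // leq_pmull.
Qed.

(** Term by term in the power series, since (2 j)! is at least 2^j j!. *)
Lemma cosh_le (R : realType) (x : R) :
  (expR x + expR (- x)) / 2 <= expR (x ^+ 2 / 2).
Proof.
have even_sum N : \sum_(k < N) (exp_coeff x k + exp_coeff (- x) k) <=
    2 * \sum_(j < N) x ^+ (2 * j) / (2 * j)`!%:R.
  have termE k : exp_coeff x k + exp_coeff (- x) k =
      if odd k then 0 else 2 * (x ^+ k / k`!%:R).
    rewrite /exp_coeff /= -mulrDl exprNn -signr_odd; case: (odd k).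
      by rewrite expr1 mulN1r subrr mul0r.
    by rewrite expr0 mul1r -mulr2n -[x ^+ k *+ 2]mulr_natl mulrA.
  have term_ge0 k : 0 <= exp_coeff x k + exp_coeff (- x) k.
    rewrite termE; case: (boolP (odd k)) => // ek.
    by rewrite mulr_ge0 // divr_ge0 // exprn_even_ge0.
  apply: (@le_trans _ _ (\sum_(k < 2 * N) (exp_coeff x k + exp_coeff (- x) k))).
    rewrite -!(big_mkord xpredT (fun k => exp_coeff x k + exp_coeff (- x) k)).
    rewrite (@big_cat_nat _ _ _ N 0 (2 * N)) //= ?lerDl; last by lia.
    by apply: sumr_ge0.
  rewrite le_eqVlt; apply/orP; left; apply/eqP.
  elim: N => [|N IH]; first by rewrite !big_ord0 mulr0.
  rewrite mulnS add2n !big_ord_recr /= IH mulrDr -addrA; congr (_ + _).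
  by rewrite !termE /= oddM /= addr0.
have part N : (series (exp_coeff x) N + series (exp_coeff (- x)) N) / 2 <= expR (x ^+ 2 / 2).
  rewrite /series /= !big_mkord -big_split /=.
  apply: (@le_trans _ _ (\sum_(j < N) exp_coeff (x ^+ 2 / 2) j)).
    rewrite ler_pdivrMr // mulrC (le_trans (even_sum N)) // ler_wpM2l //.
    apply: ler_sum => j _; rewrite /exp_coeff /= expr_div_n -exprM -mulrA ler_wpM2l //.
      by rewrite exprM exprn_ge0 // sqr_ge0.
    rewrite -invfM lef_pV2 ?posrE ?mulr_gt0 ?exprn_gt0 ?ltr0n ?fact_gt0 //.
    by rewrite -natrX -natrM ler_nat fact_double.
  rewrite -(big_mkord xpredT (exp_coeff (x ^+ 2 / 2))).
  rewrite -[leRHS]/(limn (series (exp_coeff (x ^+ 2 / 2)))).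
  apply: (@nondecreasing_cvgn_le _ (series (exp_coeff (x ^+ 2 / 2)))).
    apply: nondecreasing_series => k _ _; rewrite /exp_coeff /= mulr_ge0 //.
    by rewrite exprn_ge0 // divr_ge0 // sqr_ge0.
  exact: is_cvg_series_exp_coeff.
have cv : (fun N => (series (exp_coeff x) N + series (exp_coeff (- x)) N) / 2) @ \oo -->
   (expR x + expR (- x)) / 2.
  apply: cvgM; last exact: cvg_cst.
  by apply: cvgD; exact: is_cvg_series_exp_coeff.
rewrite -(cvg_lim _ cv) //; apply: limr_le; first by apply/cvg_ex; eexists; exact: cv.
by apply: nearW => N; exact: part.
Qed.

Lemma sign_mgf (R : realType) n (a : 'I_n -> R) :
  (2 ^+ n)^-1 * (\sum_(sg : {ffun 'I_n -> bool}) expR (\sum_i (-1) ^+ sg i * a i)) <=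
  expR (\sum_i a i ^+ 2 / 2).
Proof.
rewrite expR_sum.
rewrite (eq_bigr (fun sg : {ffun 'I_n -> bool} => \prod_i expR ((-1) ^+ sg i * a i)));
  last by move=> sg _; rewrite expR_sum.
rewrite -(bigA_distr_bigA (fun i (b : bool) => expR ((-1) ^+ b * a i))) /=.
have -> : (2 ^+ n : R)^-1 = \prod_(i < n) 2^-1 by rewrite prodr_const card_ord exprVn.
rewrite -big_split /=; apply: ler_prod => i _.
rewrite big_bool /= expr0 expr1 mul1r mulN1r addrC mulrC.
by rewrite cosh_le divr_ge0 // addr_ge0 // expR_ge0.
Qed.

(** A selection h of one parameter for each sign vector replaces a supremum
    inside the average. Passing from a parameter to the representative of its
    pattern costs kap per coordinate, and the largest of the exponentials of
    the representatives is at most their sum. *)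
Lemma finite_class_mgf (R : realType) n (Th : Type) (v : Th -> 'I_n -> R)
    (T : finType) (pat : Th -> T) (M : nat) (A kap lam : R) :
  (#|realised pat| <= M)%N -> 0 <= lam ->
  (forall th i, `|v th i| <= A) ->
  (forall th th', pat th = pat th' -> forall i, `|v th i - v th' i| <= kap) ->
  forall h : {ffun 'I_n -> bool} -> Th,
  (2 ^+ n)^-1 * (\sum_(sg : {ffun 'I_n -> bool}) expR (lam * \sum_i (-1) ^+ sg i * v (h sg) i)) <=
  M%:R * expR (lam * n%:R * kap + lam ^+ 2 * n%:R * A ^+ 2 / 2).
Proof.
move=> cM lam0 vA vkap h.
have /choice[r rP] : forall p : {p | p \in realised pat}, exists th, pat th = val p.
  by move=> [p /= pP]; move: (pP); rewrite inE => /asboolP.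
have inR th : pat th \in realised pat by rewrite inE; apply/asboolP; exists th.
pose T' : finType := {p | p \in realised pat}.
have step (sg : {ffun 'I_n -> bool}) : expR (lam * \sum_i (-1) ^+ sg i * v (h sg) i) <=
    expR (lam * n%:R * kap) *
    \sum_(p : T') expR (\sum_i (-1) ^+ sg i * (lam * v (r p) i)).
  pose p0 : T' := exist _ (pat (h sg)) (inR (h sg)).
  rewrite (bigD1 p0) //= mulrDr ler_wpDr //.
    by rewrite mulr_ge0 ?expR_ge0 // sumr_ge0 // => p _; exact: expR_ge0.
  rewrite -expRD ler_expR.
  have -> : \sum_i (-1) ^+ sg i * (lam * v (r p0) i) =
            lam * \sum_i (-1) ^+ sg i * v (r p0) i.
    by rewrite mulr_sumr; apply: eq_bigr => i _; rewrite mulrCA.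
  rewrite -mulrA -mulrDr ler_wpM2l // -lerBlDr -sumrB.
  apply: (@le_trans _ _ (\sum_(i < n) kap)); last first.
    by rewrite sumr_const card_ord mulr_natl.
  apply: ler_sum => i _; rewrite -mulrBr.
  apply: (le_trans (ler_norm _)); rewrite normrM normrX normrN1 expr1n mul1r.
  by apply: vkap; rewrite rP.
apply: (@le_trans _ _ (expR (lam * n%:R * kap) *
    \sum_(p : T') (2 ^+ n)^-1 *
       \sum_(sg : {ffun 'I_n -> bool}) expR (\sum_i (-1) ^+ sg i * (lam * v (r p) i)))).
  rewrite -mulr_sumr mulrCA ler_wpM2l ?invr_ge0 ?exprn_ge0 // exchange_big /=.
  by rewrite mulr_sumr; apply: ler_sum => sg _; exact: step.
rewrite expRD mulrCA ler_wpM2l ?expR_ge0 //.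
apply: (@le_trans _ _ (\sum_(p : T') expR (lam ^+ 2 * n%:R * A ^+ 2 / 2))).
  apply: ler_sum => p _; apply: le_trans (sign_mgf _) _; rewrite ler_expR.
  apply: (@le_trans _ _ (\sum_(i < n) lam ^+ 2 * A ^+ 2 / 2)).
    apply: ler_sum => i _; rewrite ler_pM2r ?invr_gt0 // exprMn ler_wpM2l ?sqr_ge0 //.
    by rewrite -(real_normK (num_real (v _ _))) ler_sqr ?nnegrE // (le_trans _ (vA (r p) i)).
  by rewrite sumr_const card_ord -mulr_natl; lra.
rewrite sumr_const -[leLHS]mulr_natl ler_wpM2r ?expR_ge0 // ler_nat.
by rewrite (leq_trans _ cM) // card_sig.
Qed.

(** The optimal lam is sqrt (b / c). If b or c is 0, the infimum 0 of the
    right-hand side is only approached, by small or by large lam. *)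
Lemma minimize_tradeoff (R : realType) (x b c : R) : 0 <= b -> 0 <= c ->
  (forall lam, 0 < lam -> x <= b / lam + lam * c) -> x <= 2 * Num.sqrt (b * c).
Proof.
move=> b0 c0 H; have [bp|] := ltP 0 b; last first.
  move=> b_le0; have -> : b = 0 by apply/eqP; rewrite eq_le b_le0.
  rewrite mul0r sqrtr0 mulr0 leNgt; apply/negP => x0.
  have := H (x / (2 * (c + 1))); rewrite divr_gt0 ?mulr_gt0 ?ltr_wpDl //.
  move=> /(_ isT); apply/negP; rewrite -ltNge.
  have -> : b = 0 by apply/eqP; rewrite eq_le b_le0.
  rewrite mul0r add0r mulrAC ltr_pdivrMr ?mulr_gt0 ?ltr_wpDl // ltr_pM2l //; lra.
have [cp|c_le0] := ltP 0 c; last first.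
  have c00 : c = 0 by apply/eqP; rewrite eq_le c_le0.
  rewrite c00 mulr0 sqrtr0 mulr0 leNgt; apply/negP => x0.
  have := H (2 * b / x); rewrite divr_gt0 ?mulr_gt0 // => /(_ isT).
  apply/negP; rewrite -ltNge c00 mulr0 addr0 invf_div mulrA ltr_pdivrMr ?mulr_gt0 //.
  by rewrite mulrC ltr_pM2l //; lra.
have [p p0 bE] : exists2 p, 0 < p & b = p ^+ 2.
  by exists (Num.sqrt b); rewrite ?sqrtr_gt0 ?sqr_sqrtr.
have [q q0 cE] : exists2 q, 0 < q & c = q ^+ 2.
  by exists (Num.sqrt c); rewrite ?sqrtr_gt0 ?sqr_sqrtr.
have := H (p / q) (divr_gt0 p0 q0).
rewrite bE cE sqrtrM ?sqr_ge0 // !sqrtr_sqr !gtr0_norm //.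
by have -> : p ^+ 2 / (p / q) + p / q * q ^+ 2 = 2 * (p * q) by field; lra.
Qed.

(** * Rademacher complexity of a covered class *)

(** Jensen's inequality, from the tangent line at the mean. *)
Lemma expR_mean_le (R : realType) (I : finType) (w : R) (y : I -> R) :
  0 <= w -> w * #|I|%:R = 1 ->
  expR (w * \sum_i y i) <= w * \sum_i expR (y i).
Proof.
move=> w0 w1; set m := w * \sum_i y i.
have -> : expR m = w * \sum_(i in I) (expR m * (1 + (y i - m))).
  rewrite -mulr_sumr mulrCA -[LHS]mulr1; congr (_ * _).
  by rewrite big_split sumrB /= !sumr_const -[m *+ _]mulr_natr -mulr_natl mulr1 mulrDr mulrBr w1
    -/m mulrCA [w * _]w1 mulr1 subrr addr0.
rewrite ler_wpM2l //; apply: ler_sum => i _.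
by rewrite -[in leRHS](subrKC m (y i)) expRD ler_wpM2l ?expR_ge0 // expR_ge1Dx.
Qed.

Lemma signed_average_le (R : realType) n (Th : Type) (v : Th -> 'I_n -> R)
    (T : finType) (pat : Th -> T) (M : nat) (A kap : R) :
  (0 < n)%N -> (#|realised pat| <= M)%N -> 0 <= A ->
  (forall th i, `|v th i| <= A) ->
  (forall th th', pat th = pat th' -> forall i, `|v th i - v th' i| <= kap) ->
  forall h : {ffun 'I_n -> bool} -> Th,
  (2 ^+ n)^-1 * (\sum_(sg : {ffun 'I_n -> bool}) n%:R^-1 * \sum_i (-1) ^+ sg i * v (h sg) i) <=
  kap + A * Num.sqrt (2 * ln M%:R / n%:R).
Proof.
move=> n0 cM A0 vA vkap h.
have n0R : 0 < n%:R :> R by rewrite ltr0n.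
have M0 : (0 < M)%N.
  apply: leq_trans cM; apply/card_gt0P; exists (pat (h [ffun=> true])).
  by rewrite inE; apply/asboolP; exists (h [ffun=> true]).
have lnM0 : 0 <= ln M%:R :> R by rewrite ln_ge0 // ler1n.
rewrite -lerBlDl; set x := _ - kap.
have -> : A * Num.sqrt (2 * ln M%:R / n%:R) =
          2 * Num.sqrt (ln M%:R / n%:R * (A ^+ 2 / 2)).
  rewrite (_ : _ * (A ^+ 2 / 2) = (2 * ln M%:R / n%:R) * (A / 2) ^+ 2); last by field; lra.
  rewrite [in RHS]sqrtrM; last by rewrite divr_ge0 ?ler0n // mulr_ge0.
  rewrite sqrtr_sqr ger0_norm ?divr_ge0 //.
  by field.
apply: minimize_tradeoff => [||lam lam0]; first by rewrite divr_ge0 ?ler0n.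
  by rewrite divr_ge0 ?sqr_ge0.
have w1 : (2 ^+ n)^-1 * #|{ffun 'I_n -> bool}|%:R = 1 :> R.
  by rewrite card_ffun card_bool card_ord natrX mulVf // expf_neq0.
have w0 : 0 <= (2 ^+ n)^-1 :> R by rewrite invr_ge0 exprn_ge0.
have := le_trans (expR_mean_le _ w0 w1) (finite_class_mgf cM (ltW lam0) vA vkap h).
rewrite -[M%:R in X in _ <= X]lnK ?posrE ?ltr0n // -expRD ler_expR -mulr_sumr.
have -> : (2 ^+ n)^-1 * (lam * \sum_(sg : {ffun 'I_n -> bool}) \sum_i (-1) ^+ sg i * v (h sg) i) =
          lam * n%:R * (x + kap).
  by rewrite /x subrK -[in RHS]mulr_sumr [RHS]mulrCA -(mulrA lam) mulVKf ?lt0r_neq0.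
move=> H; rewrite -(ler_pM2l (mulr_gt0 lam0 n0R)).
rewrite (_ : lam * n%:R * (_ / lam + _) =
  ln M%:R + lam ^+ 2 * n%:R * A ^+ 2 / 2); last by field; lra.
by move: H; rewrite mulrDr; lra.
Qed.

(** Finitely many suprema are approached simultaneously by a selection h. *)
Lemma mean_ereal_sup_le (R : realType) (I : finType) (w B b : R) (S : I -> set R) :
  0 <= w -> (forall i, S i !=set0) -> (forall i x, S i x -> x <= b) ->
  (forall h : I -> R, (forall i, S i (h i)) -> w * \sum_i h i <= B) ->
  (w%:E * \sum_i ereal_sup (EFin @` S i) <= B%:E)%E.
Proof.
move=> w0 S0 Sb H.
have ubS i : has_ubound (S i) by exists b => x; exact: Sb.
under eq_bigr => i _ do rewrite ereal_sup_EFin //.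
rewrite sumEFin -EFinM lee_fin; apply/ler_addgt0Pr => e e0.
pose eta := e / (w * #|I|%:R + 1).
have d0 : 0 < w * #|I|%:R + 1 by rewrite ltr_wpDl // mulr_ge0.
have eta0 : 0 < eta by rewrite divr_gt0.
have /choice[h hP] : forall i, exists x, S i x /\ sup (S i) - eta < x.
  by move=> i; have [x Sx] := sup_adherent eta0 (conj (S0 i) (ubS i)); exists x.
have := H h (fun i => (hP i).1).
have : w * \sum_i sup (S i) <= w * \sum_i (h i + eta).
  by rewrite ler_wpM2l //; apply: ler_sum => i _; have [_] := hP i; lra.
rewrite big_split /= sumr_const -mulr_natr mulrDr => H1 H2.
have : w * (eta * #|I|%:R) <= e.
  by rewrite mulrCA /eta mulrAC ler_pdivrMr // ler_pM2l // lerDl ler01.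
lra.
Qed.

(** Massart's bound at a single scale. The centre c i does not depend on the
    function, so its signed average over all sign vectors is 0 and it can be
    subtracted from the losses. *)
Theorem rademacher_le (R : realType) d m n (Y : Type) (F : set (pfun R d m))
    (l : 'cV[R]_m -> Y -> R) (X : 'M[R]_(d, n)) (y : 'I_n -> Y)
    (Th : Type) (f : Th -> pfun R d m) (T : finType) (pat : Th -> T) (M : nat)
    (c : 'I_n -> R) (A kap : R) :
  (0 < n)%N -> (forall g, F g -> exists th, g = f th) ->
  (#|realised pat| <= M)%N -> 0 <= A ->
  (forall th i, f th (col i X) <> None ->
     `|loss_at l (f th) (col i X) (y i) - c i| <= A) ->
  (forall th th', pat th = pat th' -> forall i,
     f th (col i X) <> None -> f th' (col i X) <> None ->
     `|loss_at l (f th) (col i X) (y i) - loss_at l (f th') (col i X) (y i)| <= kap) ->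
  (rademacher F l X y <= (kap + A * Num.sqrt (2 * ln M%:R / n%:R))%:E)%E.
Proof.
move=> n0 FE cM A0 lA lkap; rewrite /rademacher.
have w0 : 0 < (2 ^+ n)^-1 :> R by rewrite invr_gt0 exprn_gt0.
set D := F `&` defined_on X.
pose g (sg : {ffun 'I_n -> bool}) f :=
  n%:R^-1 * \sum_i (-1) ^+ sg i * loss_at l f (col i X) (y i).
have [[f1 Df1]|D0] := pselect (D !=set0); last first.
  have {D0} -> : D = set0 by apply/seteqP; split=> // f1 Df; apply: D0; exists f1.
  under eq_bigr do rewrite image_set0 ereal_sup0.
  rewrite (bigD1 [ffun=> true]) //= addNye mulrNy gtr0_sg // mul1e; exact: leNye.
under eq_bigr => sg _ do rewrite -[X in ereal_sup X](image_comp (g sg) EFin).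
pose Th' := {th | defined_on X (f th)}.
have signs0 : \sum_(sg : {ffun 'I_n -> bool}) n%:R^-1 * \sum_i (-1) ^+ sg i * c i = 0.
  rewrite -mulr_sumr exchange_big big1 ?mulr0 //= => i _.
  rewrite -mulr_suml; apply/eqP; rewrite mulf_eq0; apply/orP; left; apply/eqP.
  pose flip (sg : {ffun 'I_n -> bool}) := [ffun j => (j == i) (+) sg j].
  have flipK : involutive flip.
    by move=> sg; apply/ffunP => j; rewrite !ffunE addKb.
  set s := \sum_sg _; suff : s = - s by lra.
  rewrite {1}/s (reindex_inj (inv_inj flipK)) /= /s -sumrN.
  by apply: eq_bigr => sg _; rewrite ffunE eqxx /= -addTb signr_addb mulN1r.
apply: (@mean_ereal_sup_le _ _ _ _ (n%:R^-1 * \sum_(i < n) (A + `|c i|))).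
- exact: ltW.
- by move=> sg; exists (g sg f1), f1.
- move=> sg _ [f2 [/FE[th ->] dX] <-]; rewrite /g ler_wpM2l ?invr_ge0 ?ler0n //.
  apply: ler_sum => i _; apply: (le_trans (ler_norm _)).
  rewrite normrM normrX normrN1 expr1n mul1r -lerBlDr.
  by apply: le_trans (lerB_dist _ _) _; apply: lA; exact: dX.
move=> h hP; have /choice[k kP] : forall sg, exists th : Th', h sg = g sg (f (sval th)).
  move=> sg; have [f2 [/FE[th ->] dX] <-] := hP sg.
  by exists (exist _ th dX).
have := @signed_average_le R n Th' (fun th i => loss_at l (f (sval th)) (col i X) (y i) - c i)
  T (fun th => pat (sval th)) M A kap n0 _ A0 _ _ k.
have -> : \sum_sg h sg = \sum_(sg : {ffun 'I_n -> bool}) n%:R^-1 *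
     \sum_i (-1) ^+ sg i * (loss_at l (f (sval (k sg))) (col i X) (y i) - c i).
  transitivity (\sum_sg h sg - \sum_(sg : {ffun 'I_n -> bool}) n%:R^-1 *
      \sum_i (-1) ^+ sg i * c i); first by rewrite signs0 subr0.
  rewrite -sumrB; apply: eq_bigr => sg _.
  rewrite kP /g -mulrBr -sumrB; congr (_ * _); apply: eq_bigr => i _; by rewrite mulrBr.
apply.
- apply: leq_trans cM; apply: subset_leq_card; apply/fintype.subsetP => p.
  by rewrite inE => /asboolP[th <-]; rewrite inE; apply/asboolP; exists (sval th).
- by move=> [th dX] i; apply: lA; exact: dX.
- move=> [th dX] [th' dX'] /= e i; rewrite opprB addrA subrK.
  by apply: lkap.
Qed.

(** * Joint laws of finite families *)

Lemma measurable_rectangles d (Z : measurableType d) m :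
  (measurable : set (set (m.-tuple Z))) =
  <<s [set A | exists2 B : 'I_m -> set Z, (forall j, measurable (B j)) &
         A = [set z | forall j, B j (tnth z j)]] >>.
Proof.
apply/seteqP; split.
  apply: smallest_sub; first exact: smallest_sigma_algebra.
  move=> A; rewrite -bigcup_seq => -[i _ [Y mY <-]].
  apply: sub_sigma_algebra; exists (fun j => if j == i then Y else setT).
    by move=> j; case: eqP.
  apply/seteqP; split=> [z [_ Yz] j|z Yz]; first by case: eqP => // ->.
  by split=> //; have := Yz i; rewrite eqxx.
apply: smallest_sub; first exact: sigma_algebra_measurable.
move=> _ [B mB ->].
rewrite (_ : [set z | _] = \bigcap_j (@tnth m Z ^~ j @^-1` (B j))); last first.
  by apply/seteqP; split=> [z Bz j _|z Bz j]; [exact: Bz|exact: Bz].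
apply: fin_bigcap_measurable => [|j _]; first exact: finite_finset.
by rewrite -[X in measurable X]setTI; exact: measurable_tnth.
Qed.

(** Rectangles are stable under intersection and generate the product
    sigma-algebra, so they determine the joint law. *)
Lemma eq_integral_tuple (R : realType) d d' (O : measurableType d)
    (Z : measurableType d') (mu : {measure set O -> \bar R}) m
    (Y Y' : 'I_m -> O -> Z) (Psi : m.-tuple Z -> \bar R) :
  (mu setT < +oo)%E ->
  (forall j, measurable_fun setT (Y j)) -> (forall j, measurable_fun setT (Y' j)) ->
  (forall B : 'I_m -> set Z, (forall j, measurable (B j)) ->
     mu [set w | forall j, B j (Y j w)] = mu [set w | forall j, B j (Y' j w)]) ->
  measurable_fun [set: m.-tuple Z] Psi -> (forall z, 0 <= Psi z)%E ->
  (\int[mu]_w Psi [tuple Y j w | j < m] = \int[mu]_w Psi [tuple Y' j w | j < m])%E.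
Proof.
move=> mufin mY mY' same mPsi Psi0.
have mtup (X : 'I_m -> O -> Z) : (forall j, measurable_fun setT (X j)) ->
    measurable_fun setT (fun w => [tuple X j w | j < m]).
  move=> mX; apply/measurable_fun_tnthP => j.
  by rewrite [X in measurable_fun _ X](_ : _ = X j) //; apply/funext => w; rewrite /= tnth_mktuple.
have E (X : 'I_m -> O -> Z) (mX : forall j, measurable_fun setT (X j)) :
    (\int[mu]_w Psi [tuple X j w | j < m] =
     \int[pushforward mu (fun w => [tuple X j w | j < m])]_z Psi z)%E.
  by rewrite (ge0_integral_pushforward (mtup X mX)).
rewrite (E Y mY) (E Y' mY').
pose phi : {mfun O >-> m.-tuple Z} :=
  HB.pack (fun w => [tuple Y j w | j < m]) (isMeasurableFun.Build _ _ _ _ _ (mtup Y mY)).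
pose phi' : {mfun O >-> m.-tuple Z} :=
  HB.pack (fun w => [tuple Y' j w | j < m]) (isMeasurableFun.Build _ _ _ _ _ (mtup Y' mY')).
apply: (@eq_measure_integral _ _ _ _ (pushforward mu phi') (pushforward mu phi)) => A mA _.
apply: (measure_unique _ (fun=> setT) (measurable_rectangles Z m)) => //.
- move=> _ _ [B mB ->] [B' mB' ->]; exists (fun j => B j `&` B' j).
    by move=> j; exact: measurableI.
  apply/seteqP; split=> [z [Bz Bz'] j|z Bz]; first by split; [exact: Bz|exact: Bz'].
  by split=> j; have [] := Bz j.
- by move=> _; exists (fun=> setT) => //; apply/seteqP.
- by rewrite bigcup_const //; exists 0%N.
- move=> _ [B mB ->]; rewrite /pushforward.
  have pre (X : 'I_m -> O -> Z) : (fun w => [tuple X j w | j < m]) @^-1` [set z | forall j, B j (tnth z j)] =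
      [set w | forall j, B j (X j w)].
    by apply/seteqP; split=> w /= Bw j; have := Bw j; rewrite tnth_mktuple.
  by have := same B mB; rewrite -(pre Y) -(pre Y').
Qed.

(** * Symmetrization with a ghost sample *)

(** The two components of w are the sample and the ghost sample; sg tells
    which of their entries are exchanged. *)
Definition swapped (T O : Type) n (S : 'I_n -> O -> T) (sg : {ffun 'I_n -> bool})
    (j : 'I_(n + n)) (w : O * O) : T :=
  match fintype.split j with
  | inl i => S i (if sg i then w.2 else w.1)
  | inr i => S i (if sg i then w.1 else w.2)
  end.

(** The right-hand side does not depend on sg: exchanging entries of an i.i.d.
    double sample preserves its law. *)
Lemma swapped_rectangle (R : realType) dO dZ (O : measurableType dO)
    (Z : measurableType dZ) (P : probability O R) (D : probability Z R) n
    (S : 'I_n -> {RV P >-> Z}) (sg : {ffun 'I_n -> bool})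
    (B : 'I_(n + n) -> set Z) :
  iid D S -> (forall j, measurable (B j)) ->
  ((P \x P) [set w | forall j, B j (swapped (fun i => S i) sg j w)] =
   \prod_(i < n) (D (B (lshift n i)) * D (B (rshift n i))))%E.
Proof.
move=> [SD Sind] mB.
pose C (b : bool) i := if sg i (+) b then B (rshift n i) else B (lshift n i).
have mC b i : measurable (C b i) by rewrite /C; case: ifP.
have -> : [set w | forall j, B j (swapped (fun i => S i) sg j w)] =
    (\bigcap_i (S i @^-1` C false i)) `*` (\bigcap_i (S i @^-1` C true i)).
  apply/seteqP; split=> [w Bw|w [Bw1 Bw2] j].
    split=> i _; rewrite /preimage /= /C.
      have := Bw (lshift n i); have := Bw (rshift n i).
      rewrite /swapped (unsplitK (inl i)) (unsplitK (inr i)).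
      by case: (sg i).
    have := Bw (lshift n i); have := Bw (rshift n i).
    rewrite /swapped (unsplitK (inl i)) (unsplitK (inr i)).
    by case: (sg i).
  rewrite /swapped; case: fintype.splitP => i ji.
    have -> : j = lshift n i by apply: val_inj.
    have := Bw1 i Logic.I; have := Bw2 i Logic.I; rewrite /preimage /= /C.
    by case: (sg i).
  have -> : j = rshift n i by apply: val_inj.
  have := Bw1 i Logic.I; have := Bw2 i Logic.I; rewrite /preimage /= /C.
  by case: (sg i).
have mcap b : measurable (\bigcap_i (S i @^-1` C b i)).
  apply: fin_bigcap_measurable => [|i _]; first exact: finite_finset.
  by rewrite -[X in measurable X]setTI; apply: (measurable_funPT (S i)).
apply: (etrans (product_measure1E P P (mcap false) (mcap true))).
transitivity ((\prod_(i < n) D (C false i)) * (\prod_(i < n) D (C true i)))%E.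
  by congr (_ * _)%E; (apply: etrans (Sind _ _) _ => //; apply: eq_bigr => i _; exact: SD).
rewrite -big_split /=; apply: eq_bigr => i _; rewrite /C.
by case: (sg i) => //=; rewrite muleC.
Qed.

Lemma measurable_swapped (R : realType) dO dZ (O : measurableType dO)
    (Z : measurableType dZ) (P : probability O R) n
    (S : 'I_n -> {RV P >-> Z}) (sg : {ffun 'I_n -> bool}) j :
  measurable_fun setT (swapped (fun i => S i) sg j).
Proof.
rewrite /swapped; case: (fintype.split j) => i; case: (sg i);
  by apply: measurableT_comp => //; exact: measurable_funPT.
Qed.

(** By swapped_rectangle the integral is the same for all exchanges sg, hence
    it is the integral of their average, which is bounded at each point. *)
Lemma symmetrization (R : realType) dO dZ (O : measurableType dO)
    (Z : measurableType dZ) (P : probability O R) (D : probability Z R) n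
    (S : 'I_n -> {RV P >-> Z}) (Psi : (n + n).-tuple Z -> \bar R) (C : R) :
  iid D S -> measurable_fun [set: (n + n).-tuple Z] Psi -> (forall z, 0 <= Psi z)%E ->
  (forall w, ((2 ^+ n)^-1%:E * \sum_(sg : {ffun 'I_n -> bool})
     Psi [tuple swapped (fun i => S i) sg j w | j < n + n] <= C%:E)%E) ->
  (\int[P \x P]_w Psi [tuple swapped (fun i => S i) [ffun=> false] j w | j < n + n] <= C%:E)%E.
Proof.
move=> SD mPsi Psi0 bnd.
have PP1 : ((P \x P) setT = 1)%E.
  rewrite -setXTT; apply: etrans (product_measure1E P P measurableT measurableT) _.
  have PT := probability_setT P.
  exact: etrans (congr2 mule PT PT) (mule1 _).
pose I0 sg := (\int[P \x P]_w Psi [tuple swapped (fun i => S i) sg j w | j < n + n])%E.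
have mtup sg : measurable_fun [set: O * O]
    (fun w => Psi [tuple swapped (fun i => S i) sg j w | j < n + n]).
  apply: (measurableT_comp mPsi); apply/measurable_fun_tnthP => j.
  rewrite [X in measurable_fun _ X](_ : _ = swapped (fun i => S i) sg j).
    exact: measurable_swapped.
  by apply/funext => w; rewrite /= tnth_mktuple.
have E sg : I0 sg = I0 [ffun=> false].
  apply: eq_integral_tuple => //; try by move=> j; exact: measurable_swapped.
    have lt1 (x : \bar R) : x = 1%E -> (x < +oo)%E by move=> ->; rewrite ltry.
    exact: lt1 PP1.
  move=> B mB; have H := swapped_rectangle _ SD mB.
  exact: etrans (H sg) (esym (H [ffun=> false])).
have w0 : (0 <= (2 ^+ n)^-1%:E :> \bar R)%E by rewrite lee_fin invr_ge0 exprn_ge0.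
have meanE (x : \bar R) : (0 <= x)%E ->
    ((2 ^+ n)^-1%:E * (\sum_(sg : {ffun 'I_n -> bool}) x) = x)%E.
  have p0 : 0 < (2 ^+ n)^-1 :> R by rewrite invr_gt0 exprn_gt0.
  case: x => [r _|_|//].
    rewrite sumEFin -EFinM sumr_const card_ffun card_bool card_ord -[r *+ _]mulr_natl natrX.
    by rewrite mulrA mulVf ?mul1r // expf_neq0.
  rewrite (bigD1 [ffun=> false]) //= addye; first by rewrite mulry gtr0_sg // mul1e.
  by rewrite gt_eqF // (lt_le_trans ltNy0) // sume_ge0.
rewrite -/(I0 _) -[leLHS]meanE; last exact: integral_ge0.
under eq_bigr => sg _ do rewrite -(E sg).
rewrite /I0 -ge0_integral_sum // -ge0_integralZl //; last 2 first.
- exact: emeasurable_sum.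
- by move=> w _; apply: sume_ge0.
apply: (@le_trans _ _ (\int[P \x P]_w (cst C%:E w))%E); last first.
  rewrite integral_cst //.
  have le1 (x : \bar R) : x = 1%E -> (C%:E * x <= C%:E)%E by move=> ->; rewrite mule1.
  exact: le1 PP1.
apply: ge0_le_integral => //.
- by move=> w _; rewrite mule_ge0 // sume_ge0.
- by apply: measurable_funeM; exact: emeasurable_sum.
Qed.

(** * Expectations of bounded functions *)

Lemma bounded_integrable (R : realType) d (T : measurableType d) (P : probability T R)
    (f : T -> R) (b : R) :
  measurable_fun setT f -> (forall x, `|f x| <= b) -> P.-integrable setT (EFin \o f).
Proof.
move=> mf fb; apply: measurable_bounded_integrable => //.
  by rewrite -ge0_fin_numE ?fin_num_measure.
exists b; split; first exact: num_real.
by move=> M bM x _ /=; exact: le_trans (fb x) (ltW bM).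
Qed.

Lemma bounded_integralE (R : realType) d (T : measurableType d) (P : probability T R)
    (f : T -> R) (b : R) :
  measurable_fun setT f -> (forall x, `|f x| <= b) ->
  (\int[P]_x (f x)%:E = (fine (\int[P]_x (f x)%:E))%:E)%E.
Proof.
move=> mf fb; rewrite fineK //; apply: integrable_fin_num => //.
exact: (bounded_integrable P mf fb).
Qed.

Lemma integral_sample (R : realType) dO dZ (O : measurableType dO)
    (Z : measurableType dZ) (P : probability O R) (D : probability Z R) n
    (S : 'I_n -> {RV P >-> Z}) (f : Z -> R) (b : R) i :
  iid D S -> measurable_fun setT f -> (forall z, `|f z| <= b) ->
  (\int[P]_w (f (S i w))%:E = \int[D]_z (f z)%:E)%E.
Proof.
move=> [SD _] mf fb.
have mS : measurable_fun setT (S i) by exact: measurable_funPT.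
have := @integral_pushforward _ _ O Z R (S i) mS P setT (EFin \o f).
rewrite preimage_setT => <- //.
- apply: (@eq_measure_integral _ _ _ _ D (pushforward P (S i))) => B mB _.
  exact: (SD i B mB).
- exact/measurable_EFinP.
- by apply: (bounded_integrable P (b := b)) => //; exact: measurableT_comp.
Qed.

(** Applied to the tangent line of an exponential at the mean, this yields
    Jensen's inequality for the ghost sample. *)
Lemma integral_affine_mean (R : realType) dO dZ (O : measurableType dO)
    (Z : measurableType dZ) (P : probability O R) (D : probability Z R) n
    (S : 'I_n -> {RV P >-> Z}) (f : Z -> R) (b mu al be : R) :
  iid D S -> measurable_fun setT f -> (forall z, `|f z| <= b) ->
  (\int[D]_z (f z)%:E = mu%:E)%E ->
  (\int[P]_w (al + be * (\sum_i f (S i w) - n%:R * mu))%:E = al%:E)%E.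
Proof.
move=> SD mf fb fmu.
have mS i : measurable_fun setT (fun w => f (S i w)).
  by apply: measurableT_comp => //; exact: measurable_funPT.
have intf i : P.-integrable setT (fun w => (f (S i w))%:E).
  by apply: (bounded_integrable P (b := b)).
have intc c : P.-integrable setT (fun=> c%:E).
  by apply: (bounded_integrable P (b := `|c|)).
have intsum : P.-integrable setT (fun w => \sum_i (f (S i w))%:E)%E.
  exact: integrable_sum.
have -> : (\int[P]_w (al + be * (\sum_i f (S i w) - n%:R * mu))%:E =
    \int[P]_w ((al - be * (n%:R * mu))%:E + be%:E * \sum_i (f (S i w))%:E))%E.
  by apply: eq_integral => w _; rewrite sumEFin -EFinM -EFinD; congr EFin; ring.
rewrite integralD //; last exact: integrableZl.
rewrite integralZl // integral_sum // integral_cst //.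
under eq_bigr do rewrite (integral_sample _ SD mf fb) fmu.
rewrite sumEFin sumr_const card_ord -[mu *+ n]mulr_natl.
have PT := probability_setT P; rewrite [X in (_ * X)%E]PT mule1.
by rewrite -EFinM -EFinD; congr EFin; ring.
Qed.

(** * Uniform deviation of a countable family *)

Lemma measurable_family_deviation (R : realType) dZ (Z : measurableType dZ) n (h : Z -> R)
    (lam : R) :
  measurable_fun setT h ->
  measurable_fun [set: (n + n).-tuple Z] (fun z : (n + n).-tuple Z =>
    (expR (lam * \sum_(i < n) (h (tnth z (rshift n i)) - h (tnth z (lshift n i)))))%:E).
Proof.
move=> mh; apply/measurable_EFinP; apply: measurableT_comp => //.
apply: measurable_funM => //; apply: measurable_sum => i.
by apply: measurable_funB; apply: measurableT_comp => //; exact: measurable_tnth.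
Qed.

(** A Chernoff bound with a ghost sample. Psi is the supremum over the family
    of the exponentials of lam times the difference between the two empirical
    sums. Where the first sample deviates by eps for some k, the integral of
    Psi over the ghost sample is at least exp (lam n eps), by Jensen's
    inequality; and the double integral of Psi is at most the C of
    finite_class_mgf, by symmetrization. The family is countable so that Psi
    is measurable. The cover acts on a difference of two losses, hence 2 kap.
    *)
Theorem uniform_deviation (R : realType) dO dZ (O : measurableType dO)
    (Z : measurableType dZ) (P : probability O R) (D : probability Z R) n
    (S : 'I_n -> {RV P >-> Z}) (h : nat -> Z -> R) (M : nat) (A kap delta : R) :
  (0 < n)%N -> iid D S -> (forall k, measurable_fun setT (h k)) ->
  0 < A -> (forall k z z', `|h k z - h k z'| <= A) ->
  (forall z z' : 'I_n -> Z, exists (T : finType) (pat : nat -> T),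
     (#|realised pat| <= M)%N /\
     forall k k', pat k = pat k' -> forall i,
       `|h k (z i) - h k' (z i)| <= kap /\ `|h k (z' i) - h k' (z' i)| <= kap) ->
  0 < delta < 1 ->
  exists2 E : set O, measurable E /\ ((1 - delta)%:E <= P E)%E &
    forall w, E w -> forall k,
      (\int[D]_z (h k z)%:E - (n%:R^-1 * \sum_i h k (S i w))%:E <=
       (2 * kap + A * Num.sqrt (2 * (ln M%:R + ln delta^-1) / n%:R))%:E)%E.
Proof.
move=> n0 SD mh A0 hA cov /andP[d0 d1].
have n0R : 0 < n%:R :> R by rewrite ltr0n.
pose b k := `|h k point| + A.
have hb k z : `|h k z| <= b k.
  rewrite -[h k z](subrK (h k point)) (le_trans (ler_normD _ _)) //.
  by rewrite addrC lerD2l.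
pose mu k := fine (\int[D]_z (h k z)%:E).
have muE k : (\int[D]_z (h k z)%:E = (mu k)%:E)%E.
  exact: bounded_integralE (mh k) (hb k).
have M0 : (0 < M)%N.
  have [T [pat [cM _]]] := cov (fun=> point) (fun=> point).
  apply: leq_trans cM; apply/card_gt0P; exists (pat 0%N).
  by rewrite inE; apply/asboolP; exists 0%N.
set L := ln M%:R + ln delta^-1.
have L0 : 0 < L.
  by rewrite ltr_wpDl // ?ln_ge0 ?ler1n // ln_gt0 // invf_gt1.
set eps' := Num.sqrt (2 * L / n%:R); pose eps := 2 * kap + A * eps'.
have e0 : 0 < eps' by rewrite sqrtr_gt0 divr_gt0 // mulr_gt0.
have e2 : eps' ^+ 2 = 2 * L / n%:R by rewrite sqr_sqrtr // ltW // divr_gt0 // mulr_gt0.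
(* This lam minimizes - lam n A eps' + lam^2 n A^2 / 2. *)
pose lam := eps' / A.
have lam0 : 0 < lam by rewrite divr_gt0.
pose dev k (w : O) := mu k - n%:R^-1 * \sum_i h k (S i w).
have mS k i : measurable_fun setT (fun w => h k (S i w)).
  by apply: measurableT_comp => //; exact: measurable_funPT.
have mdev k : measurable_fun setT (dev k).
  apply: measurable_funB => //; apply: measurable_funM => //.
  exact: measurable_sum.
pose bad := \bigcup_k [set w | eps < dev k w].
have mbad : measurable bad.
  apply: bigcup_measurable => k _.
  rewrite (_ : [set w | eps < dev k w] = dev k @^-1` `]eps, +oo[%classic); last first.
    by apply/seteqP; split=> w /=; rewrite in_itv /= andbT.
  by rewrite -[X in measurable X]setTI; apply: mdev.
exists (~` bad); last first.
  move=> w nbad k; rewrite muE -EFinB lee_fin leNgt; apply/negP => bk.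
  by apply: nbad; exists k => //; exact: bk.
split; first exact: measurableC.
rewrite probability_setC // EFinB leeB //.
pose phi k (z : (n + n).-tuple Z) :=
  expR (lam * \sum_(i < n) (h k (tnth z (rshift n i)) - h k (tnth z (lshift n i)))).
pose Psi (z : (n + n).-tuple Z) := esups (fun k => (phi k z)%:E) 0.
have PsiE z : Psi z = ereal_sup (EFin @` [set phi k z | k in setT]).
  by rewrite /Psi /esups /sdrop /= image_comp; congr ereal_sup; apply/seteqP; split=> x [k _ <-]; exists k.
have Psi_ge k z : ((phi k z)%:E <= Psi z)%E.
  by rewrite PsiE; apply: ereal_sup_ubound; exists (phi k z) => //; exists k.
have Psi0 z : (0 <= Psi z)%E.
  by apply: le_trans (Psi_ge 0%N z); rewrite lee_fin expR_ge0.
have mPsi : measurable_fun [set: (n + n).-tuple Z] Psi.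
  by apply: measurable_fun_esups => k; exact: measurable_family_deviation.
pose tup sg w := [tuple swapped (fun i => S i) sg j w | j < n + n].
have phi_tup k sg w : phi k (tup sg w) =
    expR (lam * \sum_i (-1) ^+ sg i * (h k (S i w.2) - h k (S i w.1))).
  rewrite /phi; congr expR; congr (_ * _); apply: eq_bigr => i _.
  rewrite /tup !tnth_mktuple /swapped (unsplitK (inl i)) (unsplitK (inr i)).
  by case: (sg i); rewrite ?expr1 ?expr0 ?mul1r ?mulN1r ?opprB.
pose C := M%:R * expR (lam * n%:R * (2 * kap) + lam ^+ 2 * n%:R * A ^+ 2 / 2).
have sym : (\int[P \x P]_w Psi (tup [ffun=> false] w) <= C%:E)%E.
  apply: symmetrization SD mPsi Psi0 _ => w.
  under eq_bigr => sg _ do rewrite -/(tup sg w) PsiE.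
  apply: (@mean_ereal_sup_le _ _ _ _ (expR (lam * (n%:R * A)))).
  - by rewrite invr_ge0 exprn_ge0.
  - by move=> sg; exists (phi 0%N (tup sg w)), 0%N.
  - move=> sg _ [k _ <-]; rewrite phi_tup ler_expR ler_pM2l //.
    apply: (@le_trans _ _ (\sum_(i < n) A)); last by rewrite sumr_const card_ord mulr_natl.
    apply: ler_sum => i _; apply: (le_trans (ler_norm _)).
    by rewrite normrM normrX normrN1 expr1n mul1r.
  move=> g gP; have /choice[k kP] : forall sg, exists k, g sg = phi k (tup sg w).
    by move=> sg; have [k _ <-] := gP sg; exists k.
  have [T [pat [cM patP]]] := cov (fun i => S i w.1) (fun i => S i w.2).
  have := @finite_class_mgf R n nat (fun k i => h k (S i w.2) - h k (S i w.1)) T pat M A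
    (2 * kap) lam cM (ltW lam0) (fun k i => hA k _ _).
  rewrite -/C => /(_ _ k) H.
  rewrite (eq_bigr _ (fun sg _ => kP sg)).
  under eq_bigr do rewrite phi_tup.
  apply: H => k1 k2 /patP e i; have [e1 e2'] := e i.
  rewrite (_ : _ - _ = (h k1 (S i w.2) - h k2 (S i w.2)) - (h k1 (S i w.1) - h k2 (S i w.1))).
    by apply: le_trans (ler_normB _ _) _; lra.
  by ring.
have mtup : measurable_fun [set: O * O] (fun w => Psi (tup [ffun=> false] w)).
  apply: (measurableT_comp mPsi); apply/measurable_fun_tnthP => j.
  rewrite [X in measurable_fun _ X](_ : _ = swapped (fun i => S i) [ffun=> false] j).
    exact: measurable_swapped.
  by apply/funext => w; rewrite /= tnth_mktuple.
pose G w1 := (\int[P]_w2 Psi (tup [ffun=> false] (w1, w2)))%E.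
have mG : measurable_fun setT G by exact: (measurable_fun_fubini_tonelli_F _ mtup (fun=> Psi0 _)).
have G0 w : (0 <= G w)%E by exact: integral_ge0.
have GC : (\int[P]_w G w <= C%:E)%E.
  by apply: le_trans sym; rewrite (fubini_tonelli1 _ mtup (fun=> Psi0 _)).
have mphi k w1 : measurable_fun setT (fun w2 => (phi k (tup [ffun=> false] (w1, w2)))%:E).
  have mk : measurable_fun [set: (n + n).-tuple Z] (fun z => (phi k z)%:E).
    exact: measurable_family_deviation.
  apply: (measurableT_comp mk); apply/measurable_fun_tnthP => j.
  rewrite [X in measurable_fun _ X](_ : _ =
      (fun w2 => swapped (fun i => S i) [ffun=> false] j (w1, w2))).
    apply: (measurableT_comp (f := swapped (fun i => S i) [ffun=> false] j)).
      exact: measurable_swapped.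
    exact: measurable_pair1.
  by apply/funext => w; rewrite /= tnth_mktuple.
have badG w1 : bad w1 -> ((expR (lam * (n%:R * eps)))%:E <= G w1)%E.
  move=> [k _ bk].
  pose m := lam * (n%:R * mu k - \sum_i h k (S i w1)).
  have le_m : lam * (n%:R * eps) <= m.
    rewrite /m ler_pM2l // -ler_pdivlMl // mulrBr mulrA mulVf ?mul1r ?lt0r_neq0 //.
    exact: ltW.
  apply: (@le_trans _ _ (expR m)%:E); first by rewrite lee_fin ler_expR.
  rewrite -(integral_affine_mean (expR m) (expR m * lam) SD (mh k) (hb k) (muE k)).
  apply: (@le_trans _ _ (\int[P]_w2 (phi k (tup [ffun=> false] (w1, w2)))%:E)%E).
    apply: le_integral => //.
    - apply: (bounded_integrable P (b := `|expR m| + `|expR m * lam| * (n%:R * (b k + `|mu k|)))).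
        apply: measurable_funD => //; apply: measurable_funM => //.
        by apply: measurable_funB => //; exact: measurable_sum.
      move=> w; apply: le_trans (ler_normD _ _) _; rewrite lerD2l normrM ler_wpM2l //.
      apply: le_trans (ler_normB _ _) _; rewrite mulrDr lerD //.
        apply: le_trans (ler_norm_sum _ _ _) _.
        apply: (@le_trans _ _ (\sum_(i < n) b k)); first by apply: ler_sum.
        by rewrite sumr_const card_ord mulr_natl.
      by rewrite normrM ger0_norm // ltW.
    - apply: (bounded_integrable P (b := expR (lam * (n%:R * A)))).
        apply/measurable_EFinP.
        exact: (mphi k w1).
      move=> w; rewrite phi_tup ger0_norm ?expR_ge0 // ler_expR ler_pM2l //.
      apply: (@le_trans _ _ (\sum_(i < n) A)); last by rewrite sumr_const card_ord mulr_natl.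
      apply: ler_sum => i _; apply: (le_trans (ler_norm _)).
      by rewrite normrM normrX normrN1 expr1n mul1r.
    - move=> w _; rewrite lee_fin phi_tup.
      have -> : lam * \sum_i (-1) ^+ [ffun=> false] i * (h k (S i (w1, w).2) - h k (S i (w1, w).1)) =
          m + lam * (\sum_i h k (S i w) - n%:R * mu k).
        under eq_bigr do rewrite ffunE expr0 mul1r.
        by rewrite sumrB /m /=; ring.
      rewrite expRD -mulrA -[X in X + _]mulr1 -mulrDr ler_wpM2l ?expR_ge0 //.
      exact: expR_ge1Dx.
  apply: ge0_le_integral => //.
  - by move=> w _; rewrite lee_fin expR_ge0.
  - by apply: measurableT_comp mtup _; exact: measurable_pair1.
have main : ((expR (lam * (n%:R * eps)))%:E * P bad <= C%:E)%E.
  have mind : measurable_fun setT (fun w => (\1_bad w : R)%:E).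
    by apply/measurable_EFinP; exact: measurable_indic.
  have E0 : (0 <= (expR (lam * (n%:R * eps)))%:E)%E by rewrite lee_fin expR_ge0.
  apply: le_trans GC; rewrite -[X in (_ * P X)%E]setIT -integral_indic //.
  rewrite -ge0_integralZl //.
  apply: ge0_le_integral => //; first exact: measurable_funeM.
  move=> w _; rewrite indicE; case: (boolP (w \in bad)) => [/set_mem/badG|_].
    by rewrite mule1.
  by rewrite mule0.
have : (P bad <= (C / expR (lam * (n%:R * eps)))%:E)%E.
  by rewrite EFinM lee_pdivlMr ?expR_gt0 // muleC.
move=> /le_trans; apply; rewrite lee_fin ler_pdivrMr ?expR_gt0 //.
rewrite /C -[M%:R]lnK ?posrE ?ltr0n // -[delta in leRHS]lnK ?posrE // -!expRD ler_expR.
have -> : ln delta = - ln delta^-1 by rewrite lnV ?opprK // posrE.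
have -> : lam * (n%:R * eps) = lam * n%:R * (2 * kap) + n%:R * eps' ^+ 2.
  by rewrite /lam /eps; field; lra.
have -> : lam ^+ 2 * n%:R * A ^+ 2 / 2 = n%:R * eps' ^+ 2 / 2.
  by rewrite /lam; field; lra.
rewrite e2 (_ : n%:R * (2 * L / n%:R) = 2 * L); last by field; lra.
by rewrite /L; lra.
Qed.

(** * Measurability of the loss of a network *)

Lemma l2norm_le_sum (R : realType) m (u : 'cV[R]_m) : l2norm u <= \sum_j `|u j 0|.
Proof.
have s0 : 0 <= \sum_j `|u j 0| by exact: sumr_ge0.
rewrite /l2norm -[leRHS]ger0_norm // -sqrtr_sqr ler_sqrt ?sqr_ge0 // expr2 mulr_suml.
apply: ler_sum => j _; rewrite -(real_normK (num_real (u j 0))) expr2 ler_wpM2l //.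
by rewrite (bigD1 j) //= lerDl sumr_ge0.
Qed.

Lemma l2norm_le_max (R : realType) m (u : 'cV[R]_m) (b : R) : 0 <= b ->
  (forall j, `|u j 0| <= b) -> l2norm u <= b * Num.sqrt m%:R.
Proof.
move=> b0 ub; rewrite /l2norm -[b in leRHS]ger0_norm // -sqrtr_sqr -sqrtrM ?sqr_ge0 //.
rewrite ler_sqrt ?mulr_ge0 ?sqr_ge0 //.
apply: (@le_trans _ _ (\sum_(j < m) b ^+ 2)).
  by apply: ler_sum => j _; rewrite -(real_normK (num_real _)) ler_sqr ?nnegrE.
by rewrite sumr_const card_ord mulr_natr.
Qed.

Lemma measurable_inv (R : realType) : measurable_fun [set: R] (@GRing.inv R).
Proof.
rewrite (_ : @GRing.inv R = (fun y => y * (y ^+ 2) `^ (-1))).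
  apply: measurable_funM => //.
  apply: (measurableT_comp (f := fun y : R => y `^ (-1))); first exact: measurable_powR.
  exact: measurable_funX.
apply/funext => y; rewrite powR_inv1 ?sqr_ge0 //.
have [->|y0] := eqVneq y 0; first by rewrite invr0 mul0r.
by rewrite expr2 invfM mulrA divff // mul1r.
Qed.

Lemma measurable_ev (R : realType) d (T : measurableType d) (V : Type) (e : pexp R V)
    (x : V -> T -> R) :
  (forall v, measurable_fun setT (x v)) -> measurable_fun setT (fun t => ev e (x^~ t)).
Proof.
move=> mx; elim: e => [c|v|e1 IH1 e2 IH2|e1 IH1 e2 IH2] /=.
- exact: measurable_cst.
- exact: mx.
- exact: measurable_funD.
- exact: measurable_funM.
Qed.

(** A K-Lipschitz function is the infimum over rational q of l q y + K |u -
    q|, so its strict sublevel sets are countable unions. *)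
Lemma measurable_Caratheodory (R : realType) d dY (T : measurableType d)
    (Y : measurableType dY) m (l : 'cV[R]_m -> Y -> R) (K : R)
    (u : T -> 'cV[R]_m) (y : T -> Y) :
  0 <= K -> loss_lipschitz l K -> (forall v, measurable_fun setT (l v)) ->
  (forall j, measurable_fun setT (fun t => u t j 0)) -> measurable_fun setT y ->
  measurable_fun setT (fun t => l (u t) (y t)).
Proof.
move=> K0 lK ml mu my mT.
have lip z v w : l v z <= l w z + K * \sum_j `|v j 0 - w j 0|.
  rewrite -lerBlDl; apply: (le_trans (ler_norm _)); apply: (le_trans (lK _ _ _)).
  rewrite ler_wpM2l // (le_trans (l2norm_le_sum _)) //.
  by apply: ler_sum => j _; rewrite !mxE.
pose rv (q : {ffun 'I_m -> rat}) : 'cV[R]_m := \col_j ratr (q j).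
pose F q t := l (rv q) (y t) + K * \sum_j `|u t j 0 - ratr (q j)|.
have mF q : measurable_fun setT (F q).
  apply: measurable_funD; first by apply: measurableT_comp.
  apply: measurable_funM => //; apply: measurable_sum => j.
  by apply: measurableT_comp => //; apply: measurable_funB.
apply: (measurability _ (RGenInftyO.measurableE R)) => //.
move=> _ [_ [a ->] <-]; rewrite setTI.
pose Q k := if unpickle k is Some q then F q @^-1` `]-oo, a[%classic else set0.
rewrite (_ : _ @^-1` _ = \bigcup_k Q k).
  apply: bigcup_measurable => k _; rewrite /Q; case: (unpickle k) => [q|//].
  by rewrite -[X in measurable X]setTI; apply: mF.
apply/seteqP; split=> [t|t [k _]]; last first.
  rewrite /Q; case: (unpickle k) => [q|//] /=; rewrite !in_itv /=; apply: le_lt_trans.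
  apply: le_trans (lip (y t) (u t) (rv q)) _; rewrite lerD2l ler_wpM2l //.
  by apply: ler_sum => j _; rewrite mxE.
rewrite /= in_itv /= => lta; set gap := a - l (u t) (y t).
have gap0 : 0 < gap by rewrite subr_gt0.
pose eta := gap / (2 * K * m%:R + 1).
have den0 : 0 < 2 * K * m%:R + 1 by rewrite ltr_wpDl // !mulr_ge0.
have eta0 : 0 < eta by rewrite divr_gt0.
have /choice[q qP] : forall j, exists q : rat, ratr q \in `]u t j 0 - eta, u t j 0 + eta[.
  by move=> j; apply: rat_in_itvoo; lra.
exists (pickle [ffun j => q j]) => //; rewrite /Q pickleK /= in_itv /= /F.
have close j : `|u t j 0 - ratr ([ffun j => q j] j)| <= eta.
  by have := qP j; rewrite ffunE in_itv /= => /andP[q1 q2]; rewrite ler_norml; lra.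
have sum_le : \sum_j `|u t j 0 - ratr ([ffun j => q j] j)| <= m%:R * eta.
  apply: (@le_trans _ _ (\sum_(j < m) eta)); first exact: ler_sum.
  by rewrite sumr_const card_ord mulr_natl.
have := lip (y t) (rv [ffun j => q j]) (u t).
rewrite (eq_bigr (fun j => `|u t j 0 - ratr ([ffun j => q j] j)|)) => [|j _]; last first.
  by rewrite mxE distrC.
move: sum_le; set s := \sum_j _ => sum_le lipq.
have Ks : K * s <= K * (m%:R * eta) by rewrite ler_wpM2l.
have : 2 * (K * (m%:R * eta)) < gap.
  rewrite (_ : _ * _ = gap * ((2 * K * m%:R) / (2 * K * m%:R + 1))); last first.
    by rewrite /eta; field; lra.
  rewrite gtr_pMr // ltr_pdivrMr //; lra.
rewrite /gap; lra.
Qed.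

Section network_measurable.
Context (R : realType) (a : arch R) (s : nat) (act : activations R s) (L : nat).
Context (dY : measure_display) (Y : measurableType dY).
Let Z : measurableType _ := ((layer_dim a 0).-tuple R * Y)%type.

Lemma measurable_joint_entry (th : parameters a s) (v : joint_var a act L) :
  measurable_fun [set: Z] (fun z : Z => joint_entry th (cvec z.1) v).
Proof.
case: v => [q|j] /=; first exact: measurable_cst.
under eq_fun do rewrite mxE.
by apply: (measurableT_comp (f := (@tnth _ R)^~ j)) => //; exact: measurable_tnth.
Qed.

Lemma measurable_undefined (th : parameters a s) :
  fixes act (p_act th) ->
  measurable [set z : Z | net L th (cvec z.1) = None].
Proof.
move=> fx; have [P [Q [Delta [_ netE]]]] := network_exprs a act (leqnn L).
rewrite (_ : [set z | _] = (fun z : Z => ev Delta (joint_entry th (cvec z.1))) @^-1` [set 0]).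
  rewrite -[X in measurable X]setTI.
  by apply: (measurable_ev Delta (measurable_joint_entry th)).
apply/seteqP; split=> z /=; have [_ ->] := netE th (cvec z.1) fx; first by case: eqP.
by move=> ->; rewrite eqxx.
Qed.

Lemma measurable_network_loss (th : parameters a s) (l : 'cV[R]_(layer_dim a L) -> Y -> R)
    (K : R) :
  0 <= K -> loss_lipschitz l K -> (forall v, measurable_fun setT (l v)) ->
  fixes act (p_act th) ->
  measurable_fun [set: Z] (fun z : Z => loss_at l (net L th) (cvec z.1) z.2).
Proof.
move=> K0 lK ml fx; have [P [Q [Delta [_ netE]]]] := network_exprs a act (leqnn L).
have me e := measurable_ev e (measurable_joint_entry th).
rewrite (_ : (fun z => _) = (fun z : Z =>
  if ev Delta (joint_entry th (cvec z.1)) == 0 then 0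
  else l (\col_j (ev (P j) (joint_entry th (cvec z.1)) /
                  ev (Q j) (joint_entry th (cvec z.1)))) z.2)).
  apply: measurable_fun_ifT => //; first by apply: measurable_fun_eqr => //; exact: me.
  apply: (measurable_Caratheodory K0 lK ml) => // j.
  under eq_fun do rewrite mxE.
  apply: measurable_funM; first exact: me.
  by apply: measurableT_comp; [exact: measurable_inv|exact: me].
apply/funext => z; rewrite /loss_at; have [_ ->] := netE th (cvec z.1) fx.
by case: eqP.
Qed.
End network_measurable.

(** * Centring the loss *)

Lemma probability_setI_ge (R : realType) d (T : measurableType d) (P : probability T R)
    (A B : set T) (a b : R) :
  measurable A -> measurable B -> ((1 - a)%:E <= P A)%E -> ((1 - b)%:E <= P B)%E ->
  ((1 - (a + b))%:E <= P (A `&` B))%E.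
Proof.
move=> mA mB PA PB.
have small C x : measurable C -> ((1 - x)%:E <= P C)%E -> (P (~` C) <= x%:E)%E.
  move=> mC; rewrite probability_setC // EFinB.
  by rewrite leeBlDr // => H; rewrite leeBlDr ?fin_num_measure // addeC.
have mAB : measurable (A `&` B) by exact: measurableI.
have mC : measurable (~` (A `&` B)) by exact: measurableC.
have : (P (~` (A `&` B)) <= (a + b)%:E)%E.
  rewrite setCI; apply: le_trans (measureU2 _ (measurableC mA) (measurableC mB)) _.
  by rewrite EFinD; apply: leeD; exact: small.
move=> H; rewrite -[A `&` B]setCK probability_setC //.
by rewrite EFinB leeB.
Qed.

Lemma sqrtD_le (R : realType) (x y : R) : 0 <= x -> 0 <= y ->
  Num.sqrt (x + y) <= Num.sqrt x + Num.sqrt y.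
Proof.
move=> x0 y0; rewrite -(ler_pXn2r (n := 2)) ?nnegrE ?addr_ge0 ?sqrtr_ge0 //.
rewrite sqrrD !sqr_sqrtr ?addr_ge0 // -addrA [_ *+ 2 + _]addrC addrA lerDl.
by rewrite mulrn_wge0 // mulr_ge0 // sqrtr_ge0.
Qed.

(** Applied to the g k themselves, uniform_deviation would multiply the
    contribution ln M of the cover by their range H, which may be much larger
    than the range A of the differences g k - c. The centre c is a single
    function and needs no cover; c and the differences g k - c get half of
    delta each, and A + Ac <= 3/2 H leads to the constant 3 H. The null set
    bad contains the points where some network is undefined. *)
Lemma centred_deviation (R : realType) dO dZ (O : measurableType dO)
    (Z : measurableType dZ) (P : probability O R) (D : probability Z R) n
    (S : 'I_n -> {RV P >-> Z}) (g : nat -> Z -> R) (c : Z -> R) (bad : set Z)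
    (M : nat) (A Ac H kap delta : R) :
  (0 < n)%N -> iid D S ->
  (forall k, measurable_fun setT (g k)) -> measurable_fun setT c ->
  measurable bad -> D bad = 0%E ->
  0 < A -> 0 < Ac -> A + Ac <= 3 / 2 * H -> 0 <= kap ->
  (forall z z', `|c z - c z'| <= Ac) ->
  (forall k z, ~ bad z -> `|g k z - c z| <= A) ->
  (forall k z z', ~ bad z -> ~ bad z' -> `|(g k z - c z) - (g k z' - c z')| <= A) ->
  (forall z z' : 'I_n -> Z, exists (T : finType) (pat : nat -> T),
     (#|realised pat| <= M)%N /\
     forall k k', pat k = pat k' -> forall i,
       (~ bad (z i) -> `|g k (z i) - g k' (z i)| <= kap) /\
       (~ bad (z' i) -> `|g k (z' i) - g k' (z' i)| <= kap)) ->
  0 < delta < 1 ->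
  exists2 E : set O, measurable E /\ ((1 - delta)%:E <= P E)%E &
    forall w, E w -> (forall i, ~ bad (S i w)) /\ forall k,
      (\int[D]_z (g k z)%:E - (n%:R^-1 * \sum_i g k (S i w))%:E <=
       (2 * kap + A * Num.sqrt (2 * ln M%:R / n%:R)
        + 3 * H * Num.sqrt (ln (2 / delta) / (2 * n%:R)))%:E)%E.
Proof.
move=> n0 SD mg mc mbad Dbad A0 Ac0 AH kap0 cA gA ggA cov /andP[d0 d1].
have n0R : 0 < n%:R :> R by rewrite ltr0n.
pose h k z := if `[< bad z >] then 0 else g k z - c z.
have mind : measurable_fun setT (fun z => `[< bad z >]).
  apply: (measurable_fun_bool true).
  rewrite (_ : _ @^-1` _ = bad) ?setTI //.
  by apply/seteqP; split=> z /= /asboolP.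
have mh k : measurable_fun setT (h k).
  by apply: measurable_fun_ifT => //; apply: measurable_funB.
have hA k z z' : `|h k z - h k z'| <= A.
  rewrite /h; case: (asboolP (bad z)) => bz; case: (asboolP (bad z')) => bz'.
  - by rewrite subrr normr0 ltW.
  - by rewrite sub0r normrN gA.
  - by rewrite subr0 gA.
  - exact: ggA.
have covh (z z' : 'I_n -> Z) : exists (T : finType) (pat : nat -> T),
     (#|realised pat| <= M)%N /\
     forall k k', pat k = pat k' -> forall i,
       `|h k (z i) - h k' (z i)| <= kap /\ `|h k (z' i) - h k' (z' i)| <= kap.
  have [T [pat [cM patP]]] := cov z z'; exists T, pat; split=> // k k' /patP e i.
  have [e1 e2] := e i; rewrite /h; split.
    case: asboolP => [_|/e1]; first by rewrite subrr normr0.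
    by rewrite opprB addrA subrK.
  case: asboolP => [_|/e2]; first by rewrite subrr normr0.
  by rewrite opprB addrA subrK.
have dd : 0 < delta / 2 < 1 by lra.
have [E1 [mE1 PE1] E1P] := uniform_deviation n0 SD mh A0 hA covh dd.
have [E2 [mE2 PE2] E2P] : exists2 E : set O, measurable E /\ ((1 - delta / 2)%:E <= P E)%E &
    forall w, E w -> (\int[D]_z (c z)%:E - (n%:R^-1 * \sum_i c (S i w))%:E <=
       (Ac * Num.sqrt (2 * ln (2 / delta) / n%:R))%:E)%E.
  have cov1 (z z' : 'I_n -> Z) : exists (T : finType) (pat : nat -> T),
     (#|realised pat| <= 1)%N /\
     forall k k' : nat, pat k = pat k' -> forall i : 'I_n,
       `|c (z i) - c (z i)| <= 0 /\ `|c (z' i) - c (z' i)| <= 0.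
    exists unit, (fun=> tt); split; last by move=> k k' _ i; rewrite !subrr normr0.
    by rewrite (leq_trans (max_card _)) // card_unit.
  have [E2 E2m E2P] := uniform_deviation (h := fun=> c) n0 SD (fun=> mc) Ac0 (fun=> cA) cov1 dd.
  exists E2 => // w /E2P /(_ 0%N); rewrite mulr0 add0r ln1 add0r.
  by rewrite invf_div.
pose E3 := \bigcap_i (S i @^-1` (~` bad)).
have mcbad : measurable (~` bad) by exact: measurableC.
have mE3 : measurable E3.
  apply: fin_bigcap_measurable => [|i _]; first exact: finite_finset.
  by rewrite -[X in measurable X]setTI; apply: (measurable_funPT (S i)).
have PE3 : ((1 - 0)%:E <= P E3)%E.
  have [SDl Sind] := SD.
  suff -> : P E3 = 1%E by rewrite subr0.
  apply: etrans (Sind (fun=> ~` bad) (fun=> mcbad)) _.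
  rewrite big1 // => i _; apply: etrans (SDl i _ mcbad) _.
  by rewrite probability_setC // Dbad sube0.
exists (E1 `&` E2 `&` E3).
  split; first by do 2 (apply: measurableI => //).
  rewrite (_ : 1 - delta = 1 - (delta / 2 + delta / 2 + 0)); last by field.
  apply: probability_setI_ge => //; first exact: measurableI.
  exact: probability_setI_ge.
move=> w [[/E1P E1w /E2P E2w] E3w]; split=> [i|k]; first exact: E3w.
have cb z : `|c z| <= `|c point| + Ac.
  by rewrite -[c z](subrK (c point)) (le_trans (ler_normD _ _)) // addrC lerD2l.
have hb z : `|h k z| <= A.
  by rewrite /h; case: asboolP => [_|nb]; [rewrite normr0 ltW|exact: gA].
have -> : (\int[D]_z (g k z)%:E = \int[D]_z (h k z)%:E + \int[D]_z (c z)%:E)%E.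
  rewrite -integralD //; last 2 first.
  - exact: (bounded_integrable D (mh k) hb).
  - exact: (bounded_integrable D mc cb).
  apply: ae_eq_integral => //.
  - exact/measurable_EFinP.
  - by apply: emeasurable_funD; exact/measurable_EFinP.
  exists bad; split=> // z nz; apply: contrapT => nb; apply: nz => _ /=.
  by rewrite /h asboolF // -EFinD subrK.
have -> : \sum_i g k (S i w) = \sum_i h k (S i w) + \sum_i c (S i w).
  rewrite -big_split /=; apply: eq_bigr => i _.
  by rewrite /h asboolF ?subrK //; exact: E3w.
have := E1w k; have := E2w.
rewrite (bounded_integralE D (mh k) hb) (bounded_integralE D mc cb).
set y := fine _; set x := fine _ => H2 H1.
rewrite -[X in (X <= _)%E]/((x + y - n%:R^-1 *
  (\sum_i h k (S i w) + \sum_i c (S i w)))%:E) lee_fin mulrDr.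
move: H2 H1; rewrite -!EFinB !lee_fin invf_div => H2 H1.
have L0 : 0 <= ln (2 / delta) by rewrite ln_ge0 // ler_pdivlMr //; lra.
have M0 : (0 < M)%N.
  have [T [pat [cM _]]] := cov (fun=> point) (fun=> point).
  apply: leq_trans cM; apply/card_gt0P; exists (pat 0%N).
  by rewrite inE; apply/asboolP; exists 0%N.
have lnM0 : 0 <= ln M%:R :> R by rewrite ln_ge0 // ler1n.
have s1 : Num.sqrt (2 * (ln M%:R + ln (2 / delta)) / n%:R) <=
    Num.sqrt (2 * ln M%:R / n%:R) + Num.sqrt (2 * ln (2 / delta) / n%:R).
  rewrite mulrDr mulrDl; apply: sqrtD_le; by rewrite divr_ge0 ?ler0n // mulr_ge0.
have s2 : Num.sqrt (2 * ln (2 / delta) / n%:R) = 2 * Num.sqrt (ln (2 / delta) / (2 * n%:R)).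
  rewrite (_ : 2 * ln (2 / delta) / n%:R = 2 ^+ 2 * (ln (2 / delta) / (2 * n%:R))).
    by rewrite sqrtrM ?sqr_ge0 // sqrtr_sqr ger0_norm.
  by field; rewrite !lt0r_neq0.
have r0 : 0 <= Num.sqrt (ln (2 / delta) / (2 * n%:R)) by exact: sqrtr_ge0.
have s1' := ler_wpM2l (ltW A0) s1.
have AH' := ler_wpM2r r0 AH.
move: H1 H2 s1'; rewrite s2.
move: AH' r0; set r := Num.sqrt (ln (2 / delta) / _) => AH' r0.
lra.
Qed.

(** * Generalization of networks *)

(** For every rational vector and every precision, a member that close to it
    is picked if there is one. *)
Lemma dense_sequence (R : realType) (I : finType) (Th : Type) (th0 : Th) (e : Th -> I -> R) :
  exists seq : nat -> Th, forall th eta, 0 < eta ->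
    exists k, forall i, `|e (seq k) i - e th i| < eta.
Proof.
pose close (q : {ffun I -> rat} * nat) th := forall i, `|e th i - ratr (q.1 i)| < q.2.+1%:R^-1.
have /choice[pick pickP] : forall q, exists th, (exists th', close q th') -> close q th.
  move=> q; have [[th' cth]|no] := pselect (exists th', close q th'); first by exists th'.
  by exists th0.
exists (fun k => if unpickle k is Some q then pick q else th0) => th eta eta0.
have [r] : exists r, r.+1%:R^-1 < eta / 2.
  exists (Num.truncn (eta / 2)^-1); rewrite invf_plt ?posrE ?divr_gt0 ?ltr0n //.
  exact: truncnS_gt.
move=> rP; have r0 : 0 < r.+1%:R^-1 :> R by rewrite invr_gt0 ltr0n.
have /choice[q qP] : forall i, exists q : rat,
    ratr q \in `]e th i - r.+1%:R^-1, e th i + r.+1%:R^-1[.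
  by move=> i; apply: rat_in_itvoo; rewrite ltrD2l (lt_trans _ r0) // oppr_lt0.
have cl : close ([ffun i => q i], r) th.
  move=> i; rewrite /= ffunE; have := qP i; rewrite in_itv /= => /andP[q1 q2].
  by rewrite ltr_distlC q1 q2.
exists (pickle ([ffun i => q i], r)) => i; rewrite pickleK.
have c1 := cl i; have c2 := pickP _ (ex_intro _ th cl) i.
rewrite /= ffunE in c1; rewrite /= ffunE in c2.
rewrite (_ : _ - _ = (e (pick ([ffun i => q i], r)) i - ratr (q i))
   - (e th i - ratr (q i))); last by ring.
apply: le_lt_trans (ler_normB _ _) _.
by rewrite [ltRHS]splitr ltrD // (lt_trans _ rP).
Qed.

Lemma cvg_ev (R : realType) (V : Type) (e : pexp R V) (x : nat -> V -> R) (y : V -> R) :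
  (forall v, x^~ v @ \oo --> y v) -> (fun j => ev e (x j)) @ \oo --> ev e y.
Proof.
move=> xy; elim: e => [c|v|e1 IH1 e2 IH2|e1 IH1 e2 IH2] /=.
- exact: cvg_cst.
- exact: xy.
- exact: (cvgD IH1 IH2).
- exact: (cvgM IH1 IH2).
Qed.

Lemma cvg_finite_sum (R : realType) (I : Type) (r : seq I) (f : I -> nat -> R) (l : I -> R) :
  (forall i, f i @ \oo --> l i) ->
  (fun j => \sum_(i <- r) f i j) @ \oo --> \sum_(i <- r) l i.
Proof.
by move=> fl; apply: cvg_big => //; exact: add_continuous.
Qed.

Lemma cvg_of_dist_le (R : realType) (f b : nat -> R) (l : R) :
  (forall j, `|f j - l| <= b j) -> b @ \oo --> 0 -> f @ \oo --> l.
Proof.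
move=> fb b0; apply/cvgrPdist_lt => e e0.
have be : \forall j \near \oo, b j < e by exact: (cvgr_lt _ b0).
near=> j; rewrite distrC; apply: le_lt_trans (fb j) _.
by near: j.
Unshelve. all: by end_near. Qed.

Lemma cvg_network_loss (R : realType) (a : arch R) s (act : activations R s) L (Y : Type)
    (l : 'cV[R]_(layer_dim a L) -> Y -> R) (K : R)
    (ths : nat -> parameters a s) (th : parameters a s) x y :
  0 <= K -> loss_lipschitz l K ->
  (forall j, fixes act (p_act (ths j))) -> fixes act (p_act th) ->
  (forall q : param_index a act L, (fun j => param_entry (ths j) q) @ \oo --> param_entry th q) ->
  net L th x <> None ->
  (fun j => loss_at l (net L (ths j)) x y) @ \oo --> loss_at l (net L th) x y.
Proof.
move=> K0 lK fxs fx conv.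
have [P [Q [Delta [_ netE]]]] := network_exprs a act (leqnn L).
have ce (e : pexp R (joint_var a act L)) :
    (fun j => ev e (joint_entry (ths j) x)) @ \oo --> ev e (joint_entry th x).
  by apply: cvg_ev => -[q|j]; [exact: (conv q)|exact: cvg_cst].
have [Q0 nE] := netE th x fx; rewrite /loss_at nE; case: ifP => // De _.
set u := \col_j _; pose us i := \col_j (ev (P j) (joint_entry (ths i) x) /
                                       ev (Q j) (joint_entry (ths i) x)).
have cu j : (fun i => us i j 0) @ \oo --> u j 0.
  rewrite mxE; under eq_fun do rewrite mxE.
  by apply: cvgM; [exact: ce|apply: cvgV; [exact: Q0|exact: ce]].
have cl : (fun i => l (us i) y) @ \oo --> l u y.
  have bound i : `|l (us i) y - l u y| <= K * \sum_j `|us i j 0 - u j 0|.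
    rewrite (le_trans (lK _ _ _)) // ler_wpM2l //.
    by rewrite (le_trans (l2norm_le_sum _)) //; apply: ler_sum => j _; rewrite !mxE.
  have lim0 : (fun i => K * \sum_j `|us i j 0 - u j 0|) @ \oo --> (0 : R).
    rewrite -[X in _ --> X](mulr0 K); apply: cvgM; first exact: cvg_cst.
    have : forall j, (fun i => `|us i j 0 - u j 0|) @ \oo --> (0 : R).
      move=> j; rewrite -[X in _ --> X](normr0 R); apply: cvg_norm.
      by rewrite -[X in _ --> X](subrr (u j 0)); apply: cvgB => //; exact: cvg_cst.
    by move=> /(cvg_finite_sum (r := index_enum 'I_(layer_dim a L))); rewrite big1.
  exact: cvg_of_dist_le bound lim0.
apply: cvg_trans cl; apply: near_eq_cvg.
have nz : \forall i \near \oo, ev Delta (joint_entry (ths i) x) != 0.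
  exact: (cvgr_neq0 _ (ce Delta) De).
near=> i; have [_ ->] := netE (ths i) x (fxs i).
by rewrite ifT //; near: i.
Unshelve. all: by end_near. Qed.

Lemma hyp_class_parameters (R : realType) (a : arch R) s (act : activations R s) L t f :
  last_within act L t -> hyp_class a act L t f ->
  exists th : class_parameters a act L t, f = net L (sval th).
Proof.
case: act => [rho|] /= imt.
  by move=> [A [b ->]]; exists (exist _ (MakeParameters rho A b) (conj erefl imt)).
move=> [rho [A [b [im ->]]]].
by exists (exist _ (MakeParameters rho A b) (conj Logic.I im)).
Qed.

Lemma cvec_col (R : realType) d n (x : 'I_n -> d.-tuple R) i :
  col i (\matrix_(j < d, i < n) tnth (x i) j) = cvec (x i).
Proof. by apply/colP => j; rewrite !mxE. Qed.

(** Measurability requires a countable family. Networks that are defined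
    almost everywhere are limits, in the parameters, of members of a sequence
    of such networks; the losses converge wherever the limit is defined, in
    particular at the sample points, and their expectations converge by
    dominated convergence. *)
Theorem network_generalizes (R : realType) (a : arch R) s (act : activations R s) L t n
    dY (Y : measurableType dY) (l : 'cV[R]_(layer_dim a L) -> Y -> R) (K H : R)
    (c : Y -> R) (M : nat) (eps A Ac B : R) :
  (0 < L)%N -> (0 < n)%N -> last_within act L t ->
  0 <= K -> 0 <= H -> 0 <= eps -> loss_lipschitz l K -> loss_range l H ->
  (forall X : 'M[R]_(layer_dim a 0, n + n),
     exists (T : finType) (pat : class_parameters a act L t -> T),
     (#|realised pat| <= M)%N /\
     forall th th', pat th = pat th' -> forall i u u',
      net L (sval th) (col i X) = Some u -> net L (sval th') (col i X) = Some u' ->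
      forall j, `|u j 0 - u' j 0| <= eps) ->
  ((forall u, measurable_fun setT (l u)) -> measurable_fun setT c) ->
  0 < A -> 0 < Ac -> A + Ac <= 3 / 2 * H ->
  (forall y y', `|c y - c y'| <= Ac) ->
  (forall (u : 'cV_(layer_dim a L)) y, (forall j, - t <= u j 0 <= t) -> `|l u y - c y| <= A) ->
  (forall (u : 'cV_(layer_dim a L)) y (u' : 'cV_(layer_dim a L)) y',
     (forall j, - t <= u j 0 <= t) -> (forall j, - t <= u' j 0 <= t) ->
     `|(l u y - c y) - (l u' y' - c y')| <= A) ->
  2 * (K * (eps * Num.sqrt (layer_dim a L)%:R)) + A * Num.sqrt (2 * ln M%:R / n%:R) <= 2 * B ->
  generalizes n (hyp_class a act L t) l H B.
Proof.
move=> L0 n0 lw K0 H0 eps0 lK lH cover mc A0 Ac0 AH cAc lA llA bndB ml.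
move=> dO O P D S SD delta d01.
set m := layer_dim a L in l lK lH mc cover lA llA bndB ml *.
pose Z : measurableType _ := ((layer_dim a 0).-tuple R * Y)%type.
have mloss th : fixes act (p_act th) ->
    measurable_fun [set: Z] (fun z : Z => loss_at l (net L th) (cvec z.1) z.2).
  exact: measurable_network_loss K0 lK ml.
have loss_bound (f : pfun R (layer_dim a 0) m) x y : 0 <= loss_at l f x y <= H.
  by rewrite /loss_at; case: (f x) => [u|]; rewrite ?lexx ?H0 //; exact: lH.
pose F' := {th : class_parameters a act L t |
  {ae D, forall z, net L (sval th) (cvec z.1) <> None}}.
set bnd := (2 * B + _)%:E.
have [[th0 _]|noF] := pselect (exists th : F', True); last first.
  exists setT; first by rewrite probability_setT lee_fin; split=> //; lra.
  move=> w _; apply: ge_ereal_sup => _ [f [Ff _ aef] <-]; exfalso; apply: noF.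
  have [th fE] := hyp_class_parameters lw Ff; rewrite fE in aef.
  by exists (exist _ th aef).
pose par (th : F') : parameters a s := sval (sval th).
have [sq sqP] := dense_sequence th0 (fun th => @param_entry R a s act L (par th)).
pose g k (z : Z) := loss_at l (net L (par (sq k))) (cvec z.1) z.2.
pose und k := [set z : Z | net L (par (sq k)) (cvec z.1) = None].
have fixP (th : F') : fixes act (p_act (par th)) by exact: (svalP (sval th)).1.
have imP (th : F') : im_within (p_act (par th) L.-1) t by exact: (svalP (sval th)).2.
have mund k : measurable (und k) by exact: measurable_undefined (fixP (sq k)).
pose bad := \bigcup_k und k.
have mbad : measurable bad by exact: bigcup_measurable.
have Dbad : D bad = 0%E.
  apply/negligibleP => //; apply: negligible_bigcup => k.
  have := svalP (sq k); apply: negligibleS => z /= uz; exact.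
have gdef k (z : Z) : ~ bad z -> exists2 u, net L (par (sq k)) (cvec z.1) = Some u &
    forall j, - t <= u j 0 <= t.
  move=> nb; case E : (net L (par (sq k)) (cvec z.1)) => [u|].
    by exists u => //; exact: net_range L0 (imP (sq k)) E.
  by exfalso; apply: nb; exists k.
have [||||||||E [mE PE] EP] := @centred_deviation R _ _ O Z P D n S g (fun z => c z.2) bad
  M A Ac H (K * (eps * Num.sqrt m%:R)) delta n0 SD _ _ mbad Dbad A0 Ac0 AH.
- by move=> k; apply: mloss; exact: fixP.
- by apply: measurableT_comp => //; exact: mc.
- by rewrite !mulr_ge0 ?sqrtr_ge0.
- by move=> z z'; exact: cAc.
- by move=> k z /(gdef k)[u uE ut]; rewrite /g /loss_at uE; exact: lA.
- move=> k z z' /(gdef k)[u uE ut] /(gdef k)[u' uE' ut'].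
  by rewrite /g /loss_at uE uE'; exact: llA.
- move=> z z'.
  pose x (i : 'I_(n + n)) := match fintype.split i with inl i => (z i).1 | inr i => (z' i).1 end.
  have [T [pat [cM patP]]] := cover (\matrix_(j, i) tnth (x i) j).
  exists T, (fun k => pat (sval (sq k))); split.
    apply: leq_trans cM; apply: subset_leq_card; apply/fintype.subsetP => p.
    by rewrite inE => /asboolP[k <-]; rewrite inE; apply/asboolP; exists (sval (sq k)).
  move=> k k' /patP pk.
  have close i (zi : Z) : x i = zi.1 -> ~ bad zi ->
      `|g k zi - g k' zi| <= K * (eps * Num.sqrt m%:R).
    move=> xi nb; have [u uE _] := gdef k _ nb; have [u' uE' _] := gdef k' _ nb.
    rewrite /g /loss_at uE uE' (le_trans (lK _ _ _)) // ler_wpM2l //.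
    apply: l2norm_le_max => // j; rewrite !mxE.
    by apply: (pk i); rewrite cvec_col xi.
  move=> i; split=> nb.
    by apply: (close (lshift n i)) => //; rewrite /x (unsplitK (inl i)).
  by apply: (close (rshift n i)) => //; rewrite /x (unsplitK (inr i)).
- exact: d01.
exists E => // w /EP [nbad dev]; apply: ge_ereal_sup => _ [f [Ff dX aef] <-].
have [th fE] := hyp_class_parameters lw Ff; rewrite fE in aef dX *.
pose th' : F' := exist _ th aef.
have /choice[ks ksP] : forall j : nat, exists k, forall q,
    `|@param_entry R a s act L (par (sq k)) q - param_entry (par th') q| < j.+1%:R^-1.
  by move=> j; apply: sqP; rewrite invr_gt0 ltr0n.
have conv (q : param_index a act L) :
    (fun j => param_entry (par (sq (ks j))) q) @ \oo --> param_entry (par th') q.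
  by apply: cvg_of_dist_le (@cvg_harmonic R) => j; rewrite ltW //; exact: ksP.
have closs x y : net L (par th') x <> None ->
    (fun j => loss_at l (net L (par (sq (ks j)))) x y) @ \oo --> loss_at l (net L (par th')) x y.
  by apply: cvg_network_loss K0 lK _ (fixP th') conv => j; exact: fixP.
have gb (f1 : pfun R (layer_dim a 0) m) (z : Z) : `|loss_at l f1 (cvec z.1) z.2| <= H.
  by have /andP[l0 l1] := loss_bound f1 (cvec z.1) z.2; rewrite ger0_norm.
have mEF (th1 : F') : measurable_fun [set: Z]
    (fun z : Z => (loss_at l (net L (par th1)) (cvec z.1) z.2)%:E).
  by apply/measurable_EFinP; apply: mloss; exact: fixP.
have int_fine (th1 : F') := bounded_integralE D (mloss _ (fixP th1)) (gb _).
have aecv : {ae D, forall z : Z, setT z ->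
    (fun j => (g (ks j) z)%:E) @ \oo -->
    (loss_at l (net L (par th')) (cvec z.1) z.2)%:E}.
  apply: (filterS _ aef) => z dz _; apply: cvg_EFin; first exact: nearW.
  exact: closs.
have aebd : {ae D, forall (z : Z) (j : nat), setT z -> (`|(g (ks j) z)%:E| <= cst H%:E z)%E}.
  by apply: aeW => z j _; rewrite /= lee_fin; exact: gb.
have intH : D.-integrable setT (cst H%:E).
  exact: (bounded_integrable D (b := `|H|) (measurable_cst H) (fun=> lexx _)).
have [_ _ cint] := dominated_convergence measurableT (fun j => mEF (sq (ks j))) (mEF th')
  aecv intH aebd.
pose mu1 (th1 : F') := fine (\int[D]_z (loss_at l (net L (par th1)) (cvec z.1) z.2)%:E).
have cmu : (fun j => mu1 (sq (ks j))) @ \oo --> mu1 th'.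
  apply: fine_cvg; rewrite -int_fine; exact: cint.
pose er (th1 : F') := n%:R^-1 * \sum_i loss_at l (net L (par th1)) (cvec (S i w).1) (S i w).2.
have cer : (fun j => er (sq (ks j))) @ \oo --> er th'.
  apply: cvgM; first exact: cvg_cst.
  apply: cvg_finite_sum => i; apply: closs.
  by have := dX i; rewrite (cvec_col (fun i => (S i w).1)).
rewrite -/(par th') int_fine.
under eq_bigr do rewrite (cvec_col (fun i => (S i w).1)).
rewrite -[X in (X <= _)%E]/((mu1 th' - er th')%:E) /bnd lee_fin.
rewrite -(cvg_lim _ (cvgB cmu cer)) //.
apply: limr_le; first by apply/cvg_ex; eexists; exact: cvgB cmu cer.
apply: nearW => j; have := dev (ks j).
rewrite -[X in (X - _)%E]/(\int[D]_z (loss_at l (net L (par (sq (ks j)))) (cvec z.1) z.2)%:E)%E.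
rewrite int_fine -[X in (X <= _)%E]/((mu1 (sq (ks j)) - er (sq (ks j)))%:E) lee_fin.
move=> /le_trans; apply; rewrite lerD2r; exact: bndB.
Qed.

(** * Size of the cover *)

Lemma fan_in_gt0 (R : realType) (a : arch R) L j :
  arch_wf a L -> (j <= L)%N -> (0 < #|fan_in a j|)%N.
Proof.
case: a => [d|k c h w g] /=; first by move=> wf jL; rewrite card_ord wf.
by move=> [k0 wf _] jL; have [c0 _ _] := wf j jL; rewrite !card_prod !card_ord !muln_gt0 c0 k0.
Qed.

Lemma layer_dim_gt0 (R : realType) (a : arch R) L j :
  arch_wf a L -> (j <= L)%N -> (0 < layer_dim a j)%N.
Proof.
case: a => [d|k c h w g] /=; first exact.
by move=> [_ wf _] jL; have [c0 h0 w0] := wf j jL; rewrite !muln_gt0 c0 h0.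
Qed.

Lemma depth_le_num_params (R : realType) (a : arch R) s (act : activations R s) L :
  arch_wf a L -> (L <= num_params a act L)%N.
Proof.
move=> wf; rewrite /num_params (@leq_trans (\sum_(i < L) 1)%N) //.
  by rewrite sum_nat_const card_ord muln1.
apply: (@leq_trans (\sum_(i < L) (num_weights a i + layer_dim a i.+1))); last exact: leq_addr.
apply: leq_sum => i _; rewrite addn_gt0 (layer_dim_gt0 wf (ltn_ord i)) orbT //.
Qed.

(** G is the number of thresholds and D the degree. Only the logarithm
    matters, so it suffices that the base of the power is at most the square
    of the argument of the logarithm on the right. *)
Lemma pattern_count_le (R : realType) (N n d G Pi D : nat) (r : R) :
  (0 < N)%N -> (0 < n)%N -> (0 < d)%N -> (0 < G)%N -> (0 < Pi)%N ->
  (D <= 2 * N * Pi)%N -> 1 <= r -> G%:R <= 3 * (Num.sqrt n%:R * r) ->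
  ln ((N * (4 * ((n + n) * d * G) * D + 2 * N) + 1) ^ N)%:R <=
  2 * N%:R * ln (8 * N%:R * n%:R ^+ 2 * d%:R ^+ 2 * Pi%:R * r) :> R.
Proof.
move=> N0 n0 d0 G0 Pi0 DPi r1 Gr.
set base := (N * _ + 1)%N.
have N1 : 1 <= N%:R :> R by rewrite ler1n.
have n1 : 1 <= n%:R :> R by rewrite ler1n.
have d1 : 1 <= d%:R :> R by rewrite ler1n.
have Pi1 : 1 <= Pi%:R :> R by rewrite ler1n.
have base_le : (base <= 19 * (N ^ 2 * n * d * Pi) * G)%N.
  have H1 : (4 * ((n + n) * d * G) * D <= 4 * ((n + n) * d * G) * (2 * N * Pi))%N.
    by rewrite leq_mul2l DPi orbT.
  have H2 : (1 <= n * d * G * Pi)%N by rewrite !muln_gt0 n0 d0 G0.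
  have H3 : (N * (4 * ((n + n) * d * G) * D) <= N * (4 * ((n + n) * d * G) * (2 * N * Pi)))%N.
    by rewrite leq_mul2l H1 orbT.
  have H4 : (N * N * 1 <= N * N * (n * d * G * Pi))%N by rewrite leq_mul2l H2 orbT.
  have H5 : (1 <= N * N * (n * d * G * Pi))%N.
    by apply: leq_trans H4; rewrite muln1 muln_gt0 N0.
  rewrite /base mulnDr; lia.
set W := 8 * _ * _ * _ * _ * _.
pose q : R := N%:R * n%:R * d%:R * Pi%:R.
have q1 : 1 <= q by rewrite /q !mulr_ege1.
have WE : W = 8 * q * (n%:R * d%:R) * r by rewrite /W /q; ring.
have nd1 : 1 <= n%:R * d%:R :> R by rewrite mulr_ege1.
have W1 : 1 <= W by rewrite WE !mulr_ege1 // ler1n.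
have base0 : (0 < base)%N by rewrite /base addn1.
have sn : Num.sqrt n%:R <= n%:R :> R.
  rewrite -[leRHS]ger0_norm ?ler0n // -sqrtr_sqr ler_sqrt ?sqr_ge0 //.
  by rewrite expr2 ler_peMl ?ler0n.
rewrite natrX lnXn ?ltr0n // -[ln _ *+ N]mulr_natl -mulrA.
rewrite mulrCA ler_wpM2l ?ler0n //.
rewrite mulr_natl -lnXn ?(lt_le_trans ltr01 W1) // ler_ln ?posrE ?ltr0n //; last first.
  by rewrite exprn_gt0 // (lt_le_trans ltr01 W1).
apply: (@le_trans _ _ (57 * (q * N%:R) * (n%:R * r))).
  apply: (@le_trans _ _ (19 * (q * N%:R) * G%:R)).
    have : base%:R <= (19 * (N ^ 2 * n * d * Pi) * G)%:R :> R by rewrite ler_nat.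
    move=> /le_trans; apply; rewrite !natrM le_eqVlt; apply/orP; left; apply/eqP.
    by rewrite /q; ring.
  have -> : 57 * (q * N%:R) * (n%:R * r) = 19 * (q * N%:R) * (3 * (n%:R * r)) by ring.
  rewrite ler_wpM2l //; first by rewrite !mulr_ge0 ?ler0n // (le_trans ler01 q1).
  by apply: le_trans Gr _; rewrite ler_wpM2l // ler_wpM2r // (le_trans ler01 r1).
have NQ : N%:R <= q.
  by rewrite /q -!mulrA ler_peMr ?ler0n // !mulr_ege1.
have nd : n%:R <= n%:R * d%:R :> R by rewrite ler_peMr ?ler0n.
have q0 := le_trans ler01 q1; have r0 := le_trans ler01 r1.
have nd0 := le_trans ler01 nd1.
rewrite WE; apply: (@le_trans _ _ (64 * (q * q) * ((n%:R * d%:R) * r))).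
  rewrite ler_pM ?mulr_ge0 ?ler0n //; last by rewrite ler_wpM2r.
  rewrite ler_pM ?mulr_ge0 ?ler0n //; last by rewrite ler_wpM2l.
  lra.
rewrite (_ : (_ ^+ 2) = 64 * (q * q) * (((n%:R * d%:R) * r) * ((n%:R * d%:R) * r))); last by ring.
rewrite ler_wpM2l ?mulr_ge0 ?ler0n // ler_peMl ?mulr_ge0 //.
by rewrite mulr_ege1.
Qed.

Lemma powR52 (R : realType) (x : R) : 0 <= x -> x `^ (5 / 2) = x ^+ 2 * Num.sqrt x.
Proof.
move=> x0; have -> : 5 / 2 = 2%:R + 2^-1 :> R by field.
rewrite powRD; last by apply/implyP; rewrite gt_eqF // addr_gt0.
by rewrite powR_mulrn // powR12_sqrt.
Qed.

(** The precision eps on the outputs is chosen so that the losses vary by at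
    most alpha / sqrt n, which is absorbed by the other term of the bound. The
    sample is doubled to accommodate a ghost sample. *)
Lemma sample_cover (R : realType) (a : arch R) s (act : activations R s) L n (t K alpha : R) :
  (0 < s)%N -> (0 < L)%N -> (0 < n)%N -> arch_wf a L ->
  0 < K -> 0 < t -> 0 < alpha -> alpha <= t * K * Num.sqrt (layer_dim a L)%:R ->
  let N : R := (num_params a act L)%:R in
  let W := 8 * N * (n * layer_dim a L)%:R `^ (5 / 2) * s%:R ^+ L * (width_prod a L)%:R in
  let Ws := t * W * K / (alpha * Num.sqrt n%:R) in
  let eps := alpha / (Num.sqrt n%:R * (K * Num.sqrt (layer_dim a L)%:R)) in
  exists M : nat,
    [/\ 1 <= Ws, ln M%:R <= 2 * N * ln Ws &
    forall X : 'M[R]_(layer_dim a 0, n + n),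
      exists (T : finType) (pat : class_parameters a act L t -> T),
      (#|realised pat| <= M)%N /\
      forall th th', pat th = pat th' -> forall i u u',
        net L (sval th) (col i X) = Some u -> net L (sval th') (col i X) = Some u' ->
        forall j, `|u j 0 - u' j 0| <= eps].
Proof.
move=> s0 L0 n0 wf K0 t0 al0 alle N W Ws eps.
set d := layer_dim a L in alle W Ws eps *.
have d0 : (0 < d)%N by exact: layer_dim_gt0 wf (leqnn _).
have N0 : (0 < num_params a act L)%N.
  exact: leq_trans L0 (depth_le_num_params act wf).
have n0R : 0 < n%:R :> R by rewrite ltr0n.
have d0R : 0 < d%:R :> R by rewrite ltr0n.
have sn0 : 0 < Num.sqrt n%:R :> R by rewrite sqrtr_gt0.
have sd0 : 0 < Num.sqrt d%:R :> R by rewrite sqrtr_gt0.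
pose r := t * K * Num.sqrt d%:R / alpha.
have r1 : 1 <= r by rewrite ler_pdivlMr // mul1r.
pose Pi := (s ^ L * width_prod a L)%N.
have Pi0 : (0 < Pi)%N.
  rewrite muln_gt0 expn_gt0 s0 /= (width_prodE a L0) big_nat.
  by apply: prodn_cond_gt0 => j /andP[_ /ltnW jL]; exact: fan_in_gt0 wf jL.
have DPi : (layer_degree a s L <= 2 * num_params a act L * Pi)%N.
  have Lp : L = L.-1.+1 by rewrite prednK.
  have := @layer_degree_le R a s L.-1 s0 _; rewrite -Lp => /(_ _)/leq_trans; apply.
    by move=> j jL; apply: fan_in_gt0 wf _; rewrite (leq_trans jL) // leq_pred.
  rewrite /Pi (width_prodE a L0) leq_mul2r leq_mul2l /=.
  by rewrite (depth_le_num_params act wf) orbT.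
(* The grid covers [-t, t] with step eps: 2 t / eps = 2 r sqrt n. *)
pose G := (Num.truncn (2 * (Num.sqrt n%:R * r))).+1.
have q1 : 1 <= Num.sqrt n%:R * r.
  by rewrite mulr_ege1 // -[leLHS]sqrtr1 ler_sqrt ?ler1n ?ler0n.
have Gr : G%:R <= 3 * (Num.sqrt n%:R * r).
  have : (Num.truncn (2 * (Num.sqrt n%:R * r)))%:R <= 2 * (Num.sqrt n%:R * r).
    have q2 : 0 <= 2 * (Num.sqrt n%:R * r) by rewrite mulr_ge0 // (le_trans ler01 q1).
    by have /andP[] := truncn_itv q2.
  by rewrite /G -natr1; lra.
have eps0 : 0 < eps by rewrite divr_gt0 // !mulr_gt0.
have tG : 2 * t <= G%:R * eps.
  have -> : 2 * t = 2 * (Num.sqrt n%:R * r) * eps.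
    by rewrite /r /eps; field; rewrite !lt0r_neq0.
  by rewrite ler_wpM2r ?ltW //; exact: truncnS_gt.
have WsE : Ws = 8 * N * n%:R ^+ 2 * d%:R ^+ 2 * Pi%:R * r.
  rewrite /Ws /W powR52 ?ler0n // /r /Pi !natrM natrX sqrtrM ?ler0n //.
  by field; rewrite !lt0r_neq0.
have cnt := pattern_count_le N0 n0 d0 (ltn0Sn _) Pi0 DPi r1 Gr.
exists ((num_params a act L * (4 * ((n + n) * d * G) * layer_degree a s L +
  2 * num_params a act L) + 1) ^ num_params a act L)%N; split.
- rewrite WsE mulr_ege1 // !mulr_ege1 ?exprn_ege1 ?ler1n //.
- by rewrite WsE.
- by move=> X; exact: network_cover.
Qed.

Lemma loss_at_bounds (R : realType) d m (Y : Type) (l : 'cV[R]_m -> Y -> R) H (f : pfun R d m) x y :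
  0 <= H -> loss_range l H -> 0 <= loss_at l f x y <= H.
Proof. by move=> H0 lH; rewrite /loss_at; case: (f x) => [u|]; rewrite ?lexx ?H0. Qed.

Lemma rademacher_le_range (R : realType) d m n (Y : Type) (F : set (pfun R d m))
    (l : 'cV[R]_m -> Y -> R) H (X : 'M[R]_(d, n)) (y : 'I_n -> Y) :
  (0 < n)%N -> 0 <= H -> loss_range l H -> (rademacher F l X y <= H%:E)%E.
Proof.
move=> n0 H0 lH.
have lb f x y' := @loss_at_bounds R d m Y l H f x y' H0 lH.
have := @rademacher_le R d m n Y F l X y (pfun R d m) id unit (fun=> tt) 1
  (fun=> 0) H H n0 _ _ H0 _ _.
rewrite ln1 mulr0 mul0r sqrtr0 mulr0 addr0; apply.
- by move=> f _; exists f.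
- by rewrite (leq_trans (max_card _)) // card_unit.
- by move=> f i _; have /andP[l0 l1] := lb f (col i X) (y i); rewrite subr0 ger0_norm.
- move=> f f' _ i _ _; have /andP[l0 l1] := lb f (col i X) (y i).
  have /andP[l0' l1'] := lb f' (col i X) (y i).
  by rewrite ler_norml; apply/andP; split; lra.
Qed.

Lemma generalizes_trivial (R : realType) (a : arch R) s (act : activations R s) L t n
    dY (Y : measurableType dY) (l : 'cV[R]_(layer_dim a L) -> Y -> R) K H B :
  last_within act L t -> 0 <= K -> loss_lipschitz l K ->
  0 <= H -> loss_range l H -> H <= 2 * B -> generalizes n (hyp_class a act L t) l H B.
Proof.
move=> lw K0 lK H0 lH HB ml dO O P D S SD delta /andP[d0 d1].
have lb (f : pfun R (layer_dim a 0) (layer_dim a L)) x y' := loss_at_bounds f x y' H0 lH.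
exists setT; first by rewrite probability_setT lee_fin; split=> //; lra.
move=> w _; apply: ge_ereal_sup => _ [f [Ff _ _] <-].
have [[th [fx _]] /= ->] := hyp_class_parameters lw Ff.
have mloss := measurable_network_loss K0 lK ml fx.
apply: (@le_trans _ _ H%:E).
  apply: (@le_trans _ _ (\int[D]_z (loss_at l (net L th) (cvec z.1) z.2)%:E)%E).
    rewrite -[leRHS]adde0 leeD2l // lee_fin oppr_le0 mulr_ge0 ?invr_ge0 ?ler0n // sumr_ge0 // => i _.
    by have /andP[] := lb (net L th) (col i (\matrix_(j, i0) tnth (S i0 w).1 j)) (S i w).2.
  apply: (@le_trans _ _ (\int[D]_z (cst H%:E z))%E); last first.
    have PT := probability_setT D; rewrite integral_cst //.
    have le1 (x : \bar R) : x = 1%E -> (H%:E * x <= H%:E)%E by move=> ->; rewrite mule1.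
    exact: le1 PT.
  apply: ge0_le_integral => //.
  - by move=> z _; rewrite lee_fin; have /andP[] := lb (net L th) (cvec z.1) z.2.
  - exact/measurable_EFinP.
  - by move=> z _; rewrite lee_fin; have /andP[] := lb (net L th) (cvec z.1) z.2.
by rewrite lee_fin (le_trans HB) // lerDl !mulr_ge0 // sqrtr_ge0.
Qed.

(** * Explicit bounds *)

Lemma loss_in_box (R : realType) m (Y : Type) (l : 'cV[R]_m -> Y -> R) K t (u : 'cV[R]_m) y :
  0 <= t -> 0 <= K -> loss_lipschitz l K -> (forall j, - t <= u j 0 <= t) ->
  `|l u y - l 0 y| <= t * K * Num.sqrt m%:R.
Proof.
move=> t0 K0 lK ut; apply: (le_trans (lK _ _ _)).
rewrite [t * K]mulrC -mulrA ler_wpM2l // subr0; apply: l2norm_le_max => // j.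
by rewrite ler_norml.
Qed.

Lemma loss_at_in_box (R : realType) (a : arch R) s (act : activations R s) L t
    (th : class_parameters a act L t) (Y : Type) (l : 'cV[R]_(layer_dim a L) -> Y -> R) x y :
  (0 < L)%N -> net L (sval th) x <> None ->
  exists2 u : 'cV[R]_(layer_dim a L), (forall j, - t <= u j 0 <= t) & loss_at l (net L (sval th)) x y = l u y.
Proof.
move=> L0; rewrite /loss_at; case E: (net L (sval th) x) => [u|//] _; exists u => //.
exact: net_range L0 (svalP th).2 E.
Qed.

(** The losses are centred at 0 if alpha = H, and at the loss of the output 0
    if alpha = t K sqrt d, as the outputs lie in the box [-t, t]^d. For
    generalization, centring at the output 0 gives differences of range 2
    alpha and a centre of range H, which centred_deviation accepts if 4 alpha
    <= H; otherwise the centre 0 is good enough, since H < 4 alpha. If alpha =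
    0, the loss of an output in the box depends on y only, or vanishes. *)
Theorem explicit_bounds (R : realType) (a : arch R) (s L n : nat) (act : activations R s)
    (t H K : R) (dY : measure_display) (Y : measurableType dY)
    (l : 'cV[R]_(layer_dim a L) -> Y -> R) :
  (0 < s)%N -> (0 < L)%N -> (0 < n)%N -> arch_wf a L ->
  0 <= t -> 0 <= H -> 0 <= K ->
  last_within act L t -> loss_lipschitz l K -> loss_range l H ->
  let F := hyp_class a act L t in
  let N : R := (num_params a act L)%:R in
  let alpha := Num.min H (t * K * Num.sqrt (layer_dim a L)%:R) in
  let W := 8 * N * (n * layer_dim a L)%:R `^ (5 / 2) * s%:R ^+ L * (width_prod a L)%:R in
  let B := 4 * alpha * Num.sqrt (N / n%:R)
           * (Num.sqrt pi + Num.sqrt (ln (t * W * K / (alpha * Num.sqrt n%:R)))) in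
  (forall y : 'I_n -> Y, (sup_rademacher F l y <= B%:E)%E) /\ generalizes n F l H B.
Proof.
move=> s0 L0 n0 wf t0 H0 K0 lw lK lH F N alpha W B.
set d := layer_dim a L in l lK lH alpha W B *.
have d0 : (0 < d)%N by exact: layer_dim_gt0 wf (leqnn _).
have sd0 : 0 < Num.sqrt d%:R :> R by rewrite sqrtr_gt0 ltr0n.
have sn0 : 0 < Num.sqrt n%:R :> R by rewrite sqrtr_gt0 ltr0n.
have box0 (u : 'cV[R]_d) y := loss_in_box (u := u) y t0 K0 lK.
have unitr (Th : Type) : (#|realised (fun _ : Th => tt)| <= 1)%N.
  by rewrite (leq_trans (max_card _)) // card_unit.
have tK0 : 0 <= t * K * Num.sqrt d%:R by rewrite !mulr_ge0 // sqrtr_ge0.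
have al0 : 0 <= alpha by rewrite le_min H0.
have [al_eq0|al_neq0] := eqVneq alpha 0.
  have B0 : B = 0 by rewrite /B al_eq0 mulr0 !mul0r.
  have [H_eq0|H_neq0] := eqVneq H 0.
    rewrite B0; split=> [y|]; last by apply: generalizes_trivial lw K0 lK H0 lH _; lra.
    apply: ge_ereal_sup => _ [X _ <-]; rewrite -H_eq0.
    exact: rademacher_le_range.
  have tK_eq0 : t * K * Num.sqrt d%:R = 0.
    by move/eqP: al_eq0; rewrite /alpha minEle; case: ifP => _ /eqP // /eqP; rewrite (negbTE H_neq0).
  have lconst (u : 'cV[R]_d) y : (forall j, - t <= u j 0 <= t) -> l u y = l 0 y.
    move=> ut; apply/eqP; rewrite -subr_eq0 -normr_le0 -[leRHS]tK_eq0; exact: box0.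
  have Hp : 0 < H by rewrite lt_neqAle eq_sym H_neq0.
  rewrite B0; split=> [y|].
    apply: ge_ereal_sup => _ [X _ <-].
    have := @rademacher_le R _ _ n Y F l X y (class_parameters a act L t)
      (fun th => net L (sval th)) unit (fun=> tt) 1 (fun i => l 0 (y i)) 0 0 n0 _ (unitr _) (lexx _) _ _.
    rewrite mul0r addr0; apply.
    - by move=> f; exact: hyp_class_parameters.
    - move=> th i /(loss_at_in_box l (y i) L0)[u ut ->].
      by rewrite lconst // subrr normr0.
    - move=> th th' _ i /(loss_at_in_box l (y i) L0)[u ut ->].
      move=> /(loss_at_in_box l (y i) L0)[u' ut' ->].
      by rewrite !lconst // subrr normr0.
  apply: (@network_generalizes R a s act L t n dY Y l K H (l 0) 1 (2 * t) (H / 2) H 0) => //.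
  - by rewrite mulr_ge0.
  - move=> X; exists unit, (fun=> tt); split=> // th th' _ i u u' nu nu' j.
    have /andP[u1 u2] := net_range L0 (svalP th).2 nu j.
    have /andP[u1' u2'] := net_range L0 (svalP th').2 nu' j.
    by rewrite ler_norml; apply/andP; split; lra.
  - lra.
  - lra.
  - move=> y y'; have /andP[l1 l2] := lH 0 y; have /andP[l1' l2'] := lH 0 y'.
    by rewrite ler_norml; apply/andP; split; lra.
  - by move=> u y ut; rewrite lconst // subrr normr0; lra.
  - by move=> u y u' y' ut ut'; rewrite !lconst // !subrr normr0; lra.
  - have -> : K * (2 * t * Num.sqrt d%:R) = 0.
      by rewrite -[RHS](mulr0 2) -tK_eq0; ring.
    by rewrite ln1 mulr0 mul0r sqrtr0 !mulr0 addr0.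
have alp : 0 < alpha by rewrite lt_neqAle eq_sym al_neq0.
have alH : alpha <= H by rewrite /alpha ge_min lexx.
have altK : alpha <= t * K * Num.sqrt d%:R by rewrite /alpha ge_min lexx orbT.
have Hp : 0 < H := lt_le_trans alp alH.
have tp : 0 < t.
  rewrite lt_neqAle t0 andbT; apply/eqP => te; move: (lt_le_trans alp altK).
  by rewrite -te !mul0r ltxx.
have Kp : 0 < K.
  rewrite lt_neqAle K0 andbT; apply/eqP => Ke; move: (lt_le_trans alp altK).
  by rewrite -Ke mulr0 mul0r ltxx.
have [M [Ws1 lnM cover]] := sample_cover act s0 L0 n0 wf Kp tp alp altK.
rewrite -/N -/d -/W in Ws1 lnM.
set Ws := t * W * K / _ in B Ws1 lnM *; set eps := alpha / _ in cover.
have N1 : 1 <= N.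
  by rewrite ler1n; exact: leq_trans L0 (depth_le_num_params act wf).
have N0 := le_trans ler01 N1.
have lnW : 0 <= ln Ws by rewrite ln_ge0.
have kapE : K * (eps * Num.sqrt d%:R) = alpha / Num.sqrt n%:R.
  by rewrite /eps; field; rewrite !lt0r_neq0.
have n0R : 0 < n%:R :> R by rewrite ltr0n.
set rt := Num.sqrt (N / n%:R) in B *.
have rtE : Num.sqrt n%:R^-1 <= rt by rewrite ler_sqrt ?divr_ge0 // ler_peMl // invr_ge0 ltW.
have kap_rt : alpha / Num.sqrt n%:R <= alpha * rt.
  by rewrite ler_wpM2l // -sqrtrV // ltW.
have sqM : Num.sqrt (2 * ln M%:R / n%:R) <= 2 * (rt * Num.sqrt (ln Ws)).
  have Nn0 : 0 <= N / n%:R by rewrite divr_ge0 // ltW.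
  have -> : 2 * (rt * Num.sqrt (ln Ws)) = Num.sqrt (2 ^+ 2 * (N / n%:R * ln Ws)).
    by rewrite sqrtrM ?sqr_ge0 // sqrtr_sqr ger0_norm // sqrtrM.
  rewrite ler_sqrt; last by rewrite !mulr_ge0.
  rewrite (_ : 2 ^+ 2 * _ = 2 * (2 * N * ln Ws) / n%:R); last by field; rewrite lt0r_neq0.
  by rewrite ler_pM2r ?invr_gt0 // ler_pM2l.
have spi : 1 <= Num.sqrt pi :> R.
  by rewrite -[leLHS]sqrtr1 ler_sqrt ?pi_ge0 // (le_trans _ (pi_ge2 R)) // ler1n.
have rt0 : 0 <= rt by exact: sqrtr_ge0.
have art : alpha * rt <= alpha * rt * Num.sqrt pi by rewrite ler_peMr // mulr_ge0.
have sW0 : 0 <= Num.sqrt (ln Ws) by exact: sqrtr_ge0.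
have BE : B = 4 * (alpha * rt * Num.sqrt pi) + 4 * (alpha * (rt * Num.sqrt (ln Ws))).
  by rewrite /B; ring.
have arW0 : 0 <= alpha * (rt * Num.sqrt (ln Ws)) by rewrite !mulr_ge0.
have art0 : 0 <= alpha * rt * Num.sqrt pi by rewrite !mulr_ge0 // sqrtr_ge0.
split=> [y|].
  apply: ge_ereal_sup => _ [X _ <-].
  have [T [pat [cM patP]]] := cover (row_mx X X).
  pose c i := if H <= t * K * Num.sqrt d%:R then 0 else l 0 (y i).
  have colX i : col (lshift n i) (row_mx X X) = col i X.
    by apply/colP => j; rewrite mxE row_mxEl mxE.
  apply: le_trans (@rademacher_le R _ _ n Y F l X y (class_parameters a act L t)
      (fun th => net L (sval th)) T pat M c alpha (alpha / Num.sqrt n%:R) n0 _ cM al0 _ _) _.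
  - by move=> f; exact: hyp_class_parameters.
  - move=> th i /(loss_at_in_box l (y i) L0)[u ut ->].
    rewrite /c /alpha minEle; case: ifP => _; last exact: box0.
    by have /andP[l1 l2] := lH u (y i); rewrite subr0 ger0_norm.
  - move=> th th' /patP pe i; rewrite /loss_at.
    case E: (net L (sval th) _) => [u|//] _; case E': (net L (sval th') _) => [u'|//] _.
    rewrite -kapE (le_trans (lK _ _ _)) // ler_wpM2l //.
    apply: l2norm_le_max => [|j].
      by rewrite divr_ge0 // ltW // !mulr_gt0.
    by rewrite !mxE; apply: (pe (lshift n i)); rewrite colX.
  - rewrite lee_fin BE.
    have : alpha * Num.sqrt (2 * ln M%:R / n%:R) <= alpha * (2 * (rt * Num.sqrt (ln Ws))).
      by rewrite ler_wpM2l.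
    lra.
have eps0 : 0 <= eps by rewrite divr_ge0 // ltW // !mulr_gt0.
(* With centre 0 the centre has range 0, but a positive bound is required: H / 2
   is what the range H of the differences leaves of 3/2 H. *)
have [Hal|alH4] := leP H (4 * alpha).
  apply: (@network_generalizes R a s act L t n dY Y l K H (fun=> 0) M eps H (H / 2) B) => //.
  - lra.
  - lra.
  - by move=> y y'; rewrite subrr normr0; lra.
  - by move=> u y _; have /andP[l1 l2] := lH u y; rewrite subr0 ger0_norm.
  - move=> u y u' y' _ _; rewrite !subr0.
    have /andP[l1 l2] := lH u y; have /andP[l1' l2'] := lH u' y'.
    by rewrite ler_norml; apply/andP; split; lra.
  - rewrite kapE BE.
    have h1 : H * Num.sqrt (2 * ln M%:R / n%:R) <= H * (2 * (rt * Num.sqrt (ln Ws))).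
      by rewrite ler_wpM2l.
    have h2 : H * (2 * (rt * Num.sqrt (ln Ws))) <= 4 * alpha * (2 * (rt * Num.sqrt (ln Ws))).
      by rewrite ler_wpM2r // !mulr_ge0.
    lra.
have alE : alpha = t * K * Num.sqrt d%:R.
  rewrite /alpha minEle; case: ifP => // Hle; move: alH4; rewrite /alpha minEle Hle; lra.
apply: (@network_generalizes R a s act L t n dY Y l K H (l 0) M eps (2 * alpha) H B) => //.
- by rewrite mulr_gt0.
- lra.
- move=> y y'; have /andP[l1 l2] := lH 0 y; have /andP[l1' l2'] := lH 0 y'.
  by rewrite ler_norml; apply/andP; split; lra.
- by move=> u y ut; apply: le_trans (box0 _ _ ut) _; lra.
- move=> u y u' y' ut ut'; apply: le_trans (ler_normB _ _) _.
  by have := box0 u y ut; have := box0 u' y' ut'; lra.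
- rewrite kapE BE.
  have h1 : 2 * alpha * Num.sqrt (2 * ln M%:R / n%:R) <= 2 * alpha * (2 * (rt * Num.sqrt (ln Ws))).
    by rewrite ler_wpM2l // mulr_ge0.
  lra.
Qed.

(** * Asymptotic bounds *)

Lemma leq_bigmaxn (I : eqType) (r : seq I) (x : nat) (F : I -> nat) i :
  i \in r -> (F i <= \big[maxn/x]_(j <- r) F j)%N.
Proof.
elim: r => // j r IH; rewrite inE big_cons leq_max => /orP[/eqP<-|/IH ->].
  by rewrite leqnn.
exact: orbT.
Qed.

Lemma fan_in_le_width (R : realType) (a : arch R) L j :
  (1 <= j < L)%N -> (#|fan_in a j| <= width a L)%N.
Proof.
move=> jL; have jr : j \in index_iota 1 L by rewrite mem_index_iota.
case: a => [d|k c h w g] /=; first by rewrite card_ord; exact: (leq_bigmaxn _ _ jr).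
by rewrite !card_prod !card_ord mulnn mulnC leq_mul2l; apply/orP; right; exact: (leq_bigmaxn _ _ jr).
Qed.

Lemma width_prod_le (R : realType) (a : arch R) s L :
  (0 < L)%N -> (1 < s * width a L)%N -> (s ^ L * width_prod a L <= (s * width a L) ^ L)%N.
Proof.
move=> L0 sw1; have w0 : (0 < width a L)%N by case: (width a L) sw1; rewrite ?muln0.
rewrite expnMn leq_mul2l (width_prodE a L0); apply/orP; right.
apply: (@leq_trans (width a L ^ (L - 1))); last by rewrite leq_pexp2l // leq_subr.
rewrite -prod_nat_const_nat big_nat [leqRHS]big_nat.
by apply: leq_prod => j jL; exact: fan_in_le_width.
Qed.

Lemma ln2_ge_half (R : realType) : 2^-1 <= ln 2 :> R.
Proof.
rewrite -[leLHS]expRK ler_ln ?posrE ?expR_gt0 //.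
have := expR_ge1Dx (- 2^-1 : R); rewrite expRN => h.
have e0 : 0 < expR 2^-1 :> R := expR_gt0 _.
rewrite -[leLHS]invrK invf_ple ?posrE ?invr_gt0 //; lra.
Qed.

Lemma ln_cover_scale_le (R : realType) (a : arch R) (s L n N : nat) (t K alpha : R) :
  (0 < s)%N -> (0 < L)%N -> (0 < n)%N -> (0 < N)%N -> arch_wf a L ->
  (1 < s * width a L)%N -> (N <= n)%N -> 0 < t -> 0 < K -> 0 < alpha ->
  ln (t * (8 * N%:R * (n * layer_dim a L)%:R `^ (5 / 2) * s%:R ^+ L * (width_prod a L)%:R) * K /
      (alpha * Num.sqrt n%:R)) <=
  3 * ln 2 + 3 * ln n%:R + 3 * ln (layer_dim a L)%:R + L%:R * ln (s * width a L)%:R + t * K / alpha.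
Proof.
move=> s0 L0 n0 N0 wf sw1 Nn t0 K0 al0.
have d0 : (0 < layer_dim a L)%N := layer_dim_gt0 wf (leqnn _).
set d := layer_dim a L in d0 *.
have n0R : 0 < n%:R :> R by rewrite ltr0n.
have d0R : 0 < d%:R :> R by rewrite ltr0n.
have sn0 : 0 < Num.sqrt n%:R :> R by rewrite sqrtr_gt0.
have sd0 : 0 < Num.sqrt d%:R :> R by rewrite sqrtr_gt0.
have x0 : 0 < t * K / alpha by rewrite !mulr_gt0 // invr_gt0.
pose Pi := (s ^ L * width_prod a L)%N.
have swp : (0 < s * width a L)%N := ltnW sw1.
have sw0 : 0 < (s * width a L)%:R :> R by rewrite ltr0n.
have Pi0 : (0 < Pi)%N.
  rewrite muln_gt0 expn_gt0 s0 /= (width_prodE a L0) big_nat.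
  by apply: prodn_cond_gt0 => j /andP[_ /ltnW jL]; exact: fan_in_gt0 wf jL.
have -> : t * (8 * N%:R * (n * d)%:R `^ (5 / 2) * s%:R ^+ L * (width_prod a L)%:R) * K /
   (alpha * Num.sqrt n%:R) = 8 * (N%:R * n%:R ^+ 2 * (d%:R ^+ 2 * Num.sqrt d%:R)) * Pi%:R * (t * K / alpha).
  rewrite powR52 ?ler0n // natrM sqrtrM ?ler0n // /Pi natrM natrX.
  by field; rewrite !lt0r_neq0.
have -> : 3 * ln 2 + 3 * ln n%:R + 3 * ln d%:R + L%:R * ln (s * width a L)%:R + t * K / alpha =
    ln (2 ^+ 3 * n%:R ^+ 3 * d%:R ^+ 3 * (s * width a L)%:R ^+ L) + t * K / alpha.
  rewrite !lnM ?posrE ?mulr_gt0 ?exprn_gt0 //.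
  by rewrite !lnXn // !mulr_natl.
have sdd : Num.sqrt d%:R <= d%:R :> R.
  rewrite -[leRHS]ger0_norm ?ler0n // -sqrtr_sqr ler_sqrt ?sqr_ge0 //.
  by rewrite expr2 ler_peMl ?ler0n // ler1n.
rewrite [ln (_ * (t * K / alpha))]lnM ?posrE // ?mulr_gt0 ?exprn_gt0 ?ltr0n //.
apply: lerD; last exact/ltW/ln_sublinear.
rewrite ler_ln ?posrE ?mulr_gt0 ?exprn_gt0 ?ltr0n //.
rewrite (_ : 2 ^+ 3 * _ * _ = 8 * (n%:R * n%:R ^+ 2 * (d%:R ^+ 2 * d%:R))); last by ring.
have n2 : 0 < n%:R ^+ 2 :> R by rewrite exprn_gt0.
have d2 : 0 < d%:R ^+ 2 :> R by rewrite exprn_gt0.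
apply: ler_pM; rewrite ?mulr_ge0 ?ler0n ?(ltW n2) ?(ltW d2) ?(ltW sd0) //; last first.
  by rewrite -natrX ler_nat width_prod_le.
rewrite ler_pM2l //.
apply: ler_pM; rewrite ?mulr_ge0 ?ler0n ?(ltW n2) ?(ltW d2) ?(ltW sd0) //.
  by rewrite ler_pM2r // ler_nat.
by rewrite ler_pM2l.
Qed.

Lemma generalizes_le (R : realType) (d m n : nat) dY (Y : measurableType dY)
    (F : set (pfun R d m)) (l : 'cV[R]_m -> Y -> R) (H B B' : R) :
  B <= B' -> generalizes n F l H B -> generalizes n F l H B'.
Proof.
move=> BB' gB ml dO O P D S SD delta dd.
have [E mE EP] := gB ml dO O P D S SD delta dd.
exists E => // w /EP /le_trans; apply.
by rewrite lee_fin lerD2r ler_pM2l.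
Qed.

(** T0 is a common scale for H and t K. If N >= n, the claimed bound exceeds
    H. Otherwise ln N <= ln n, and all terms of the logarithm are bounded by
    multiples of L log (s D), except ln (t K / alpha), which may be large; but
    alpha^2 ln (t K / alpha) is at most alpha t K. *)
Theorem asymptotic_bounds (R : realType) (a : arch R) (s L n : nat) (act : activations R s)
    (t H K T0 M : R) (dY : measure_display) (Y : measurableType dY)
    (l : 'cV[R]_(layer_dim a L) -> Y -> R) :
  (0 < s)%N -> (0 < L)%N -> (0 < n)%N -> arch_wf a L ->
  0 <= t -> 0 <= H -> 0 <= K -> H <= 2 * T0 -> t * K <= 2 * T0 ->
  last_within act L t -> loss_lipschitz l K -> loss_range l H ->
  let F := hyp_class a act L t in
  let N : R := (num_params a act L)%:R in
  let logsD : R := ln (s * width a L)%:R in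
  (1 < s * width a L)%N ->
  ln (layer_dim a L)%:R <= M * (L%:R * logsD) ->
  ln n%:R <= M * (L%:R * logsD) ->
  let B := (80 + 48 * M) * T0 * ((Num.sqrt n%:R)^-1 * Num.sqrt (N * L%:R * logsD)) in
  (forall y : 'I_n -> Y, (sup_rademacher F l y <= B%:E)%E)
  /\ generalizes n F l H B.
Proof.
move=> s0 L0 n0 wf t0 H0 K0 HT tKT lw lK lH F N logsD sw1 lnd lnn B.
have T00 : 0 <= T0 by lra.
have n0R : 0 < n%:R :> R by rewrite ltr0n.
have sn0 : 0 < Num.sqrt n%:R :> R by rewrite sqrtr_gt0.
pose Lam := L%:R * logsD.
have l2 : ln 2 <= logsD.
  by rewrite /logsD ler_ln ?posrE ?ltr0n ?(ltn_trans _ sw1) // ler_nat.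
have l2h := ln2_ge_half R.
have l2L : ln 2 <= Lam.
  by rewrite (le_trans l2) // ler_peMl ?ler1n //; lra.
have Lam0 : 0 < Lam by lra.
have d0 : (0 < layer_dim a L)%N := layer_dim_gt0 wf (leqnn _).
have M0 : 0 <= M.
  by rewrite -(pmulr_lge0 _ Lam0) (le_trans _ lnd) // ln_ge0 // ler1n.
have Np : (0 < num_params a act L)%N := leq_trans L0 (depth_le_num_params act wf).
have sL : 2^-1 <= Num.sqrt Lam.
  rewrite -[leLHS]ger0_norm // -sqrtr_sqr ler_sqrt ?ltW // expr2; lra.
pose rt := Num.sqrt (N / n%:R).
have rt0 : 0 <= rt := sqrtr_ge0 _.
have N0 : 0 <= N by exact: ler0n.
have BE : B = (80 + 48 * M) * T0 * (rt * Num.sqrt Lam).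
  rewrite /B /rt [N / _]mulrC; congr (_ * _).
  have ni : 0 <= (n%:R)^-1 :> R by rewrite invr_ge0 ler0n.
  by rewrite -sqrtrV ?ler0n // -!sqrtrM ?mulr_ge0 // /Lam !mulrA.
have [nN|Nn] := leqP n (num_params a act L).
  have rt1 : 1 <= rt.
    by rewrite -[leLHS]sqrtr1 ler_sqrt ?divr_ge0 ?ler0n // ler_pdivlMr // mul1r ler_nat.
  have rl : 2^-1 <= rt * Num.sqrt Lam.
    by rewrite (le_trans sL) // ler_peMl // sqrtr_ge0.
  have HB : H <= B.
    rewrite BE (le_trans HT) //.
    have h1 : (80 + 48 * M) * T0 * 2^-1 <= (80 + 48 * M) * T0 * (rt * Num.sqrt Lam).
      by rewrite ler_wpM2l // mulr_ge0 // addr_ge0 // mulr_ge0.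
    have h2 : 0 <= M * T0 by rewrite mulr_ge0.
    lra.
  split=> [y|]; last by apply: (generalizes_trivial lw K0 lK H0 lH); lra.
  apply: ge_ereal_sup => _ [X _ <-].
  by apply: (@le_trans _ _ H%:E); [exact: rademacher_le_range | rewrite lee_fin].
have [] := explicit_bounds s0 L0 n0 wf t0 H0 K0 lw lK lH.
rewrite -/F -/N; set alpha := Num.min _ _; set W := _ * _ ^+ L * _; set Bx := _ * (_ + _).
suff BxB : Bx <= B.
  move=> h1 h2; split=> [y|]; last exact: generalizes_le BxB h2.
  by apply: (le_trans (h1 y)); rewrite lee_fin.
have al0 : 0 <= alpha by rewrite le_min H0 !mulr_ge0 // sqrtr_ge0.
have B0 : 0 <= B by rewrite BE !mulr_ge0 ?sqrtr_ge0 // addr_ge0 // mulr_ge0.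
have [al_eq0|al_neq0] := eqVneq alpha 0; first by rewrite /Bx al_eq0 mulr0 !mul0r.
have alp : 0 < alpha by rewrite lt_neqAle eq_sym al_neq0.
have altK : alpha <= t * K * Num.sqrt (layer_dim a L)%:R by rewrite /alpha ge_min lexx orbT.
have alT : alpha <= 2 * T0 by apply: le_trans HT; rewrite /alpha ge_min lexx.
have tp : 0 < t.
  rewrite lt_neqAle t0 andbT; apply/eqP => te; move: (lt_le_trans alp altK).
  by rewrite -te !mul0r ltxx.
have Kp : 0 < K.
  rewrite lt_neqAle K0 andbT; apply/eqP => Ke; move: (lt_le_trans alp altK).
  by rewrite -Ke mulr0 mul0r ltxx.
have := ln_cover_scale_le s0 L0 n0 Np wf sw1 (ltnW Nn) tp Kp alp.
rewrite -/N -/W -/logsD -/Lam; set lW := ln _ => lWle.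
have {}lWle : lW <= (4 + 6 * M) * Lam + t * K / alpha.
  by move: lnd lnn; rewrite -/Lam => lnd lnn; lra.
have alW : alpha * Num.sqrt lW <= 2 * T0 * Num.sqrt Lam * (6 + 6 * M).
  have c0 : 1 <= 6 + 6 * M by lra.
  have c0' := le_trans ler01 c0.
  have -> : alpha * Num.sqrt lW = Num.sqrt (alpha ^+ 2 * lW).
    by rewrite sqrtrM ?sqr_ge0 // sqrtr_sqr ger0_norm.
  have -> : 2 * T0 * Num.sqrt Lam * (6 + 6 * M) = Num.sqrt ((2 * T0) ^+ 2 * (6 + 6 * M) ^+ 2 * Lam).
    rewrite -exprMn [in RHS]sqrtrM ?sqr_ge0 // sqrtr_sqr ger0_norm; first by ring.
    by rewrite !mulr_ge0.
  rewrite ler_sqrt; last by apply: mulr_ge0; [apply: mulr_ge0; exact: sqr_ge0 | exact: ltW].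
  have a2 : alpha ^+ 2 <= (2 * T0) ^+ 2 by rewrite ler_sqr ?nnegrE // mulr_ge0.
  have h1 : alpha ^+ 2 * lW <= alpha ^+ 2 * ((4 + 6 * M) * Lam) + alpha * (t * K).
    apply: le_trans (_ : alpha ^+ 2 * ((4 + 6 * M) * Lam + t * K / alpha) <= _).
      by rewrite ler_wpM2l ?sqr_ge0.
    by rewrite le_eqVlt; apply/orP; left; apply/eqP; field.
  have h2 : alpha ^+ 2 * ((4 + 6 * M) * Lam) <= (2 * T0) ^+ 2 * ((4 + 6 * M) * Lam).
    by rewrite ler_wpM2r // mulr_ge0 ?(ltW Lam0) // addr_ge0 // mulr_ge0.
  have h3 : alpha * (t * K) <= (2 * T0) ^+ 2.
    by rewrite expr2 ler_pM // mulr_ge0.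
  have h4 : (2 * T0) ^+ 2 <= (2 * T0) ^+ 2 * (2 * Lam).
    by rewrite ler_peMr ?sqr_ge0 //; lra.
  have h5 : (2 * T0) ^+ 2 * ((6 + 6 * M) * Lam) <= (2 * T0) ^+ 2 * ((6 + 6 * M) ^+ 2 * Lam).
    by rewrite ler_wpM2l ?sqr_ge0 // ler_wpM2r ?(ltW Lam0) // expr2 ler_peMr.
  by rewrite -[_ * _ * Lam]mulrA; lra.
have spi : Num.sqrt pi <= 2 :> R.
  rewrite -[leRHS]ger0_norm // -sqrtr_sqr ler_sqrt ?sqr_ge0 //.
  by have := pihalf_lt2 R; lra.
have alpi : alpha * Num.sqrt pi <= 2 * T0 * Num.sqrt Lam * 4.
  have h1 : alpha * Num.sqrt pi <= 2 * T0 * 2 by rewrite ler_pM // sqrtr_ge0.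
  have h2 : 2 * T0 * 2^-1 <= 2 * T0 * Num.sqrt Lam by rewrite ler_wpM2l // mulr_ge0.
  lra.
have -> : Bx = 4 * rt * (alpha * Num.sqrt pi + alpha * Num.sqrt lW).
  by rewrite /Bx -/rt -/lW; ring.
have -> : B = 4 * rt * (2 * T0 * Num.sqrt Lam * 4 + 2 * T0 * Num.sqrt Lam * (6 + 6 * M)).
  by rewrite BE; ring.
by rewrite ler_wpM2l ?mulr_ge0 // lerD.
Qed.

(** * Cross-entropy and conclusion *)

(** Cross-entropy is unbounded. The outputs of a network lie in [-t, t]^m,
    where it agrees with its composite with this projection, which is bounded
    and has the same Lipschitz constant. *)
Definition clip (R : realType) m (t : R) (u : 'cV[R]_m) : 'cV[R]_m :=
  \col_j Num.max (- t) (Num.min t (u j 0)).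

Lemma clip_in_box (R : realType) m (t : R) (u : 'cV[R]_m) j :
  0 <= t -> - t <= clip t u j 0 <= t.
Proof.
by move=> t0; rewrite mxE le_max lexx /= ge_max ge_min lexx /= andbT; lra.
Qed.

Lemma clip_id (R : realType) m (t : R) (u : 'cV[R]_m) :
  (forall j, - t <= u j 0 <= t) -> clip t u = u.
Proof.
move=> ut; apply/colP => j; rewrite mxE; have /andP[u1 u2] := ut j.
by rewrite min_r // max_r.
Qed.

Lemma clip_dist (R : realType) m (t : R) (u v : 'cV[R]_m) j :
  0 <= t -> `|clip t u j 0 - clip t v j 0| <= `|u j 0 - v j 0|.
Proof.
move=> t0; rewrite !mxE; set x := u j 0; set y := v j 0.
have mE z : Num.max (- t) (Num.min t z) = if t < z then t else if z < - t then - t else z.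
  rewrite minEle; case: (ltP t z) => [tz|zt].
    by rewrite (ltW tz) max_r; lra.
  by rewrite maxEge; case: ifP; case: ifP; case: ifP; lra.
rewrite !mE; have := ler_norm (x - y); have := ler_norm (y - x); rewrite [`|y - x|]distrC => h1 h2.
rewrite ler_norml; apply/andP; split; do 4?[case: ifP => [?|/negbT]; rewrite -?leNgt]; lra.
Qed.

Lemma entry_le_l2norm (R : realType) m (u : 'cV[R]_m) j : `|u j 0| <= l2norm u.
Proof.
rewrite -sqrtr_sqr ler_wsqrtr // (bigD1 j) //= lerDl sumr_ge0 // => i _.
exact: sqr_ge0.
Qed.

Lemma l2norm_clip (R : realType) m (t : R) (u v : 'cV[R]_m) :
  0 <= t -> l2norm (clip t u - clip t v) <= l2norm (u - v).
Proof.
move=> t0; rewrite ler_wsqrtr // ler_sum // => j _.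
have := clip_dist u v j t0; rewrite !mxE => h.
by rewrite -[leLHS]real_normK ?num_real // -[leRHS]real_normK ?num_real // ler_sqr ?nnegrE.
Qed.

Lemma expR_le_sum (R : realType) m (z : 'cV[R]_m) (c : 'I_m) :
  expR (z c 0) <= \sum_j expR (z j 0).
Proof. by rewrite (bigD1 c) //= lerDl sumr_ge0 // => j _; exact: expR_ge0. Qed.

Lemma sum_expR_gt0 (R : realType) m (z : 'cV[R]_m) (c : 'I_m) :
  0 < \sum_j expR (z j 0).
Proof. exact: lt_le_trans (expR_gt0 _) (expR_le_sum z c). Qed.

Lemma ce_lossE (R : realType) m (Y : Type) (cls : Y -> 'I_m) (z : 'cV[R]_m) y :
  ce_loss cls z y = ln (\sum_j expR (z j 0)) - z (cls y) 0.
Proof.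
rewrite /ce_loss /cross_entropy /one_hot (bigD1 (cls y)) //= big1 => [|j jc]; last first.
  by rewrite mxE (negbTE jc) /= mul0r.
have S0 := sum_expR_gt0 z (cls y).
by rewrite !mxE !eqxx mul1r addr0 ln_div ?posrE ?expR_gt0 // expRK opprB.
Qed.

Lemma log_sum_exp_le (R : realType) m (u v : 'cV[R]_m) (e : R) (j0 : 'I_m) :
  (forall j, u j 0 <= v j 0 + e) ->
  ln (\sum_j expR (u j 0)) <= ln (\sum_j expR (v j 0)) + e.
Proof.
move=> uv; have S0 (z : 'cV[R]_m) := sum_expR_gt0 z j0.
rewrite -[e]expRK -lnM ?posrE ?expR_gt0 // ler_ln ?posrE ?mulr_gt0 ?expR_gt0 //.
rewrite mulr_suml ler_sum // => j _.
by rewrite -expRD ler_expR.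
Qed.

(** Both ln (sum_j exp z_j) and z_c vary by at most the largest change of a
    coordinate. *)
Lemma ce_loss_lipschitz (R : realType) m (Y : Type) (cls : Y -> 'I_m) :
  loss_lipschitz (ce_loss (R := R) cls) 2.
Proof.
move=> y u v; rewrite !ce_lossE.
have ent j : `|u j 0 - v j 0| <= l2norm (u - v).
  by have := entry_le_l2norm (u - v) j; rewrite !mxE.
have entl j : u j 0 <= v j 0 + l2norm (u - v).
  by have := ent j; rewrite ler_norml => /andP[h1 h2]; lra.
have entr j : v j 0 <= u j 0 + l2norm (u - v).
  by have := ent j; rewrite ler_norml => /andP[h1 h2]; lra.
have h1 := log_sum_exp_le (cls y) entl; have h2 := log_sum_exp_le (cls y) entr.
have := entl (cls y); have := entr (cls y).
by rewrite ler_norml => h3 h4; apply/andP; split; lra.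
Qed.

Lemma ce_loss_in_box (R : realType) m (Y : Type) (cls : Y -> 'I_m) (t : R) (u : 'cV[R]_m) y :
  (forall j, - t <= u j 0 <= t) -> 0 <= ce_loss cls u y <= 2 * t + ln m%:R.
Proof.
move=> ut; rewrite ce_lossE; set c := cls y.
have m0 : (0 < m)%N by exact: leq_ltn_trans (ltn_ord c).
have S0 := sum_expR_gt0 u c.
have h1 : u c 0 <= ln (\sum_j expR (u j 0)).
  by rewrite -[leLHS]expRK ler_ln ?posrE ?expR_gt0 // expR_le_sum.
have h2 : ln (\sum_j expR (u j 0)) <= t + ln m%:R.
  rewrite -[t]expRK -lnM ?posrE ?expR_gt0 ?ltr0n // ler_ln ?posrE ?mulr_gt0 ?expR_gt0 ?ltr0n //.
  rewrite mulr_natr -[m in leRHS]card_ord -sumr_const ler_sum // => j _.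
  by rewrite ler_expR; have /andP[] := ut j.
by have /andP[h3 h4] := ut c; apply/andP; split; lra.
Qed.

Lemma eq_loss_rademacher (R : realType) d m n (Y : Type) (F : set (pfun R d m))
    (l l' : 'cV[R]_m -> Y -> R) (X : 'M[R]_(d, n)) (y : 'I_n -> Y) :
  (forall f x y, F f -> loss_at l f x y = loss_at l' f x y) ->
  rademacher F l X y = rademacher F l' X y.
Proof.
move=> ll'; rewrite /rademacher; congr (_ * _)%E; apply: eq_bigr => sg _.
congr ereal_sup; apply/seteqP; split=> _ [f [Ff Xf] <-]; exists f => //;
  congr EFin; congr (_ * _); apply: eq_bigr => i _; by rewrite ll'.
Qed.

Lemma eq_loss_gen_error (R : realType) d m n dY (Y : measurableType dY)
    (F : set (pfun R d m)) (l l' : 'cV[R]_m -> Y -> R) D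
    (X : 'M[R]_(d, n)) (y : 'I_n -> Y) :
  (forall f x y, F f -> loss_at l f x y = loss_at l' f x y) ->
  gen_error F l D X y = gen_error F l' D X y.
Proof.
move=> ll'; rewrite /gen_error.
congr ereal_sup; apply/seteqP; split=> _ [f [Ff Xf Df] <-]; exists f => //;
  (congr (_ - _)%E; [apply: eq_integral => z _; by rewrite ll' |
   congr EFin; congr (_ * _); apply: eq_bigr => i _; by rewrite ll']).
Qed.

Lemma generalizes_transfer (R : realType) d m n dY (Y : measurableType dY)
    (F : set (pfun R d m)) (l l' : 'cV[R]_m -> Y -> R) H B :
  (forall f x y, F f -> loss_at l f x y = loss_at l' f x y) ->
  ((forall u, measurable_fun setT (l u)) -> forall u, measurable_fun setT (l' u)) ->
  generalizes n F l' H B -> generalizes n F l H B.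
Proof.
move=> ll' mll' gB ml dO O P D S SD delta dd.
have [E mE EP] := gB (mll' ml) dO O P D S SD delta dd.
by exists E => // w /EP; rewrite -(eq_loss_gen_error _ _ _ ll').
Qed.

Theorem corollary3p19 (R : realType) :
  [/\ (exists c c' : R, [/\ 0 < c, 0 < c' &
        forall (a : arch R) (s L n : nat) (act : activations R s) (t H K : R)
               (dY : measure_display) (Y : measurableType dY)
               (l : 'cV[R]_(layer_dim a L) -> Y -> R),
        (0 < s)%N -> (0 < L)%N -> (0 < n)%N -> arch_wf a L ->
        0 <= t -> 0 <= H -> 0 <= K ->
        last_within act L t -> loss_lipschitz l K -> loss_range l H ->
        let F := hyp_class a act L t in
        let N : R := (num_params a act L)%:R in
        let alpha := Num.min H (t * K * Num.sqrt (layer_dim a L)%:R) in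
        let W := c' * N * (n * layer_dim a L)%:R `^ (5 / 2) * s%:R ^+ L
                 * (width_prod a L)%:R in
        let B := c * alpha * Num.sqrt (N / n%:R)
                 * (Num.sqrt pi
                    + Num.sqrt (ln (t * W * K / (alpha * Num.sqrt n%:R)))) in
        (forall y : 'I_n -> Y, (sup_rademacher F l y <= B%:E)%E)
        /\ generalizes n F l H B]),
      (forall M : R, exists C : R,
        forall (a : arch R) (s L n : nat) (act : activations R s) (t H K : R)
               (dY : measure_display) (Y : measurableType dY)
               (l : 'cV[R]_(layer_dim a L) -> Y -> R),
        (0 < s)%N -> (0 < L)%N -> (0 < n)%N -> arch_wf a L ->
        0 <= t <= M -> 0 <= H <= M -> 0 <= K <= M ->
        last_within act L t -> loss_lipschitz l K -> loss_range l H ->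
        let F := hyp_class a act L t in
        let N : R := (num_params a act L)%:R in
        let logsD : R := ln (s * width a L)%:R in
        (1 < s * width a L)%N ->
        ln (layer_dim a L)%:R <= M * (L%:R * logsD) ->
        ln n%:R <= M * (L%:R * logsD) ->
        let B := C * ((Num.sqrt n%:R)^-1 * Num.sqrt (N * L%:R * logsD)) in
        (forall y : 'I_n -> Y, (sup_rademacher F l y <= B%:E)%E)
        /\ generalizes n F l H B)
    & (forall M : R, exists C : R,
        forall (a : arch R) (s L n : nat) (act : activations R s) (t : R)
               (dY : measure_display) (Y : measurableType dY)
               (cls : Y -> 'I_(layer_dim a L)),
        (0 < s)%N -> (0 < L)%N -> (0 < n)%N -> arch_wf a L ->
        0 <= t <= M -> last_within act L t ->
        let F := hyp_class a act L t in
        let l := ce_loss (R := R) cls in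
        let N : R := (num_params a act L)%:R in
        let logsD : R := ln (s * width a L)%:R in
        (1 < s * width a L)%N ->
        ln (layer_dim a L)%:R <= M * (L%:R * logsD) ->
        ln n%:R <= M * (L%:R * logsD) ->
        let B := C * ((Num.sqrt n%:R)^-1 * (t + ln (layer_dim a L)%:R)
                      * Num.sqrt (N * L%:R * logsD)) in
        (forall y : 'I_n -> Y, (sup_rademacher F l y <= B%:E)%E)
        /\ generalizes n F l (2 * t + ln (layer_dim a L)%:R) B)].
Proof.
split.
- exists 4, 8; split=> // a s L n act t H K dY Y l; exact: explicit_bounds.
- move=> M; exists ((80 + 48 * M) * (M + M ^+ 2)).
  move=> a s L n act t H K dY Y l s0 L0 n0 wf /andP[t0 tM] /andP[H0 HM] /andP[K0 KM] lw lK lH.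
  move=> F N logsD sw1 lnd lnn B.
  have M0 : 0 <= M := le_trans t0 tM.
  have M2 : 0 <= M ^+ 2 by exact: sqr_ge0.
  apply: (asymptotic_bounds s0 L0 n0 wf t0 H0 K0 _ _ lw lK lH sw1 lnd lnn); first by lra.
  have : t * K <= M ^+ 2 by rewrite expr2 ler_pM.
  lra.
move=> M; exists (80 + 48 * M).
move=> a s L n act t dY Y cls s0 L0 n0 wf /andP[t0 tM] lw F l N logsD sw1 lnd lnn B.
have d0 : (0 < layer_dim a L)%N := layer_dim_gt0 wf (leqnn _).
have lnd0 : 0 <= ln (layer_dim a L)%:R :> R by rewrite ln_ge0 // ler1n.
pose l' u y := l (clip t u) y.
have ll' f x y : F f -> loss_at l f x y = loss_at l' f x y.
  move=> /(hyp_class_parameters lw)[th ->]; rewrite /loss_at.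
  case E: (net L (sval th) x) => [u|] //; rewrite /l' clip_id //.
  exact: net_range L0 (svalP th).2 E.
have lK' : loss_lipschitz l' 2.
  move=> y u v; apply: (le_trans (ce_loss_lipschitz cls y _ _)).
  by rewrite ler_pM2l // l2norm_clip.
have lH' : loss_range l' (2 * t + ln (layer_dim a L)%:R).
  by move=> u y; apply: ce_loss_in_box => j; exact: clip_in_box.
have H0 : 0 <= 2 * t + ln (layer_dim a L)%:R by lra.
have [] := @asymptotic_bounds R a s L n act t (2 * t + ln (layer_dim a L)%:R) 2
  (t + ln (layer_dim a L)%:R) M dY Y l' s0 L0 n0 wf t0 H0 (ler0n _ _) _ _ lw lK' lH' sw1 lnd lnn.
- lra.
- lra.
rewrite -/F -/N -/logsD (_ : _ * _ * _ = B); last by rewrite /B; ring.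
move=> h1 h2; split=> [y|].
  apply: le_trans (h1 y); apply: ge_ereal_sup => _ [X _ <-].
  by rewrite (eq_loss_rademacher _ _ ll'); apply: ereal_sup_ubound; exists X.
by apply: generalizes_transfer ll' _ h2 => ml u; exact: ml.
Qed.
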